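(* Let $p=p(n)\to\infty$ with $p/n\to\gamma\in(0,\infty)$. Fix $\omega>0$ and $\alpha\in(0,1)$. Then $$\sup_{H\in\mathcal K_n^{\mathrm{rig}}}\big|\mathbb E_{\nu_n(H,\omega)}\varphi_n^U-\beta^*(\omega)\big|\to0,\qquad \beta^*(\omega)=1-\Phi\Big(z_{1-\alpha}-\frac{\omega^2\gamma}{2}\Big).$$
   Context: The sample is $X_t=(X_{1t},\dots,X_{pt})'\in\mathbb R^p$, $t=1,\dots,n$; $\gamma_n=p/n$; $\Phi$ is the standard normal distribution function and $z_{1-\alpha}=\Phi^{-1}(1-\alpha)$. For a symmetric $p\times p$ matrix $H$, $\nu_n(H,\omega)$ is the law of $n$ i.i.d. $N_p(0,\Sigma_\omega(H))$ observations with $\Sigma_\omega(H)^{-1}=I_p+A+A^2$, $A=\omega H/n$. The bulk is $$\mathcal K_n^{\mathrm{rig}}=\{H=H':\ \|H\|_{\mathrm{op}}\le3\sqrt p,\ |p^{-2}\operatorname{tr}(H^2)-1|\le n^{-1/4}\}.$$ The benchmark test is $\varphi_n^U=1\{2U_n/\gamma_n>z_{1-\alpha}\}$ with $$U_n=\frac1{n^2}\sum_{i<j}\sum_{t=2}^nX_{it}X_{jt}\sum_{s<t}X_{is}X_{js}+\frac1{2n^2}\sum_i\sum_{t=2}^n(X_{it}^2-1)\sum_{s<t}(X_{is}^2-1).$$ *)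

(* Defs.v *)
From HB Require Import structures.
From mathcomp Require Import all_boot all_order all_algebra.
From mathcomp Require Import all_classical all_reals all_analysis measurable_realfun.

Set Implicit Arguments.
Unset Strict Implicit.
Unset Printing Implicit Defensive.

Import Order.TTheory GRing.Theory Num.Theory.
Import numFieldTopology.Exports numFieldNormedType.Exports.

Local Open Scope classical_set_scope.
Local Open Scope ring_scope.

Section Product_power.
Context d (T : measurableType d) (R : realType).

Definition cons_pair n (x : T * n.-tuple T) : n.+1.-tuple T :=
  [tuple of x.1 :: x.2].

Lemma measurable_cons_pair n : measurable_fun [set: _] (@cons_pair n).
Proof. exact: (measurable_cons measurable_fst measurable_snd). Qed.

HB.instance Definition _ n :=
  isMeasurableFun.Build _ _ _ _ (@cons_pair n) (@measurable_cons_pair n).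

(* The n-fold product measure P \x ... \x P, i.e. the law of n i.i.d. draws
   from P. *)
Fixpoint iid_law (P : probability T R) (n : nat) :
    probability (n.-tuple T) R :=
  match n with
  | 0 => (\d_([tuple] : 0.-tuple T))%R
  | m.+1 => distribution (P \x iid_law P m)%E (@cons_pair m)
  end.

End Product_power.

Section Gaussian.
Context (R : realType) (p : nat).

Definition lin_map (L : 'M[R]_p) (z : p.-tuple (measurableTypeR R)) :
    p.-tuple R :=
  [tuple \sum_(j < p) L i j * (tnth z j : R) | i < p].

Lemma measurable_lin_map (L : 'M[R]_p) : measurable_fun [set: _] (lin_map L).
Proof.
apply/measurable_fun_tnthP => i.
rewrite (_ : _ \o _ = fun z : p.-tuple (measurableTypeR R) =>
  \sum_(j < p) L i j * (tnth z j : R)).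
  apply: measurable_sum => j; apply: measurable_funM => //.
  exact: measurable_tnth.
by apply/funext => z /=; rewrite /lin_map tnth_mktuple.
Qed.

HB.instance Definition _ (L : 'M[R]_p) :=
  isMeasurableFun.Build _ _ _ _ (lin_map L) (measurable_lin_map L).

(* Such an L exists iff S is symmetric positive semidefinite, in particular for
   the covariance matrices Sigma below; the default 0 is then never used. *)
Definition cov_root (S : 'M[R]_p) : 'M[R]_p :=
  xget 0 [set L : 'M[R]_p | L *m L^T = S].

(* N_p(0, S) is the law of L Z, where L L' = S and Z has independent N(0, 1)
   coordinates; this law does not depend on the choice of L. *)
Definition mvnormal (S : 'M[R]_p) : probability (p.-tuple R) R :=
  distribution (iid_law (normal_prob (0 : R) 1) p) (lin_map (cov_root S)).

End Gaussian.

Section Model.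
Context (R : realType).

Definition Phi (x : R) : R := fine (normal_prob (0 : R) 1 `]-oo, x]).

(* Phi is a bijection from R onto ]0, 1[; outside that range pinv returns a
   default value. *)
Definition Phi_inv : R -> R := pinv [set: R] Phi.

Definition l2norm p (x : 'cV[R]_p) : R := Num.sqrt (\sum_(i < p) x i 0 ^+ 2).

Definition opnorm p (H : 'M[R]_p) : R :=
  sup [set l2norm (H *m x) | x in [set x : 'cV[R]_p | l2norm x <= 1]].

(* For symmetric H, 1 + A + A^2 is positive definite, so invmx is a genuine
   inverse. *)
Definition Sigma n p (omega : R) (H : 'M[R]_p) : 'M[R]_p :=
  let A := (omega / n%:R) *: H in invmx (1%:M + A + A *m A).

Definition nu n p (omega : R) (H : 'M[R]_p) :
    probability (n.-tuple (p.-tuple R)) R :=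
  iid_law (mvnormal (Sigma n omega H)) n.

Definition K_rig n p : set 'M[R]_p :=
  [set H | [/\ H^T = H,
     opnorm H <= 3 * Num.sqrt p%:R &
     `|p%:R ^- 2 * \tr (H *m H) - 1| <= n%:R `^ (- 4^-1)]].

(* Observations are indexed from 0, so that t = 2, ..., n becomes 0 < t < n.
   X i t is the i-th coordinate of the t-th observation. *)
Definition U_stat n p (x : n.-tuple (p.-tuple R)) : R :=
  let X (i : 'I_p) (t : 'I_n) := tnth (tnth x t) i in
  n%:R ^- 2 *
    (\sum_(i < p) \sum_(j < p | (i < j)%N) \sum_(t < n | (0 < t)%N)
       X i t * X j t * \sum_(s < n | (s < t)%N) X i s * X j s)
  + (2 * n%:R ^+ 2)^-1 *
    (\sum_(i < p) \sum_(t < n | (0 < t)%N)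
       (X i t ^+ 2 - 1) * \sum_(s < n | (s < t)%N) (X i s ^+ 2 - 1)).

Definition phi_U (alpha : R) n p (x : n.-tuple (p.-tuple R)) : R :=
  if 2 * U_stat x / (p%:R / n%:R) > Phi_inv (1 - alpha) then 1 else 0.

Definition beta_star (gamma alpha omega : R) : R :=
  1 - Phi (Phi_inv (1 - alpha) - omega ^+ 2 * gamma / 2).

End Model.

(* Main.v *)
From HB Require Import structures.
Require Import Defs.
From mathcomp Require Import all_boot all_order all_algebra.
From mathcomp Require Import all_classical all_reals all_analysis measurable_realfun.
From mathcomp Require Import ring lra.

(** Write the observations as X_t = L Z_t with L L^T = Sigma and Z_t standard
    normal, and put Y_t = X_t X_t^T - 1, G = Sigma - 1, <A, B> = tr (A^T B).
    Grouping diagonal and off-diagonal entries, the test statistic 2 U / (p/n)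
    is (n p)^-1 times the sum of <Y_s, Y_t> over the pairs s < t ([U_statE]).

    The mean.  Since E Y_t = G, the statistic has mean (n - 1) / (2 p) |G|^2,
    which [test_statE] splits off.  The identity (1 + A + A^2)(1 - A) = 1 - A^3
    gives G = - A + Sigma A^3; on the bulk the operator norm of A is of order
    n^(-1/2), so |G|^2 is close to |A|^2 = omega^2 tr (H^2) / n^2, hence to
    omega^2 (p/n)^2, and the mean is close to omega^2 gamma / 2
    ([covB1_expand], [K_rig_bounds], [bulk_regime]).

    The fluctuation.  The centred statistic [mart] is built by adding the
    observations one at a time.  Let S be the sum of the Y's of m observations.
    Given these, the next increment has mean [drift] / (n p), where [drift] =
    <G, S> - m |G|^2 is itself centred, and variance 2 |L^T S L|^2 / (n p)^2.
    As L is close to orthogonal and |S|^2 concentrates around m p^2, this is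
    close to the constant [vstep] = 2 m / n^2; these constants add up to
    1 - 1/n.  All the errors follow from second and fourth moments of quadratic
    forms in normal variables ([Ex_qform2], [Ex_qform4_le]), computed by
    peeling off one coordinate at a time.

    Normality.  The function Phi (y / sqrt tau) solves the heat equation, so
    averaging Phi ((y - D) / sqrt tau) over an increment D of mean about 0 and
    variance about v gives Phi (y / sqrt (tau + v)) up to an error of third
    order ([Phi_step]).  Here that error is O(n^(-3/2)) on average
    ([Ex_step_err_le]).  Telescoping over the n increments yields
    E Phi ((z - mart) / sqrt e) = Phi (z / sqrt (e + 1 - 1/n)) + O(n^(-1/2)),
    with a constant that depends on the bulk matrix only through a bound kappa
    ([mart_clt]).

    For small e the left-hand side is a smoothed distribution function of the
    statistic, and monotonicity of the indicator sandwiches the true one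
    ([indicator_approx]).  Choosing e first and n afterwards bounds the
    deviation of the power from its limit uniformly on the bulk
    ([power_uniform]). *)

Set Implicit Arguments.
Unset Strict Implicit.
Unset Printing Implicit Defensive.

Import Order.TTheory GRing.Theory Num.Theory.
Import numFieldTopology.Exports numFieldNormedType.Exports.
Local Open Scope classical_set_scope.
Local Open Scope ring_scope.

(** * Expectations and finite moments *)

Section Moments.
Context d (T : measurableType d) (R : realType) (P : probability T R).
Implicit Types f g : T -> R.

Definition Ex f : R := fine (\int[P]_x (f x)%:E)%E.

(** All absolute moments are finite.  This class is closed under sums, products
    and domination, so integrability of a polynomial expression is settled by
    the shape of the expression. *)
Definition mom f := measurable_fun setT f /\
  forall k, P.-integrable setT (EFin \o (fun x => `|f x| ^+ k)).

Lemma integrable_dom f g : measurable_fun setT f ->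
  (forall x, `|f x| <= g x) -> P.-integrable setT (EFin \o g) ->
  P.-integrable setT (EFin \o f).
Proof.
move=> mf fg ig; apply: (le_integrable measurableT _ _ ig) => //.
  exact/measurable_EFinP.
move=> x _ /=; rewrite lee_fin (le_trans (fg x))// ler_norm//.
Qed.

Lemma mom_int f : mom f -> P.-integrable setT (EFin \o f).
Proof.
move=> [mf /(_ 1%N) i1]; apply: (integrable_dom mf _ i1) => x.
by rewrite expr1.
Qed.

Lemma mom_meas f : mom f -> measurable_fun setT f.
Proof. by case. Qed.

Lemma mom_dom f g : measurable_fun setT f ->
  (forall x, `|f x| <= `|g x|) -> mom g -> mom f.
Proof.
move=> mf fg [mg ig]; split => // k; apply: (integrable_dom _ _ (ig k)).
  by apply: measurable_funX; exact: measurableT_comp.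
by move=> x; rewrite ger0_norm ?exprn_ge0// lerXn2r ?nnegrE.
Qed.

Lemma mom_cst c : mom (fun=> c).
Proof.
split=> // k.
exact: (@finite_measure_integrable_cst _ _ _ P setT (`|c| ^+ k) measurableT).
Qed.

Lemma integrableDR f g : P.-integrable setT (EFin \o f) ->
  P.-integrable setT (EFin \o g) ->
  P.-integrable setT (EFin \o (fun x => f x + g x)).
Proof.
move=> fi gi; have := integrableD measurableT fi gi.
by apply: eq_integrable.
Qed.

Lemma integrableZR f c : P.-integrable setT (EFin \o f) ->
  P.-integrable setT (EFin \o (fun x => c * f x)).
Proof.
move=> fi; have := integrableZl measurableT c fi.
by apply: eq_integrable.
Qed.

Lemma mom_bnd f c : measurable_fun setT f -> (forall x, `|f x| <= c) -> mom f.
Proof.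
move=> mf fc; apply: (mom_dom mf _ (mom_cst c)) => x.
by rewrite (le_trans (fc x))// ler_norm.
Qed.

Lemma momD f g : mom f -> mom g -> mom (fun x => f x + g x).
Proof.
move=> [mf fi] [mg gi]; split=> [|k]; first exact: measurable_funD.
apply: (@integrable_dom _ (fun x => 2 ^+ k * (`|f x| ^+ k + `|g x| ^+ k))).
- apply: measurable_funX; apply: measurableT_comp => //.
  exact: measurable_funD.
- move=> x; rewrite ger0_norm ?exprn_ge0//.
  wlog le_fg : f g {mf mg fi gi} / `|f x| <= `|g x|.
    move=> H; have [/H//|/ltW/H] := leP `|f x| `|g x|.
    by rewrite (addrC (g x)) (addrC (_ ^+ k)).
  apply: (@le_trans _ _ (2 ^+ k * `|g x| ^+ k)).
    rewrite -exprMn lerXn2r ?nnegrE ?mulr_ge0//.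
    by rewrite (le_trans (ler_normD _ _))// mulr2n mulrDl mul1r lerD2r.
  by rewrite ler_wpM2l ?exprn_ge0// lerDr exprn_ge0.
- exact/integrableZR/integrableDR.
Qed.

Lemma momM f g : mom f -> mom g -> mom (fun x => f x * g x).
Proof.
move=> [mf fi] [mg gi]; split=> [|k]; first exact: measurable_funM.
apply: (@integrable_dom _ (fun x => `|f x| ^+ (k * 2) + `|g x| ^+ (k * 2))).
- apply: measurable_funX; apply: measurableT_comp => //.
  exact: measurable_funM.
- move=> x; rewrite ger0_norm ?exprn_ge0// normrM exprMn !exprM.
  set a := _ ^+ k; set b := _ ^+ k.
  have a0 : 0 <= a by rewrite exprn_ge0.
  have b0 : 0 <= b by rewrite exprn_ge0.
  nra.
- exact: integrableDR.
Qed.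

Lemma momZ c f : mom f -> mom (fun x => c * f x).
Proof. by move=> fm; apply: momM => //; exact: mom_cst. Qed.

Lemma momN f : mom f -> mom (fun x => - f x).
Proof.
move=> fm; have := momZ (-1) fm.
by under eq_fun do rewrite mulN1r.
Qed.

Lemma momB f g : mom f -> mom g -> mom (fun x => f x - g x).
Proof. by move=> fm gm; apply: momD => //; exact: momN. Qed.

Lemma momX f k : mom f -> mom (fun x => f x ^+ k).
Proof.
move=> fm; elim: k => [|k IH].
  by under eq_fun do rewrite expr0; exact: mom_cst.
by under eq_fun do rewrite exprS; exact: momM.
Qed.

Lemma mom_norm f : mom f -> mom (fun x => `|f x|).
Proof.
move=> fm; apply: (mom_dom _ _ fm) => [|x]; last by rewrite normr_id.
by apply: measurableT_comp => //; case: fm.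
Qed.

Lemma mom_sum (I : Type) (r : seq I) (Q : pred I) (F : I -> T -> R) :
  (forall i, mom (F i)) -> mom (fun x => \sum_(i <- r | Q i) F i x).
Proof.
move=> Fm; elim: r => [|i r IH].
  by under eq_fun do rewrite big_nil; exact: mom_cst.
under eq_fun do rewrite big_cons; case: (Q i) => //; exact: momD.
Qed.

Lemma Ex_eq f g : f =1 g -> Ex f = Ex g.
Proof. by move=> /funext ->. Qed.

Lemma Ex_fin f : mom f -> (\int[P]_x (f x)%:E)%E = (Ex f)%:E.
Proof.
move=> fm; rewrite /Ex fineK//; apply: integrable_fin_num => //.
exact: mom_int.
Qed.

Lemma Ex_cst c : Ex (fun=> c) = c.
Proof.
by rewrite /Ex integral_cst//= probability_setT mule1.
Qed.

Lemma ExD f g : mom f -> mom g -> Ex (fun x => f x + g x) = Ex f + Ex g.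
Proof.
move=> fm gm; apply: EFin_inj; rewrite EFinD -!Ex_fin//; last exact: momD.
by under eq_integral do rewrite EFinD; rewrite integralD//; exact: mom_int.
Qed.

Lemma ExZ c f : mom f -> Ex (fun x => c * f x) = c * Ex f.
Proof.
move=> fm; apply: EFin_inj; rewrite EFinM -!Ex_fin//; last exact: momZ.
by under eq_integral do rewrite EFinM; rewrite integralZl//; exact: mom_int.
Qed.

Lemma ExN f : mom f -> Ex (fun x => - f x) = - Ex f.
Proof.
by move=> fm; rewrite -mulN1r -ExZ//; apply: Ex_eq => x; rewrite mulN1r.
Qed.

Lemma ExB f g : mom f -> mom g -> Ex (fun x => f x - g x) = Ex f - Ex g.
Proof.
by move=> fm gm; rewrite ExD ?ExN//; exact: momN.
Qed.

Lemma Ex_sum (I : Type) (r : seq I) (Q : pred I) (F : I -> T -> R) :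
  (forall i, mom (F i)) ->
  Ex (fun x => \sum_(i <- r | Q i) F i x) = \sum_(i <- r | Q i) Ex (F i).
Proof.
move=> Fm; elim: r => [|i r IH].
  by rewrite big_nil -[RHS](Ex_cst 0); apply: Ex_eq => x; rewrite big_nil.
rewrite big_cons; case: ifPn => Qi.
  rewrite -IH -ExD//; last exact: mom_sum.
  by apply: Ex_eq => x; rewrite big_cons Qi.
by rewrite -IH; apply: Ex_eq => x; rewrite big_cons (negbTE Qi).
Qed.

Lemma Ex_ge0 f : (forall x, 0 <= f x) -> 0 <= Ex f.
Proof.
move=> f0; rewrite /Ex fine_ge0//; apply: integral_ge0 => x _.
by rewrite lee_fin.
Qed.

Lemma le_Ex f g : mom f -> mom g -> (forall x, f x <= g x) -> Ex f <= Ex g.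
Proof.
move=> fm gm fg; rewrite -subr_ge0 -ExB//; apply: Ex_ge0 => x.
by rewrite subr_ge0.
Qed.

Lemma Ex_norm f : mom f -> `|Ex f| <= Ex (fun x => `|f x|).
Proof.
move=> fm; rewrite ler_norml -ExN; last exact: mom_norm.
apply/andP; split; apply: le_Ex => //; try exact: mom_norm.
- exact/momN/mom_norm.
- by move=> x; rewrite lerNl -normrN; exact: ler_norm.
- by move=> x; exact: ler_norm.
Qed.

End Moments.

(** * Images, products and independent copies *)

Section Pushforward.
Context d d' (T : measurableType d) (T' : measurableType d') (R : realType).
Variables (P : probability T R) (X : {mfun T >-> T'}).

Lemma mom_distribution (f : T' -> R) : measurable_fun setT f ->
  mom P (f \o X) -> mom (distribution P X) f.
Proof.
move=> mf [_ fi]; split => // k.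
apply/integrableP; split.
  apply/measurable_EFinP; apply: measurable_funX.
  exact: measurableT_comp.
rewrite ge0_integral_distribution//.
  by have /integrableP[] := fi k.
apply: measurableT_comp => //.
apply/measurable_EFinP; apply: measurable_funX.
exact: measurableT_comp.
Qed.

Lemma Ex_distribution (f : T' -> R) : measurable_fun setT f ->
  mom P (f \o X) -> Ex (distribution P X) f = Ex P (f \o X).
Proof.
move=> mf fm; rewrite /Ex integral_distribution//.
  exact/measurable_EFinP.
exact: mom_int fm.
Qed.

End Pushforward.

Section Product.
Context d d' (T : measurableType d) (T' : measurableType d') (R : realType).
Variables (P : probability T R) (Q : probability T' R).

(** Domination is checked through iterated integrals, on which the variable that
    does not appear contributes total mass 1. *)
Lemma mom_fst (f : T -> R) : mom P f -> mom (P \x Q)%E (fun z => f z.1).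
Proof.
move=> [mf fi]; split=> [|k]; first exact: measurableT_comp.
have mfk : measurable_fun setT (fun z : T * T' => `|f z.1| ^+ k).
  by apply: measurable_funX; apply: measurableT_comp => //; exact: measurableT_comp.
apply/integrable12ltyP; first exact/measurable_EFinP.
have /integrableP[_] := fi k; apply: le_lt_trans.
apply: ge0_le_integral => //.
- by move=> x _; exact: integral_ge0.
- apply: (measurable_fun_fubini_tonelli_F
    (fun z : T * T' => `|(`|f z.1| ^+ k)%:E|%E)) => //.
  by apply: measurableT_comp => //; exact/measurable_EFinP.
- apply: measurableT_comp => //; apply/measurable_EFinP.
  by apply: measurable_funX; exact: measurableT_comp.
- by move=> x _ /=; rewrite integral_cst//= probability_setT mule1.
Qed.

Lemma mom_snd (f : T' -> R) : mom Q f -> mom (P \x Q)%E (fun z => f z.2).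
Proof.
move=> [mf fi]; split=> [|k]; first exact: measurableT_comp.
have mfk : measurable_fun setT (fun z : T * T' => `|f z.2| ^+ k).
  by apply: measurable_funX; apply: measurableT_comp => //; exact: measurableT_comp.
apply/integrable21ltyP; first exact/measurable_EFinP.
have /integrableP[_] := fi k; apply: le_lt_trans.
apply: ge0_le_integral => //.
- by move=> x _; exact: integral_ge0.
- apply: (measurable_fun_fubini_tonelli_G
    (fun z : T * T' => `|(`|f z.2| ^+ k)%:E|%E)) => //.
  by apply: measurableT_comp => //; exact/measurable_EFinP.
- apply: measurableT_comp => //; apply/measurable_EFinP.
  by apply: measurable_funX; exact: measurableT_comp.
- by move=> x _ /=; rewrite integral_cst//= probability_setT mule1.
Qed.

Lemma Ex_prod (f : T * T' -> R) : mom (P \x Q)%E f ->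
  (forall y, mom P (fun x => f (x, y))) ->
  Ex (P \x Q)%E f = Ex Q (fun y => Ex P (fun x => f (x, y))).
Proof.
move=> fm fym; rewrite /Ex; congr fine.
rewrite -(integral21_prod_meas1 (mom_int fm)).
apply: eq_integral => y _; rewrite /fubini_G /=.
exact: Ex_fin (fym y).
Qed.

End Product.

Section Iid.
Context d (T : measurableType d) (R : realType) (P : probability T R).

Lemma mom_cons m (f : m.+1.-tuple T -> R) : measurable_fun setT f ->
  mom (P \x iid_law P m)%E (f \o @cons_pair _ T m) -> mom (iid_law P m.+1) f.
Proof. exact: mom_distribution. Qed.

Lemma measurable_thead m : measurable_fun setT (@thead m T).
Proof. exact: measurable_tnth. Qed.

Lemma measurable_tbehead m :
  measurable_fun setT (fun t : m.+1.-tuple T => [tuple of behead t]).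
Proof.
apply/measurable_fun_tnthP => i.
rewrite (_ : _ \o _ = (fun t : m.+1.-tuple T => tnth t (lift ord0 i))).
  exact: measurable_tnth.
by apply/funext => t /=; rewrite tnth_behead; congr tnth; apply/val_inj;
  rewrite /= inordK// ltnS.
Qed.

Lemma mom_head m (f : T -> R) :
  mom P f -> mom (iid_law P m.+1) (fun t => f (thead t)).
Proof.
move=> fm; apply: mom_cons.
  by apply: measurableT_comp; [case: fm|exact: measurable_thead].
rewrite (_ : _ \o _ = fun z => f z.1); first exact: mom_fst.
by apply/funext => z.
Qed.

Lemma mom_behead m (f : m.-tuple T -> R) :
  mom (iid_law P m) f -> mom (iid_law P m.+1) (fun t => f [tuple of behead t]).
Proof.
move=> fm; apply: mom_cons.
  apply: (measurableT_comp (mom_meas fm)); exact: measurable_tbehead.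
rewrite (_ : _ \o _ = fun z => f z.2); first exact: mom_snd.
by apply/funext => z /=; congr f; apply/val_inj.
Qed.

Lemma mom_tnth m (f : T -> R) (i : 'I_m) :
  mom P f -> mom (iid_law P m) (fun t => f (tnth t i)).
Proof.
move=> fm; elim: m i => [[]//|m IH] i.
case: (unliftP ord0 i) => [j|] ->; last exact: mom_head.
have := mom_behead (IH j); congr (mom _ _); apply/funext => t.
by rewrite tnth_behead; congr (f (tnth _ _)); apply/val_inj;
  rewrite /= inordK// ltnS.
Qed.

Lemma mom_comp_cons m (f : m.+1.-tuple T -> R) : mom (iid_law P m.+1) f ->
  mom (P \x iid_law P m)%E (f \o @cons_pair _ T m).
Proof.
move=> [mf fi]; split=> [|k].
  by apply: measurableT_comp => //; exact: measurable_cons_pair.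
apply/integrableP; split.
  apply/measurable_EFinP; apply: measurable_funX; apply: measurableT_comp => //.
  by apply: measurableT_comp => //; exact: measurable_cons_pair.
have /integrableP[_] := fi k; rewrite /= ge0_integral_distribution//.
have mk : measurable_fun setT (fun x => `|f x| ^+ k).
  by apply: measurable_funX; exact: measurableT_comp.
by apply/measurable_EFinP; exact: measurableT_comp mk.
Qed.

(** Conditioning on all observations but the newest one, which is the head of the
    tuple. *)
Lemma Ex_iidS m (f : m.+1.-tuple T -> R) : mom (iid_law P m.+1) f ->
  (forall t, mom P (fun x => f [tuple of x :: tval t])) ->
  Ex (iid_law P m.+1) f =
  Ex (iid_law P m) (fun t => Ex P (fun x => f [tuple of x :: tval t])).
Proof.
move=> fm fxm; rewrite /= Ex_distribution; last exact: mom_comp_cons.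
  by rewrite Ex_prod//; exact: mom_comp_cons.
by case: fm.
Qed.

(** Fubini's theorem gives integrability of the conditional expectation, and this
    is enough to integrate a bound on it. *)
Lemma le_Ex_iidS m (f : m.+1.-tuple T -> R) (g : m.-tuple T -> R) :
  mom (iid_law P m.+1) f -> mom (iid_law P m) g ->
  (forall t, mom P (fun x => f [tuple of x :: tval t])) ->
  (forall t, Ex P (fun x => f [tuple of x :: tval t]) <= g t) ->
  Ex (iid_law P m.+1) f <= Ex (iid_law P m) g.
Proof.
move=> fm gm fxm fg; rewrite Ex_iidS// -lee_fin -[leRHS]Ex_fin//.
have fi := mom_int (mom_comp_cons fm).
have mF := measurable_int _ fi.
have E t : fubini_G P (EFin \o (f \o @cons_pair _ T m)) t =
    (Ex P (fun x => f [tuple of x :: tval t]))%:E.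
  by rewrite /fubini_G -(Ex_fin (fxm t)).
have hi : (iid_law P m).-integrable setT
    (EFin \o (fun t => Ex P (fun x => f [tuple of x :: tval t]))).
  have mG : measurable_fun setT
      (EFin \o (fun t => Ex P (fun x => f [tuple of x :: tval t]))).
    by apply: eq_measurable_fun (measurable_fubini_G fi) => t _; exact: E.
  apply/integrableP; split => //.
  have := (integrable21ltyP P (iid_law P m) mF).1 fi; apply: le_lt_trans.
  apply: ge0_le_integral => //.
  - exact: measurableT_comp.
  - apply: (measurable_fun_fubini_tonelli_G (fun z => `|(EFin \o (f \o @cons_pair _ T m)) z|%E)) => //.
    exact: measurableT_comp.
  - move=> t _; rewrite [X in (`|X| <= _)%E](_ : _ =
        fubini_G P (EFin \o (f \o @cons_pair _ T m)) t); last by rewrite E.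
    apply: le_abse_integral => //.
    by apply/measurable_EFinP; case: (fxm t).
rewrite /Ex fineK; last exact: integrable_fin_num.
apply: le_integral => //; first exact: mom_int gm.
by move=> t _; rewrite lee_fin; exact: fg.
Qed.

End Iid.

(** * The standard normal density *)

Section Normal.
Context (R : realType).
Notation mu := (@lebesgue_measure R).
Implicit Types (x z : R) (f F : R -> R).

Definition phi x : R := normal_pdf 0 1 x.
Definition gauss : probability (measurableTypeR R) R := normal_prob (0 : R) 1.

Lemma phiE x : phi x = normal_peak 1 * expR (- x ^+ 2 / 2).
Proof.
rewrite /phi normal_pdfE ?oner_eq0// /normal_fun subr0 expr1n.
by rewrite -[1 *+ 2]/(2%:R).
Qed.

Lemma phi_ge0 x : 0 <= phi x.
Proof. exact: normal_pdf_ge0. Qed.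

Lemma peak_le1 : normal_peak 1 <= 1 :> R.
Proof.
rewrite /normal_peak expr1n mul1r invf_le1 ?sqrtr_gt0.
  by rewrite -sqrtr1 ler_wsqrtr// mulr2n (le_trans _ (lerD (pi_ge2 _) (pi_ge2 _)))//; lra.
by rewrite mulr2n addr_gt0// pi_gt0.
Qed.

Lemma phi_le1 x : phi x <= 1.
Proof. by rewrite (le_trans (normal_pdf_ub _ _ _))// ?oner_eq0// peak_le1. Qed.

Lemma measurable_phi : measurable_fun setT phi.
Proof. exact: measurable_normal_pdf. Qed.

Lemma is_derive_phi x : is_derive x 1 phi (- x * phi x).
Proof.
have -> : phi = (fun x => normal_peak 1 * expR (- x ^+ 2 / 2)).
  by apply/funext => y; rewrite phiE.
apply: is_derive_eq; rewrite /GRing.scale /=.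
set e := expR _; set c := normal_peak 1.
by field.
Qed.

Lemma integrable_phi : mu.-integrable setT (EFin \o (fun x => phi x)).
Proof. exact: integrable_normal_pdf. Qed.

Lemma ge0_integral_gauss f : measurable_fun setT f -> (forall x, 0 <= f x) ->
  (\int[gauss]_x (f x)%:E = \int[mu]_x (f x * phi x)%:E)%E.
Proof.
move=> mf f0.
rewrite -(Radon_Nikodym_SigmaFinite.change_of_variables
  (normal_prob_dominates 0 1))//; last exact/measurable_EFinP.
apply: ae_eq_integral => //.
- apply: emeasurable_funM; first exact/measurable_EFinP.
  apply: (measurable_int mu).
  apply: Radon_Nikodym_SigmaFinite.f_integrable; exact: normal_prob_dominates.
- apply/measurable_EFinP; apply: measurable_funM => //; exact: measurable_phi.
- under [in X in ae_eq _ _ _ X]eq_fun do rewrite EFinM.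
  apply: ae_eqe_mul2l => /=; apply: integral_ae_eq => //=.
  + apply: Radon_Nikodym_SigmaFinite.f_integrable; exact: normal_prob_dominates.
  + by apply/measurable_EFinP; exact: measurable_phi.
  + move=> E _ mE; rewrite -Radon_Nikodym_SigmaFinite.f_integral//.
    exact: normal_prob_dominates.
Qed.

Lemma integrable_gauss f : measurable_fun setT f ->
  mu.-integrable setT (EFin \o (fun x => `|f x| * phi x)) ->
  gauss.-integrable setT (EFin \o f).
Proof.
move=> mf fi; apply/integrableP; split; first exact/measurable_EFinP.
rewrite /= ge0_integral_gauss//; last exact: measurableT_comp.
have /integrableP[_] := fi; apply: le_lt_trans.
rewrite le_eqVlt; apply/orP; left; apply/eqP; apply: eq_integral => x _ /=.
by rewrite normrM normr_id [`|phi x|]ger0_norm ?phi_ge0.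
Qed.

Lemma integral_gauss f : gauss.-integrable setT (EFin \o f) ->
  mu.-integrable setT (EFin \o (fun x => f x * phi x)) /\
  (\int[gauss]_x (f x)%:E = \int[mu]_x (f x * phi x)%:E)%E.
Proof.
move=> fi; have mf : measurable_fun setT f.
  by apply/measurable_EFinP; case/integrableP : fi.
split.
  apply/integrableP; split.
    apply/measurable_EFinP; apply: measurable_funM => //; exact: measurable_phi.
  have /integrableP[_] := fi; rewrite /= ge0_integral_gauss//.
    by under eq_integral do rewrite -[phi _]ger0_norm ?phi_ge0// -normrM.
  exact: measurableT_comp.
rewrite -(Radon_Nikodym_change_of_variables (normal_prob_dominates 0 1))//=.
apply: ae_eq_integral => //.
- apply: emeasurable_funM; first exact/measurable_EFinP.
  apply: (measurable_int mu).
  apply: Radon_Nikodym_integrable; exact: normal_prob_dominates.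
- apply/measurable_EFinP; apply: measurable_funM => //; exact: measurable_phi.
- under [in X in ae_eq _ _ _ X]eq_fun do rewrite EFinM.
  apply: ae_eqe_mul2l => /=; apply: integral_ae_eq => //=.
  + apply: Radon_Nikodym_integrable; exact: normal_prob_dominates.
  + by apply/measurable_EFinP; exact: measurable_phi.
  + move=> E _ mE; rewrite -Radon_Nikodym_integral//.
    exact: normal_prob_dominates.
Qed.

End Normal.

(** * Moments of the standard normal law *)

Section NormalMoments.
Context (R : realType).
Notation mu := (@lebesgue_measure R).
Implicit Types (x z : R) (f F : R -> R).

Lemma exprn_le_expR n (y : R) : 0 <= y -> y ^+ n <= n`!%:R * expR y.
Proof.
move=> y0; case: n => [|n].
  by rewrite expr0 fact0 mul1r -expR0 ler_expR.
rewrite mulrC -ler_pdivrMr ?ltr0n ?fact_gt0//.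
by apply: le_trans (expR_ge1Dxn n y0); rewrite lerDr.
Qed.

(** Half of the Gaussian exponent absorbs the polynomial factor, the other half
    remains as an integrable majorant. *)
Lemma sqr_exprn_phi j x : x ^+ 2 ^+ j * phi x <=
  (4 ^+ j * j`!%:R) * expR (- x ^+ 2 / 4).
Proof.
have y0 : 0 <= x ^+ 2 / 4 by rewrite divr_ge0// sqr_ge0.
have := exprn_le_expR j y0.
rewrite expr_div_n ler_pdivrMr ?exprn_gt0// => /ler_wpM2r.
move=> /(_ _ (phi_ge0 x)) /le_trans; apply.
rewrite (_ : _ * _ * _ * phi x = 4 ^+ j * j`!%:R * (expR (x ^+ 2 / 4) * phi x)).
  rewrite ler_wpM2l// phiE mulrCA -expRD.
  have -> : x ^+ 2 / 4 + - x ^+ 2 / 2 = - x ^+ 2 / 4 by field.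
  by rewrite ler_piMl ?expR_ge0// peak_le1.
by ring.
Qed.

Lemma exprn_phi_le j : exists2 C : R, 0 <= C & forall x, `|x| ^+ j * phi x <= C.
Proof.
exists (1 + 4 ^+ j * j`!%:R).
  by rewrite addr_ge0// mulr_ge0// exprn_ge0.
move=> x; apply: (@le_trans _ _ ((1 + x ^+ 2 ^+ j) * phi x)).
  rewrite ler_wpM2r ?phi_ge0// -real_normK ?num_real// -exprM mulnC exprM.
  have : 0 <= `|x| ^+ j by rewrite exprn_ge0.
  by nra.
rewrite mulrDl mul1r lerD ?phi_le1// (le_trans (sqr_exprn_phi _ _))//.
rewrite ler_piMr ?mulr_ge0 ?exprn_ge0// -[leRHS]expR0 ler_expR.
by rewrite mulNr oppr_le0 divr_ge0// sqr_ge0.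
Qed.

Lemma integrable_exprn_phi j :
  mu.-integrable setT (EFin \o (fun x => x ^+ 2 ^+ j * phi x)).
Proof.
pose s : R := Num.sqrt 2.
have s0 : s != 0 by rewrite gt_eqF// sqrtr_gt0.
have C0 : 0 <= (4 ^+ j * j`!%:R) / normal_peak s :> R.
  by rewrite divr_ge0 ?normal_peak_ge0// mulr_ge0// exprn_ge0.
apply: (le_integrable measurableT _ _
   (integrableZl measurableT ((4 ^+ j * j`!%:R) / normal_peak s)
     (integrable_normal_pdf 0 s))).
  apply/measurable_EFinP; apply: measurable_funM; last exact: measurable_phi.
  by do 2 apply: measurable_funX.
move=> x _ /=; rewrite lee_fin ger0_norm; last first.
  by rewrite mulr_ge0 ?phi_ge0// exprn_ge0// sqr_ge0.
rewrite ger0_norm ?mulr_ge0 ?normal_pdf_ge0//.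
rewrite (le_trans (sqr_exprn_phi _ _))//.
rewrite -[leRHS]mulrA ler_wpM2l//.
rewrite normal_pdfE// /normal_fun mulKf ?gt_eqF ?normal_peak_gt0//.
rewrite subr0 sqr_sqrtr// (_ : 2 *+ 2 = 4 :> R)//.
by rewrite mulr2n; lra.
by rewrite invr_ge0 normal_peak_ge0.
Qed.

(** An arbitrary power is dominated by 1 plus its square, which reduces to the
    even powers. *)
Lemma mom_gauss_id : mom (@gauss R) id.
Proof.
split=> // k; apply: integrable_gauss; first by apply: measurable_funX.
have := integrableD measurableT (integrable_exprn_phi 0) (integrable_exprn_phi k).
apply: le_integrable => //.
  apply/measurable_EFinP; apply: measurable_funM; last exact: measurable_phi.
  by apply: measurableT_comp => //; apply: measurable_funX.
move=> x _ /=; rewrite lee_fin expr0 mul1r.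
have -> : x ^+ 2 ^+ k = `|x| ^+ k ^+ 2.
  by rewrite -[x ^+ 2]real_normK ?num_real// -!exprM mulnC.
set a := `|x| ^+ k; have a0 : 0 <= a by rewrite exprn_ge0.
have p0 := phi_ge0 x; rewrite [leRHS]ger0_norm; last nra.
rewrite [`|a|]ger0_norm// ger0_norm ?mulr_ge0//.
have q : 0 <= 1 + a ^+ 2 - a by nra.
have := mulr_ge0 q p0; lra.
Qed.

(** The integral over [-n, n] is F n - F (- n) by the fundamental theorem of
    calculus, and both terms vanish in the limit as F decays like 1 / |x|. *)
Lemma integral_deriv_decay F f (C : R) : continuous f ->
  (forall x, is_derive x 1 F (f x)) ->
  mu.-integrable setT (EFin \o f) ->
  (forall x, `|x| * `|F x| <= C) ->
  (\int[mu]_x (f x)%:E = 0)%E.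
Proof.
move=> cf dF fi FC.
have mf : measurable_fun setT f by apply/measurable_EFinP; case/integrableP : fi.
pose fn (n : nat) := (EFin \o f) \_ `[- n%:R, n%:R].
have H : (\int[mu]_x fn n x)%E @[n --> \oo] --> (\int[mu]_x (f x)%:E)%E.
  have [] // := @dominated_convergence _ _ _ mu setT measurableT fn
    (EFin \o f) (fun x => `|(f x)%:E|%E).
  - move=> n; apply/(measurable_restrictT _ _).1 => //.
    by apply: measurable_funTS; exact/measurable_EFinP.
  - exact/measurable_EFinP.
  - apply: aeW => x _; apply: cvg_near_cst.
    near=> n; rewrite /fn patchE ifT// inE/= in_itv/=.
    rewrite -ler_norml; near: n; exact: nbhs_infty_ger.
  - exact: integrable_abse.
  - by apply: aeW => x n _ /=; rewrite /fn patchE; case: ifP => // _; rewrite /= normr0 lee_fin.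
have En n : (0 < n)%N -> (\int[mu]_x fn n x = (F n%:R - F (- n%:R))%:E)%E.
  move=> n0; rewrite /fn -integral_mkcond.
  have cF : continuous F.
    by move=> x; apply/differentiable_continuous/derivable1_diffP; case: (dF x).
  rewrite (@continuous_FTC2 _ f F)//.
  - by rewrite (@lt_trans _ _ 0)// ?oppr_lt0 ltr0n.
  - exact: continuous_subspaceT.
  - split => //.
    + exact/cvg_at_right_filter/cF.
    + exact/cvg_at_left_filter/cF.
  - by move=> x _; rewrite derive1E; apply: derive_val.
have H0 : (F n%:R - F (- n%:R)) @[n --> \oo] --> (0 : R).
  have Cn (n : nat) : (0 < n)%N -> `|F n%:R - F (- n%:R)| <= (2 * C) * n%:R^-1.
    move=> n0; have n0' : 0 < n%:R :> R by rewrite ltr0n.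
    rewrite (le_trans (ler_normB _ _))// ler_pdivlMr//.
    have := FC n%:R; have := FC (- n%:R); rewrite normrN ger0_norm//; nra.
  apply/cvgr0Pnorm_le => e e0.
  near=> n; have n0 : (0 < n)%N by near: n; exact: nbhs_infty_gt.
  rewrite (le_trans (Cn n n0))// ler_pdivrMr ?ltr0n// -ler_pdivrMl//.
  near: n; exact: nbhs_infty_ger.
apply: cvg_unique H _ => //.
have : (F n%:R - F (- n%:R))%:E @[n --> \oo] --> 0%:E by apply: cvg_EFin => //; exact: nearW.
apply: cvg_trans; apply: near_eq_cvg; near=> n; rewrite En//.
near: n; exact: nbhs_infty_gt.
Unshelve. all: by end_near. Qed.

Lemma is_derive_exprn_phi k x :
  is_derive x 1 (fun x => x ^+ k.+1 * phi x)
    (k.+1%:R * (x ^+ k * phi x) - x ^+ k.+2 * phi x).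
Proof.
have dphi := is_derive_phi x.
have -> : (fun x => x ^+ k.+1 * phi x) = (id ^+ k.+1) * (@phi R).
  by apply/funext => y; rewrite mulrfctE exprfctE.
apply: is_derive_eq; rewrite /GRing.scale /= exprfctE !exprS.
ring.
Qed.

Lemma continuous_phi : continuous (@phi R).
Proof. by apply: continuous_normal_pdf; rewrite oner_eq0. Qed.

Lemma continuous_exprn_phi k : continuous (fun x : R => x ^+ k * phi x).
Proof.
move=> x; apply: cvgM; last exact: continuous_phi.
exact: exprn_continuous.
Qed.

Definition gmoment k : R := Ex (@gauss R) (fun z => z ^+ k).

Lemma mom_gauss_exp k : mom (@gauss R) (fun z => z ^+ k).
Proof. exact: momX mom_gauss_id. Qed.

Lemma Ex_gauss_deriv0 F f (C : R) : continuous (fun x => f x * phi x) ->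
  (forall x, is_derive x 1 F (f x * phi x)) -> mom (@gauss R) f ->
  (forall x, `|x| * `|F x| <= C) -> Ex (@gauss R) f = 0.
Proof.
move=> cf dF fm FC; have [fi fE] := integral_gauss (mom_int fm).
by rewrite /Ex fE (integral_deriv_decay cf dF fi FC).
Qed.

Lemma gmoment0 : gmoment 0 = 1.
Proof. by rewrite /gmoment; under eq_fun do rewrite expr0; rewrite Ex_cst. Qed.

Lemma gmoment1 : gmoment 1 = 0.
Proof.
have [C C0 HC] := exprn_phi_le 1.
have dphi x : is_derive x 1 (fun x => - phi x) (x ^+ 1 * phi x).
  have d := is_derive_phi x.
  by apply: is_derive_eq; rewrite mulNr opprK expr1.
apply: (@Ex_gauss_deriv0 (fun x => - phi x) (fun x => x ^+ 1) C (@continuous_exprn_phi 1) dphi (mom_gauss_exp 1)).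
by move=> x; have := HC x; rewrite expr1 normrN (ger0_norm (phi_ge0 x)).
Qed.

(** Integration by parts: the derivative of x^(k+1) phi x is
    ((k + 1) x^k - x^(k+2)) phi x, and its integral is zero. *)
Lemma gmomentSS k : gmoment k.+2 = k.+1%:R * gmoment k.
Proof.
have [C C0 HC] := exprn_phi_le k.+2.
apply/esym/eqP; rewrite -subr_eq0 -ExZ; last exact: mom_gauss_exp.
rewrite -ExB; [|exact/momZ/mom_gauss_exp|exact: mom_gauss_exp].
have E x : (k.+1%:R * x ^+ k - x ^+ k.+2) * phi x =
    k.+1%:R * (x ^+ k * phi x) - x ^+ k.+2 * phi x by ring.
apply/eqP; apply: (@Ex_gauss_deriv0 (fun x => x ^+ k.+1 * phi x) _ C).
- under eq_fun do rewrite E.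
  move=> x; apply: cvgB; last exact: continuous_exprn_phi.
  by apply: cvgM; [exact: cvg_cst|exact: continuous_exprn_phi].
- by move=> x; rewrite E; exact: is_derive_exprn_phi.
- by apply: momB; [exact/momZ/mom_gauss_exp|exact: mom_gauss_exp].
- by move=> x; rewrite normrM [`|phi x|]ger0_norm ?phi_ge0// normrX mulrA -exprS.
Qed.

End NormalMoments.

(** * Linear and quadratic forms in independent normals *)

Section CauchySchwarz.
Context d (T : measurableType d) (R : realType) (P : probability T R).
Implicit Types f g : T -> R.

(** The second moment of f - t g is nonnegative for all t; the discriminant, or
    the choice of a t violating this when g has second moment zero, gives the
    bound. *)
Lemma Ex_cauchy_schwarz f g : mom P f -> mom P g ->
  Ex P (fun x => f x * g x) ^+ 2 <=
  Ex P (fun x => f x ^+ 2) * Ex P (fun x => g x ^+ 2).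
Proof.
move=> fm gm.
have H t : 0 <= Ex P (fun x => f x ^+ 2) - 2 * t * Ex P (fun x => f x * g x)
    + t ^+ 2 * Ex P (fun x => g x ^+ 2).
  have fgm := momM fm gm; have f2m := momX 2 fm; have g2m := momX 2 gm.
  rewrite -!ExZ// -ExB//; last exact: momZ.
  rewrite -ExD//; [|by apply: momB => //; exact: momZ|exact: momZ].
  apply: Ex_ge0 => x.
  by rewrite (_ : _ + _ = (f x - t * g x) ^+ 2) ?sqr_ge0//; ring.
move: H; set a := Ex _ _; set b := Ex _ _; set c := Ex _ _ => H.
have c0 : 0 <= c by apply: Ex_ge0 => x; exact: sqr_ge0.
have [c00|cn0] := eqVneq c 0.
  have [-> |bn0] := eqVneq b 0; first by rewrite c00 expr0n mulr0.
  have := H ((a + 1) / (2 * b)); rewrite c00 mulr0 addr0.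
  have -> : 2 * ((a + 1) / (2 * b)) * b = a + 1 by field.
  lra.
have := H (b / c).
have -> : a - 2 * (b / c) * b + (b / c) ^+ 2 * c = a - b ^+ 2 / c by field.
by rewrite subr_ge0 ler_pdivrMr// lt_neqAle eq_sym cn0.
Qed.

End CauchySchwarz.

Section QuadraticForms.
Context (R : realType).
Notation gauss := (@gauss R).
Notation Gn p := (iid_law gauss p).

(** Degree 8 covers the fourth power of a polynomial of degree 2, which is what a
    quadratic form is in each of its variables. *)
Lemma Ex_gauss_poly8 (c0 c1 c2 c3 c4 c5 c6 c7 c8 : R) :
  Ex gauss (fun x => c0 + c1 * x + c2 * x ^+ 2 + c3 * x ^+ 3 + c4 * x ^+ 4
    + c5 * x ^+ 5 + c6 * x ^+ 6 + c7 * x ^+ 7 + c8 * x ^+ 8) =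
  c0 + c2 + 3 * c4 + 15 * c6 + 105 * c8.
Proof.
pose c (i : 'I_9) := [:: c0; c1; c2; c3; c4; c5; c6; c7; c8]`_i.
transitivity (Ex gauss (fun x => \sum_(i < 9) c i * x ^+ i)).
  apply: Ex_eq => x; rewrite !big_ord_recr big_ord0 /c /=.
  by rewrite add0r expr0 expr1 mulr1.
rewrite Ex_sum; last by move=> i; exact/momZ/mom_gauss_exp.
transitivity (\sum_(i < 9) c i * gmoment R i).
  by apply: eq_bigr => i _; rewrite ExZ//; exact: mom_gauss_exp.
rewrite !big_ord_recr big_ord0 /c /= !gmomentSS gmoment1 gmoment0.
ring.
Qed.

Definition lform p (b : 'I_p -> R) (z : p.-tuple R) : R :=
  \sum_(j < p) b j * tnth z j.

(** The quadratic form with kernel K, centred under the standard normal law. *)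
Definition qform p (K : 'I_p -> 'I_p -> R) (z : p.-tuple R) : R :=
  \sum_(i < p) \sum_(j < p) K i j * (tnth z i * tnth z j - (i == j)%:R).

Definition hsq p (K : 'I_p -> 'I_p -> R) : R :=
  \sum_(i < p) \sum_(j < p) K i j ^+ 2.

Definition ltail p (b : 'I_p.+1 -> R) j := b (lift ord0 j).
Definition qtail p (K : 'I_p.+1 -> 'I_p.+1 -> R) i j :=
  K (lift ord0 i) (lift ord0 j).

Lemma lform_cons p (b : 'I_p.+1 -> R) x (z : p.-tuple R) :
  lform b [tuple of x :: z] = b ord0 * x + lform (ltail b) z.
Proof.
rewrite /lform big_ord_recl tnth0; congr (_ + _).
by apply: eq_bigr => j _; rewrite tnthS.
Qed.

(** In its first variable a quadratic form is a polynomial of degree 2 whose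
    coefficients are a quadratic form and a linear form in the other variables;
    every moment computation below is an induction on this decomposition. *)
Lemma qform_cons p (K : 'I_p.+1 -> 'I_p.+1 -> R) x (z : p.-tuple R) :
  (forall i j, K i j = K j i) ->
  qform K [tuple of x :: z] = qform (qtail K) z +
    2 * lform (ltail (K ord0)) z * x + K ord0 ord0 * (x ^+ 2 - 1).
Proof.
move=> Ks; rewrite /qform big_ord_recl big_ord_recl /= tnth0.
under eq_bigr do rewrite tnthS /= subr0.
under [X in _ + X]eq_bigr do rewrite big_ord_recl tnth0 tnthS /= subr0 Ks.
rewrite big_split /=.
have -> : \sum_(i < p) K ord0 (lift ord0 i) * (x * tnth z i) =
    lform (ltail (K ord0)) z * x.
  by rewrite mulr_suml; apply: eq_bigr => i _; rewrite /ltail; ring.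
have -> : \sum_(i < p) K ord0 (lift ord0 i) * (tnth z i * x) =
    lform (ltail (K ord0)) z * x.
  by rewrite mulr_suml; apply: eq_bigr => i _; rewrite /ltail; ring.
rewrite (_ : \sum_(i < p) \sum_(i0 < p) _ = qform (qtail K) z).
  by rewrite /qform; ring.
by apply: eq_bigr => i _; apply: eq_bigr => j _; rewrite tnthS.
Qed.

Lemma hsq_cons p (K : 'I_p.+1 -> 'I_p.+1 -> R) : (forall i j, K i j = K j i) ->
  hsq K = hsq (qtail K) + 2 * \sum_(j < p) ltail (K ord0) j ^+ 2 + K ord0 ord0 ^+ 2.
Proof.
move=> Ks; rewrite /hsq big_ord_recl big_ord_recl.
under [X in _ + X]eq_bigr do rewrite big_ord_recl Ks.
rewrite big_split /=.
rewrite /ltail /qtail; ring.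
Qed.

Lemma hsq_ge0 p (K : 'I_p -> 'I_p -> R) : 0 <= hsq K.
Proof. by apply: sumr_ge0 => i _; apply: sumr_ge0 => j _; exact: sqr_ge0. Qed.

Lemma mom_gauss_tnth p i : mom (Gn p) (fun z => tnth z i).
Proof. exact: (mom_tnth i (mom_gauss_id R)). Qed.

Lemma mom_lform p b : mom (Gn p) (lform b).
Proof. by apply: mom_sum => j; apply: momZ; exact: mom_gauss_tnth. Qed.

Lemma mom_qform p K : mom (Gn p) (qform K).
Proof.
apply: mom_sum => i; apply: mom_sum => j; apply: momZ; apply: momB.
  by apply: momM; exact: mom_gauss_tnth.
exact: mom_cst.
Qed.

Lemma mom_gauss_poly2 (u v w : R) : mom gauss (fun x => u + v * x + w * (x ^+ 2 - 1)).
Proof.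
apply: momD; first by apply: momD; [exact: mom_cst|exact/momZ/mom_gauss_id].
by apply/momZ/momB; [exact: mom_gauss_exp|exact: mom_cst].
Qed.

Lemma mom_qform_cons p K (z : p.-tuple R) : (forall i j, K i j = K j i) ->
  mom gauss (fun x => qform K [tuple of x :: z]).
Proof.
move=> Ks; under eq_fun do rewrite qform_cons//.
exact: mom_gauss_poly2.
Qed.

Lemma mom_lform_cons p b (z : p.-tuple R) :
  mom gauss (fun x => lform b [tuple of x :: z]).
Proof.
under eq_fun do rewrite lform_cons//.
by apply: momD; [exact/momZ/mom_gauss_id|exact: mom_cst].
Qed.

Lemma Ex_lform2 p (b : 'I_p -> R) :
  Ex (Gn p) (fun z => lform b z ^+ 2) = \sum_(j < p) b j ^+ 2.
Proof.
elim: p b => [|p IH] b.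
  rewrite big_ord0 -[RHS](Ex_cst (Gn 0) 0); apply: Ex_eq => z.
  by rewrite /lform big_ord0 expr0n.
rewrite Ex_iidS; [|exact/momX/mom_lform|by move=> t; exact/momX/mom_lform_cons].
transitivity (Ex (Gn p) (fun z => lform (ltail b) z ^+ 2 + b ord0 ^+ 2)).
  apply: Ex_eq => z.
  have := Ex_gauss_poly8 (lform (ltail b) z ^+ 2) (2 * b ord0 * lform (ltail b) z)
    (b ord0 ^+ 2) 0 0 0 0 0 0.
  rewrite !mulr0 !addr0 => <-; apply: Ex_eq => x; rewrite lform_cons; ring.
rewrite ExD; [|exact/momX/mom_lform|exact: mom_cst].
by rewrite IH Ex_cst big_ord_recl addrC.
Qed.

Lemma Ex_lform4 p (b : 'I_p -> R) :
  Ex (Gn p) (fun z => lform b z ^+ 4) = 3 * (\sum_(j < p) b j ^+ 2) ^+ 2.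
Proof.
elim: p b => [|p IH] b.
  rewrite big_ord0 expr0n mulr0 -[RHS](Ex_cst (Gn 0) 0); apply: Ex_eq => z.
  by rewrite /lform big_ord0 expr0n.
rewrite Ex_iidS; [|exact/momX/mom_lform|by move=> t; exact/momX/mom_lform_cons].
transitivity (Ex (Gn p) (fun z => lform (ltail b) z ^+ 4 +
    (6 * b ord0 ^+ 2) * lform (ltail b) z ^+ 2 + 3 * b ord0 ^+ 4)).
  apply: Ex_eq => z; set l := lform _ z; set c := b ord0.
  have := Ex_gauss_poly8 (l ^+ 4) (4 * l ^+ 3 * c) (6 * l ^+ 2 * c ^+ 2)
    (4 * l * c ^+ 3) (c ^+ 4) 0 0 0 0.
  rewrite !mulr0 !addr0 [6 * c ^+ 2 * _]mulrAC => <-; apply: Ex_eq => x.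
  by rewrite lform_cons -/l -/c; ring.
have m2 : mom (Gn p) (fun z => 6 * b ord0 ^+ 2 * lform (ltail b) z ^+ 2).
  exact/momZ/momX/mom_lform.
have m4 := momX 4 (mom_lform (ltail b)).
rewrite ExD; [|exact: momD|exact: mom_cst].
rewrite ExD// ExZ; last exact/momX/mom_lform.
by rewrite IH Ex_lform2 Ex_cst big_ord_recl /ltail; ring.
Qed.

Lemma Ex_qform p (K : 'I_p -> 'I_p -> R) : (forall i j, K i j = K j i) ->
  Ex (Gn p) (qform K) = 0.
Proof.
elim: p K => [|p IH] K Ks.
  rewrite -[RHS](Ex_cst (Gn 0) 0); apply: Ex_eq => z.
  by rewrite /qform big_ord0.
rewrite Ex_iidS; [|exact: mom_qform|by move=> t; exact: mom_qform_cons].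
transitivity (Ex (Gn p) (qform (qtail K))); last by rewrite IH// => i j; exact: Ks.
apply: Ex_eq => z.
have := Ex_gauss_poly8 (qform (qtail K) z - K ord0 ord0)
  (2 * lform (ltail (K ord0)) z) (K ord0 ord0) 0 0 0 0 0 0.
rewrite !mulr0 !addr0 subrK => <-; apply: Ex_eq => x; rewrite qform_cons//; ring.
Qed.

Lemma Ex_qform2 p (K : 'I_p -> 'I_p -> R) : (forall i j, K i j = K j i) ->
  Ex (Gn p) (fun z => qform K z ^+ 2) = 2 * hsq K.
Proof.
elim: p K => [|p IH] K Ks.
  rewrite /hsq big_ord0 mulr0 -[RHS](Ex_cst (Gn 0) 0); apply: Ex_eq => z.
  by rewrite /qform big_ord0 expr0n.
rewrite Ex_iidS; [|exact/momX/mom_qform|by move=> t; exact/momX/mom_qform_cons].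
transitivity (Ex (Gn p) (fun z => qform (qtail K) z ^+ 2 +
    4 * lform (ltail (K ord0)) z ^+ 2 + 2 * K ord0 ord0 ^+ 2)).
  apply: Ex_eq => z; set a := qform _ z; set b := lform _ z; set k := K _ _.
  have := Ex_gauss_poly8 ((a - k) ^+ 2) (2 * (a - k) * (2 * b))
    ((2 * b) ^+ 2 + 2 * (a - k) * k) (2 * (2 * b) * k) (k ^+ 2) 0 0 0 0.
  rewrite !mulr0 !addr0 => E; transitivity ((a - k) ^+ 2 +
    ((2 * b) ^+ 2 + 2 * (a - k) * k) + 3 * k ^+ 2); last by ring.
  by rewrite -E; apply: Ex_eq => x; rewrite qform_cons// -/a -/b -/k; ring.
have m2 : mom (Gn p) (fun z => 4 * lform (ltail (K ord0)) z ^+ 2).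
  exact/momZ/momX/mom_lform.
have m4 := momX 2 (mom_qform (qtail K)).
rewrite ExD; [|exact: momD|exact: mom_cst].
rewrite ExD// ExZ; last exact/momX/mom_lform.
rewrite IH; last by move=> i j; exact: Ks.
by rewrite Ex_lform2 Ex_cst hsq_cons//; ring.
Qed.

(** Hypercontractivity for quadratic forms, by induction on the dimension.  Let a
    be the quadratic form in the remaining variables, b the linear form that
    multiplies the first variable and k its square coefficient.  The only term
    of the expansion without an explicit bound is 72 E (a^2 b^2), and
    Cauchy-Schwarz together with the induction hypothesis bounds it by
    72 sqrt (1000 * 3) |K'|^2 |b|^2.  The square of the recursion for |K|^2
    offers 1000 * 4 |K'|^2 |b|^2, and 1000 is large enough for this to
    suffice. *)
Lemma Ex_qform4_le p (K : 'I_p -> 'I_p -> R) : (forall i j, K i j = K j i) ->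
  Ex (Gn p) (fun z => qform K z ^+ 4) <= 1000 * hsq K ^+ 2.
Proof.
elim: p K => [|p IH] K Ks.
  rewrite /hsq big_ord0 expr0n mulr0 -[leRHS](Ex_cst (Gn 0) 0).
  rewrite le_eqVlt; apply/orP; left; apply/eqP; apply: Ex_eq => z.
  by rewrite /qform big_ord0 expr0n.
rewrite Ex_iidS; [|exact/momX/mom_qform|by move=> t; exact/momX/mom_qform_cons].
pose a := qform (qtail K); pose b := lform (ltail (K ord0)); pose k := K ord0 ord0.
have E z : Ex gauss (fun x => qform K [tuple of x :: tval z] ^+ 4) =
    a z ^+ 4 + 24 * (a z ^+ 2 * b z ^+ 2) + 12 * k ^+ 2 * a z ^+ 2
    + 96 * (a z * b z ^+ 2 * k) + 32 * k ^+ 3 * a z + 48 * b z ^+ 4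
    + 240 * k ^+ 2 * b z ^+ 2 + 60 * k ^+ 4.
  set u := a z - k; set v := 2 * b z.
  have E := Ex_gauss_poly8 (u ^+ 4) (4 * u ^+ 3 * v)
    (6 * u ^+ 2 * v ^+ 2 + 4 * u ^+ 3 * k) (4 * u * v ^+ 3 + 12 * u ^+ 2 * v * k)
    (v ^+ 4 + 12 * u * v ^+ 2 * k + 6 * u ^+ 2 * k ^+ 2)
    (4 * v ^+ 3 * k + 12 * u * v * k ^+ 2)
    (6 * v ^+ 2 * k ^+ 2 + 4 * u * k ^+ 3) (4 * v * k ^+ 3) (k ^+ 4).
  transitivity (u ^+ 4 + (6 * u ^+ 2 * v ^+ 2 + 4 * u ^+ 3 * k) + 3 *
    (v ^+ 4 + 12 * u * v ^+ 2 * k + 6 * u ^+ 2 * k ^+ 2) + 15 *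
    (6 * v ^+ 2 * k ^+ 2 + 4 * u * k ^+ 3) + 105 * k ^+ 4).
    rewrite -E; apply: Ex_eq => x.
    by rewrite qform_cons// -/(a z) -/(b z) -/k /u /v; ring.
  by rewrite /u /v; ring.
have am : mom (Gn p) a by exact: mom_qform.
have bm : mom (Gn p) b by exact: mom_lform.
(* F dominates the conditional fourth moment by 96 a b^2 k <= 48 b^2 (a^2 + k^2),
   which removes the only product of all three quantities. *)
pose F z := a z ^+ 4 + 72 * (a z ^+ 2 * b z ^+ 2) + 12 * k ^+ 2 * a z ^+ 2
    + 32 * k ^+ 3 * a z + 48 * b z ^+ 4 + 288 * k ^+ 2 * b z ^+ 2 + 60 * k ^+ 4.
have Em : mom (Gn p) (fun z => Ex gauss (fun x => qform K [tuple of x :: tval z] ^+ 4)).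
  under eq_fun do rewrite E.
  do ! [apply: momD|apply: momM|exact: mom_cst|apply: momX|exact: am|exact: bm].
have m1 : mom (Gn p) (fun z => a z ^+ 4) by exact: momX.
have m2 : mom (Gn p) (fun z => a z ^+ 2 * b z ^+ 2) by apply: momM; exact: momX.
have m3 : mom (Gn p) (fun z => a z ^+ 2) by exact: momX.
have m4 : mom (Gn p) (fun z => b z ^+ 4) by exact: momX.
have m5 : mom (Gn p) (fun z => b z ^+ 2) by exact: momX.
have Fm : mom (Gn p) F by do ! [apply: momD|exact: mom_cst|exact: momZ|].
apply: (@le_trans _ _ (Ex (Gn p) F)).
  apply: le_Ex => // z; rewrite E /F.
  have : 0 <= b z ^+ 2 * (a z - k) ^+ 2 by rewrite mulr_ge0 ?sqr_ge0.
  by nra.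
have -> : Ex (Gn p) F = Ex (Gn p) (fun z => a z ^+ 4)
    + 72 * Ex (Gn p) (fun z => a z ^+ 2 * b z ^+ 2)
    + 12 * k ^+ 2 * Ex (Gn p) (fun z => a z ^+ 2) + 32 * k ^+ 3 * Ex (Gn p) a
    + 48 * Ex (Gn p) (fun z => b z ^+ 4)
    + 288 * k ^+ 2 * Ex (Gn p) (fun z => b z ^+ 2) + 60 * k ^+ 4.
  rewrite /F !ExD ?ExZ ?Ex_cst//; do ! [apply: momD|exact: mom_cst|exact: momZ|] => //.
have Ks' i j : qtail K i j = qtail K j i by exact: Ks.
have CS := Ex_cauchy_schwarz m3 m5.
have Ea4 : Ex (Gn p) (fun z => (a z ^+ 2) ^+ 2) = Ex (Gn p) (fun z => a z ^+ 4).
  by apply: Ex_eq => z; rewrite -exprM.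
have Eb4 : Ex (Gn p) (fun z => (b z ^+ 2) ^+ 2) = Ex (Gn p) (fun z => b z ^+ 4).
  by apply: Ex_eq => z; rewrite -exprM.
move: CS; rewrite Ea4 Eb4 {Ea4 Eb4} (Ex_qform2 Ks') (Ex_qform Ks') Ex_lform4 Ex_lform2.
have := IH _ Ks'; rewrite -/a hsq_cons//.
set A := Ex _ _; set M := Ex _ _; set T := hsq (qtail K).
set B := \sum_(j < p) _ => IA CS.
have T0 : 0 <= T by exact: hsq_ge0.
have B0 : 0 <= B by apply: sumr_ge0 => j _; exact: sqr_ge0.
have k0 : 0 <= k ^+ 2 by exact: sqr_ge0.
(* 55 is an integer above sqrt (1000 * 3). *)
have ME : M <= 55 * (T * B).
  rewrite -ler_sqr ?nnegrE ?mulr_ge0//; last first.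
    by apply: Ex_ge0 => z; rewrite mulr_ge0 ?sqr_ge0.
  apply: (le_trans CS).
  apply: (@le_trans _ _ (1000 * T ^+ 2 * (3 * B ^+ 2))).
    by rewrite ler_wpM2r// mulr_ge0// sqr_ge0.
  have : 0 <= T ^+ 2 * B ^+ 2 by rewrite mulr_ge0// sqr_ge0.
  nra.
have k4 : k ^+ 4 = k ^+ 2 * k ^+ 2 by rewrite -exprD.
rewrite k4 mulr0 addr0; move: k0; set q := k ^+ 2 => k0.
have TB := mulr_ge0 T0 B0; have Tq := mulr_ge0 T0 k0; have Bq := mulr_ge0 B0 k0.
have BB := mulr_ge0 B0 B0; have qq := mulr_ge0 k0 k0.
nra.
Qed.

End QuadraticForms.

(** * The trace inner product and centred outer products *)

Section InnerProduct.
Context (R : realType) (p : nat).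
Implicit Types A B C : 'M[R]_p.

Definition ip A B : R := \tr (A^T *m B).
Definition nsq A : R := ip A A.

Lemma ipE A B : ip A B = \sum_i \sum_j A i j * B i j.
Proof.
rewrite /ip /mxtrace exchange_big; apply: eq_bigr => i _.
by rewrite mxE; apply: eq_bigr => j _; rewrite mxE.
Qed.

Lemma ipC A B : ip A B = ip B A.
Proof. by rewrite /ip -mxtrace_tr trmx_mul trmxK. Qed.

Lemma ipDl A B C : ip (A + B) C = ip A C + ip B C.
Proof. by rewrite /ip linearD mulmxDl linearD. Qed.

Lemma ipDr A B C : ip A (B + C) = ip A B + ip A C.
Proof. by rewrite ipC ipDl !(ipC A). Qed.

Lemma ipNl A B : ip (- A) B = - ip A B.
Proof. by rewrite /ip linearN mulNmx linearN. Qed.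

Lemma ipNr A B : ip A (- B) = - ip A B.
Proof. by rewrite ipC ipNl ipC. Qed.

Lemma ipBr A B C : ip A (B - C) = ip A B - ip A C.
Proof. by rewrite ipDr ipNr. Qed.

Lemma ip0l B : ip 0 B = 0.
Proof. by rewrite /ip trmx0 mul0mx mxtrace0. Qed.

Lemma ip_trmx A B : ip A^T B^T = ip A B.
Proof. by rewrite /ip -trmx_mul mxtrace_tr mxtrace_mulC. Qed.

Lemma ip_mulmxl A B C : ip (A *m B) C = ip B (A^T *m C).
Proof. by rewrite /ip trmx_mul mulmxA. Qed.

Lemma ip_mulmxr A B C : ip (B *m A) C = ip B (C *m A^T).
Proof. by rewrite /ip trmx_mul -mulmxA mxtrace_mulC mulmxA. Qed.

Lemma nsq_ge0 A : 0 <= nsq A.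
Proof.
rewrite /nsq ipE; apply: sumr_ge0 => i _; apply: sumr_ge0 => j _.
by rewrite -expr2 sqr_ge0.
Qed.

Lemma nsqD A B : nsq (A + B) = nsq A + 2 * ip A B + nsq B.
Proof. by rewrite /nsq ipDl !ipDr (ipC B A); ring. Qed.

Lemma nsqN A : nsq (- A) = nsq A.
Proof. by rewrite /nsq ipNl ipNr opprK. Qed.

Lemma nsqB A B : nsq (A - B) = nsq A - 2 * ip A B + nsq B.
Proof. by rewrite nsqD ipNr nsqN; ring. Qed.

Lemma nsq_trmx A : nsq A^T = nsq A.
Proof. exact: ip_trmx. Qed.

Lemma ipZr (t : R) A B : ip A (t *: B) = t * ip A B.
Proof. by rewrite /ip -scalemxAr mxtraceZ. Qed.

Lemma nsqZ (t : R) A : nsq (t *: A) = t ^+ 2 * nsq A.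
Proof. by rewrite /nsq ipZr ipC ipZr expr2 mulrA. Qed.

(** The weighted inequality between the means, with both signs of the inner
    product. *)
Lemma ip_amgm (t : R) A B : 0 < t -> 2 * `|ip A B| <= t * nsq A + t^-1 * nsq B.
Proof.
move=> t0.
have H s : 0 <= nsq A - 2 * (s * ip A B) + s ^+ 2 * nsq B.
  by rewrite -ipZr -nsqZ -nsqB nsq_ge0.
have h1 := mulr_ge0 (ltW t0) (H t^-1).
have h2 := mulr_ge0 (ltW t0) (H (- t^-1)).
have E1 : t * (nsq A - 2 * (t^-1 * ip A B) + t^-1 ^+ 2 * nsq B) =
  t * nsq A + t^-1 * nsq B - 2 * ip A B by field; rewrite gt_eqF.
have E2 : t * (nsq A - 2 * (- t^-1 * ip A B) + (- t^-1) ^+ 2 * nsq B) =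
  t * nsq A + t^-1 * nsq B + 2 * ip A B by field; rewrite gt_eqF.
rewrite E1 in h1; rewrite E2 in h2.
by case: (ger0P (ip A B)) => _; lra.
Qed.

Lemma ip_cauchy_schwarz A B : ip A B ^+ 2 <= nsq A * nsq B.
Proof.
have H s : 0 <= nsq A - 2 * (s * ip A B) + s ^+ 2 * nsq B.
  by rewrite -ipZr -nsqZ -nsqB nsq_ge0.
have c0 := nsq_ge0 B.
move: H c0; set a := nsq A; set b := ip A B; set c := nsq B => H c0.
have [c00|cn0] := eqVneq c 0.
  have [-> |bn0] := eqVneq b 0; first by rewrite c00 expr0n mulr0.
  have := H ((a + 1) / (2 * b)); rewrite c00 mulr0 addr0.
  have -> : 2 * ((a + 1) / (2 * b) * b) = a + 1 by field.
  lra.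
have := H (b / c).
have -> : a - 2 * (b / c * b) + (b / c) ^+ 2 * c = a - b ^+ 2 / c by field.
by rewrite subr_ge0 ler_pdivrMr// lt_neqAle eq_sym cn0.
Qed.

Lemma nsq1 : nsq 1%:M = p%:R.
Proof. by rewrite /nsq /ip trmx1 mulmx1 mxtrace1. Qed.

End InnerProduct.

Section LinearImage.
Context (R : realType) (p : nat).
Implicit Types (L S : 'M[R]_p) (x z : p.-tuple R).
Notation Gn := (iid_law (gauss R) p).

Definition ymat x : 'M[R]_p :=
  \matrix_(i, j) (tnth x i * tnth x j - (i == j)%:R).

Lemma trmx_ymat x : (ymat x)^T = ymat x.
Proof. by apply/matrixP => i j; rewrite !mxE mulrC eq_sym. Qed.

Lemma ymatE x (c := \col_i tnth x i : 'cV[R]_p) : ymat x = c *m c^T - 1%:M.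
Proof.
by apply/matrixP => i j; rewrite !mxE big_ord_recl big_ord0 !mxE addr0 -mulr_natr mul1r.
Qed.

Lemma qform_ip S z : qform S z = ip S (ymat z).
Proof. by rewrite ipE; do 2 apply: eq_bigr => ? _; rewrite mxE. Qed.

Lemma hsq_nsq S : hsq S = nsq S.
Proof. by rewrite /nsq ipE; do 2 apply: eq_bigr => ? _; rewrite expr2. Qed.

(** Under X = L Z the linear statistic <S, Y> is the centred quadratic form of Z
    with kernel L^T S L, shifted by its mean <S, L L^T - 1>. *)
Lemma ip_ymat_lin L S z : ip S (ymat (lin_map L z)) =
  qform (L^T *m S *m L) z + ip S (L *m L^T - 1%:M).
Proof.
have E : \col_i tnth (lin_map L z) i = L *m (\col_i tnth z i : 'cV[R]_p).
  apply/matrixP => i j; rewrite !mxE tnth_mktuple.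
  by apply: eq_bigr => k _; rewrite mxE.
rewrite ymatE E trmx_mul.
set c := \col_i _; have cE : c *m c^T = ymat z + 1%:M by rewrite ymatE subrK.
rewrite mulmxA -(mulmxA L) cE mulmxDr mulmx1 mulmxDl -addrA ipDr.
congr (_ + _); rewrite ipC ip_mulmxr trmxK ip_mulmxl qform_ip ipC.
by rewrite mulmxA.
Qed.

Variable L : 'M[R]_p.
Notation N := (distribution Gn (lin_map L)).
Notation G := (L *m L^T - 1%:M).
(** Half the variance of <S, Y>. *)
Definition Qf S := nsq (L^T *m S *m L).

Lemma measurable_tnthR (i : 'I_p) : measurable_fun setT (fun x : p.-tuple R => tnth x i).
Proof. exact: measurable_tnth. Qed.

Lemma mom_lin_tnth i : mom N (fun x => tnth x i).
Proof.
apply: mom_distribution; first exact: measurable_tnthR.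
rewrite (_ : _ \o _ = lform (L i)); first exact: mom_lform.
by apply/funext => z /=; rewrite tnth_mktuple.
Qed.

Lemma mom_ymat i j : mom N (fun x => ymat x i j).
Proof.
under eq_fun do rewrite mxE.
by apply: momB; [apply: momM; exact: mom_lin_tnth|exact: mom_cst].
Qed.

Lemma mom_ip_ymat S : mom N (fun x => ip S (ymat x)).
Proof.
under eq_fun do rewrite ipE.
by apply: mom_sum => i; apply: mom_sum => j; apply: momZ; exact: mom_ymat.
Qed.

Lemma Ex_lin (f : p.-tuple R -> R) (g : p.-tuple R -> R) :
  measurable_fun setT f -> mom Gn g ->
  (forall z, f (lin_map L z) = g z) -> Ex N f = Ex Gn g.
Proof.
move=> mf gm fg; have E : f \o lin_map L = g by apply/funext => z; exact: fg.
by rewrite Ex_distribution ?E.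
Qed.

Lemma sym_conj S : S^T = S -> forall i j, (L^T *m S *m L) i j = (L^T *m S *m L) j i.
Proof.
move=> Ss i j; rewrite -[in LHS](trmxK (_ *m L)) mxE !trmx_mul trmxK Ss.
by rewrite mulmxA.
Qed.

Lemma Ex_ip_ymat S : S^T = S -> Ex N (fun x => ip S (ymat x)) = ip S G.
Proof.
move=> Ss; rewrite (Ex_lin _ _ (ip_ymat_lin L S)); last 2 first.
- exact: mom_meas (mom_ip_ymat S).
- by apply: momD; [exact: mom_qform|exact: mom_cst].
rewrite ExD; [|exact: mom_qform|exact: mom_cst].
by rewrite Ex_cst Ex_qform ?add0r//; exact: sym_conj.
Qed.

Lemma Ex_ip_ymat2 S : S^T = S ->
  Ex N (fun x => ip S (ymat x) ^+ 2) = 2 * Qf S + ip S G ^+ 2.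
Proof.
move=> Ss; have qm := mom_qform (L^T *m S *m L).
rewrite (@Ex_lin _ (fun z => qform (L^T *m S *m L) z ^+ 2 +
  2 * ip S G * qform (L^T *m S *m L) z + ip S G ^+ 2)); last 3 first.
- exact: mom_meas (momX 2 (mom_ip_ymat S)).
- by apply: momD; [apply: momD; [exact: momX|exact: momZ]|exact: mom_cst].
- by move=> z; rewrite ip_ymat_lin; ring.
rewrite ExD; [|apply: momD; [exact: momX|exact: momZ]|exact: mom_cst].
rewrite ExD; [|exact: momX|exact: momZ].
rewrite ExZ// Ex_cst Ex_qform2; last exact: sym_conj.
by rewrite Ex_qform ?mulr0 ?addr0 ?hsq_nsq//; exact: sym_conj.
Qed.

Lemma Ex_ip_ymat4_qform S : S^T = S ->
  Ex N (fun x => ip S (ymat x) ^+ 4) <= 8 * (1000 * Qf S ^+ 2 + ip S G ^+ 4).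
Proof.
move=> Ss; have qm := mom_qform (L^T *m S *m L).
rewrite (@Ex_lin _ (fun z => (qform (L^T *m S *m L) z + ip S G) ^+ 4)); last 3 first.
- exact: mom_meas (momX 4 (mom_ip_ymat S)).
- by apply: momX; apply: momD; [exact: qm|exact: mom_cst].
- by move=> z; rewrite ip_ymat_lin.
have q4 := momX 4 qm.
apply: (@le_trans _ _ (Ex Gn (fun z => 8 * (qform (L^T *m S *m L) z ^+ 4 + ip S G ^+ 4)))).
  apply: le_Ex.
  - by apply: momX; apply: momD; [exact: qm|exact: mom_cst].
  - by apply: momZ; apply: momD; [exact: q4|exact: mom_cst].
  move=> z; set a := qform _ _; set b := ip _ _.
  have h1 : (a + b) ^+ 2 <= 2 * (a ^+ 2 + b ^+ 2) by have := sqr_ge0 (a - b); nra.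
  have h2 : ((a + b) ^+ 2) ^+ 2 <= (2 * (a ^+ 2 + b ^+ 2)) ^+ 2.
    by rewrite lerXn2r ?nnegrE ?sqr_ge0// mulr_ge0// addr_ge0 ?sqr_ge0.
  rewrite -exprM in h2; apply: (le_trans h2).
  have := sqr_ge0 (a ^+ 2 - b ^+ 2).
  by rewrite (exprM a 2 2) (exprM b 2 2); nra.
rewrite ExZ; last by apply: momD; [exact: q4|exact: mom_cst].
rewrite ExD; [|exact: q4|exact: mom_cst].
rewrite Ex_cst ler_wpM2l// lerD2r /Qf -hsq_nsq.
exact: (Ex_qform4_le (sym_conj Ss)).
Qed.

(** Expansion around L L^T = 1, where the variance would be exactly 2 |S|^2. *)
Lemma QfE S : S^T = S -> Qf S = nsq S + 2 * ip S (G *m S) + ip (G *m S) (S *m G).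
Proof.
move=> Ss; pose D := L *m L^T.
have Ds : D^T = D by rewrite trmx_mul trmxK.
have Gs : G^T = G by rewrite linearB /= Ds trmx1.
have -> : Qf S = ip S (D *m S *m D).
  by rewrite /Qf /nsq ip_mulmxr ip_mulmxl trmxK /D !mulmxA.
have DE : D = 1%:M + G by rewrite addrC subrK.
move: G D Ds Gs DE => g D' _ Gs ->.
rewrite mulmxDl mulmxDr mul1mx mulmx1 !mulmxDl !ipDr.
have -> : ip S (S *m g) = ip S (g *m S).
  by rewrite -ip_trmx trmx_mul Gs Ss.
by rewrite (ip_mulmxl g S) Gs /nsq mulmxA; ring.
Qed.

End LinearImage.

(** * Sums of centred outer products *)

Section ListMoments.
Context (R : realType) (p : nat) (L : 'M[R]_p).
Notation V := (p.-tuple R).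
Notation N := (distribution (iid_law (gauss R) p) (lin_map L)).
Notation G := (L *m L^T - 1%:M).

Definition ysum (s : seq V) : 'M[R]_p := \sum_(x <- s) ymat x.

Lemma ysum_cons x s : ysum (x :: s) = ymat x + ysum s.
Proof. exact: big_cons. Qed.

Lemma trmx_ysum s : (ysum s)^T = ysum s.
Proof.
elim: s => [|x s IH]; first by rewrite /ysum big_nil trmx0.
by rewrite ysum_cons linearD /= trmx_ymat IH.
Qed.

Lemma trmx_G : G^T = G.
Proof. by rewrite linearB /= trmx_mul trmxK trmx1. Qed.

Lemma mom_ysum m i j : mom (iid_law N m) (fun t => ysum t i j).
Proof.
under eq_fun do rewrite /ysum summxE big_tuple.
apply: mom_sum => k; exact: (mom_tnth k (mom_ymat L i j)).
Qed.

Lemma mom_ip_ysum m A : mom (iid_law N m) (fun t => ip A (ysum t)).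
Proof.
under eq_fun do rewrite ipE.
by apply: mom_sum => i; apply: mom_sum => j; apply: momZ; exact: mom_ysum.
Qed.

Lemma mom_nsq_ysum m : mom (iid_law N m) (fun t => nsq (ysum t)).
Proof.
under eq_fun do rewrite /nsq ipE.
by apply: mom_sum => i; apply: mom_sum => j; apply: momM; exact: mom_ysum.
Qed.

Lemma mom_nsq_ymat : mom N (fun x => nsq (ymat x)).
Proof.
under eq_fun do rewrite /nsq ipE.
by apply: mom_sum => i; apply: mom_sum => j; apply: momM; exact: mom_ymat.
Qed.

Lemma Ex_ip_ymat_var S : S^T = S ->
  Ex N (fun x => (ip S (ymat x) - ip S G) ^+ 2) = 2 * Qf L S.
Proof.
move=> Ss; have qm := mom_ip_ymat L S.
transitivity (Ex N (fun x => ip S (ymat x) ^+ 2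
    - 2 * ip S G * ip S (ymat x) + ip S G ^+ 2)).
  by apply: Ex_eq => x; ring.
rewrite ExD; [|apply: momB; [exact: momX|exact: momZ]|exact: mom_cst].
rewrite ExB; [|exact: momX|exact: momZ].
rewrite ExZ// Ex_cst Ex_ip_ymat2// Ex_ip_ymat//; ring.
Qed.

(** The fluctuation of the conditional mean of an increment: <G, S> minus its
    mean. *)
Definition drift (s : seq V) : R := ip G (ysum s) - (size s)%:R * nsq G.

Lemma drift_cons x s : drift (x :: s) = drift s + (ip G (ymat x) - nsq G).
Proof. by rewrite /drift ysum_cons ipDr /= -natr1; ring. Qed.

Lemma mom_drift m : mom (iid_law N m) (fun t => drift t).
Proof.
rewrite /drift; under eq_fun do rewrite size_tuple.
by apply: momB; [exact: mom_ip_ysum|exact: mom_cst].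
Qed.

Lemma mom_drift_cons (s : seq V) : mom N (fun x => drift (x :: s)).
Proof.
under eq_fun do rewrite drift_cons.
apply: momD; first exact: mom_cst.
by apply: momB; [exact: mom_ip_ymat|exact: mom_cst].
Qed.

Lemma Ex_drift m : Ex (iid_law N m) (fun t => drift t) = 0.
Proof.
elim: m => [|m IH].
  rewrite -[RHS](Ex_cst (iid_law N 0) 0); apply: Ex_eq => t.
  by rewrite tuple0 /drift /ysum big_nil ipC ip0l mul0r subrr.
rewrite Ex_iidS; [|exact: mom_drift|by move=> t; exact: mom_drift_cons].
rewrite -[RHS]IH; apply: Ex_eq => t /=.
under eq_fun do rewrite drift_cons.
rewrite ExD; [|exact: mom_cst|by apply: momB; [exact: mom_ip_ymat|exact: mom_cst]].
rewrite ExB; [|exact: mom_ip_ymat|exact: mom_cst].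
by rewrite !Ex_cst Ex_ip_ymat ?trmx_G// /nsq subrr addr0.
Qed.

(** The drift is a sum of independent centred terms, so the variances add. *)
Lemma Ex_drift2 m :
  Ex (iid_law N m) (fun t => drift t ^+ 2) = m%:R * (2 * Qf L G).
Proof.
elim: m => [|m IH].
  rewrite mul0r -[RHS](Ex_cst (iid_law N 0) 0); apply: Ex_eq => t.
  by rewrite tuple0 /drift /ysum big_nil ipC ip0l mul0r subrr expr0n.
rewrite Ex_iidS; [|exact/momX/mom_drift|by move=> t; exact/momX/mom_drift_cons].
have um : mom N (fun x => ip G (ymat x) - nsq G).
  by apply: momB; [exact: mom_ip_ymat|exact: mom_cst].
transitivity (Ex (iid_law N m) (fun t => drift t ^+ 2 + 2 * Qf L G)).
  apply: Ex_eq => t; transitivity (Ex N (fun x => drift t ^+ 2 +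
    2 * drift t * (ip G (ymat x) - nsq G) + (ip G (ymat x) - nsq G) ^+ 2)).
    by apply: Ex_eq => x; rewrite drift_cons; ring.
  rewrite ExD; [|by apply: momD; [exact: mom_cst|exact: momZ]|exact: momX].
  rewrite ExD; [|exact: mom_cst|exact: momZ].
  rewrite ExZ// ExB; [|exact: mom_ip_ymat|exact: mom_cst].
  rewrite !Ex_cst Ex_ip_ymat ?trmx_G// /nsq subrr mulr0 addr0.
  by rewrite Ex_ip_ymat_var// trmx_G.
rewrite ExD; [|exact/momX/mom_drift|exact: mom_cst].
by rewrite IH Ex_cst -natr1; ring.
Qed.

(** |X X^T|^2 = |X|^4 and <1, Y> = |X|^2 - p, so |Y|^2 is a quadratic polynomial
    in <1, Y>, whose moments are known. *)
Lemma nsq_ymat (x : V) : nsq (ymat x) = ip 1%:M (ymat x) ^+ 2 +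
  (2 * p%:R - 2) * ip 1%:M (ymat x) + p%:R ^+ 2 - p%:R.
Proof.
rewrite ymatE; set c := \col_i _.
rewrite nsqB nsq1 ipBr -[ip 1%:M 1%:M]/(nsq _) nsq1 [ip (c *m c^T) _]ipC.
suff -> : nsq (c *m c^T) = ip 1%:M (c *m c^T) ^+ 2 by ring.
rewrite /nsq /ip trmx1 mul1mx trmx_mul trmxK.
pose r := (c^T *m c) ord0 ord0.
have cc : c^T *m c = r%:M by apply/matrixP => i j; rewrite !ord1 [RHS]mxE eqxx.
have tr_cc : \tr (c *m c^T) = r by rewrite mxtrace_mulC cc mxtrace_scalar.
rewrite -mulmxA (mulmxA c^T) cc mul_scalar_mx -scalemxAr mxtraceZ tr_cc.
by rewrite expr2.
Qed.

End ListMoments.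

(** * Moment bounds for a covariance close to the identity *)

Section Quantitative.
(** The hypotheses are all that the normal approximation uses about the model:
    n and p are comparable, |G| is bounded and G has operator norm of order
    n^(-1/2).  A single constant kappa serves for all bounds; taking it at least
    1000 lets each numerical factor be absorbed by one more power of kappa. *)
Context (R : realType) (n p : nat) (kappa : R) (L : 'M[R]_p).
Notation V := (p.-tuple R).
Notation N := (distribution (iid_law (gauss R) p) (lin_map L)).
Notation G := (L *m L^T - 1%:M).
Hypotheses (n_gt0 : (0 < n)%N) (p_gt0 : (0 < p)%N) (k1000 : 1000 <= kappa).
Hypotheses (pn : p%:R <= kappa * n%:R) (np : n%:R <= kappa * p%:R).
Hypotheses (Gk : nsq G <= kappa).
Hypotheses (Gop : forall B, n%:R * nsq (G *m B) <= kappa * nsq B).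

Let k1 : 1 <= kappa. Proof. by apply: le_trans k1000; rewrite ler1n. Qed.

(** The square root of n is the natural unit: all orders of magnitude below are
    integer powers of it. *)
Definition rho : R := Num.sqrt n%:R.

Lemma ler_sq (a b : R) : 0 <= a -> a <= b -> a ^+ 2 <= b ^+ 2.
Proof. nra. Qed.

Let n1 : 1 <= n%:R :> R. Proof. by rewrite ler1n. Qed.
Let p1 : 1 <= p%:R :> R. Proof. by rewrite ler1n. Qed.
Lemma rho_ge1 : 1 <= rho.
Proof. by rewrite -sqrtr1 ler_wsqrtr// n1. Qed.
Lemma sqr_rho : rho ^+ 2 = n%:R. Proof. by rewrite sqr_sqrtr. Qed.

Lemma ip_G2 S : ip S G ^+ 2 <= kappa * nsq S.
Proof. by rewrite mulrC (le_trans (ip_cauchy_schwarz _ _))// ler_wpM2l ?nsq_ge0. Qed.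

(** Both correction terms of [QfE] contain G S, and |G S|^2 <= kappa |S|^2 / n.
    The weight 1 / rho in the inequality of means balances the cross term. *)
Lemma Qf_dev S : S^T = S -> rho * `|Qf L S - nsq S| <= 3 * kappa * nsq S.
Proof.
move=> Ss; have r1 := rho_ge1; have r0 : 0 < rho by lra.
have h1 := ip_amgm S (G *m S) (t := rho^-1).
rewrite invr_gt0 invrK in h1; have {}h1 := h1 r0.
have h2 := ip_amgm (G *m S) (S *m G) (t := 1) ltr01.
have E : nsq (S *m G) = nsq (G *m S) by rewrite -nsq_trmx trmx_mul trmx_G Ss.
rewrite invr1 !mul1r E in h2.
have h3 := Gop S; rewrite -sqr_rho in h3.
rewrite (_ : Qf L S - _ = 2 * ip S (G *m S) + ip (G *m S) (S *m G)); last first.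
  by rewrite QfE//; ring.
have s0 := nsq_ge0 S; have g0 := nsq_ge0 (G *m S).
have nrm : `|2 * ip S (G *m S) + ip (G *m S) (S *m G)| <=
    2 * `|ip S (G *m S)| + `|ip (G *m S) (S *m G)|.
  by rewrite (le_trans (ler_normD _ _))// normrM ger0_norm.
apply: (@le_trans _ _ (rho * (rho^-1 * nsq S + rho * nsq (G *m S) + nsq (G *m S)))).
  by rewrite ler_pM2l//; lra.
rewrite !mulrDr mulVKf ?gt_eqF// mulrA -expr2.
have h4 : rho * nsq (G *m S) <= rho ^+ 2 * nsq (G *m S).
  by rewrite ler_wpM2r// expr2 ler_peMl// ltW.
have h5 : nsq S <= kappa * nsq S by rewrite ler_peMl.
by lra.
Qed.

Lemma Qf_ge0 S : 0 <= Qf L S. Proof. exact: nsq_ge0. Qed.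

Lemma Qf_le S : S^T = S -> Qf L S <= 4 * kappa * nsq S.
Proof.
move=> Ss; have r1 := rho_ge1; have h := Qf_dev Ss; have s0 := nsq_ge0 S.
have h2 : `|Qf L S - nsq S| <= rho * `|Qf L S - nsq S| by rewrite ler_peMl.
have h3 := ler_norm (Qf L S - nsq S).
have h5 : nsq S <= kappa * nsq S by rewrite ler_peMl.
by lra.
Qed.

Lemma Ex_ip_ymat2_le S : S^T = S ->
  Ex N (fun x => ip S (ymat x) ^+ 2) <= 9 * kappa * nsq S.
Proof.
move=> Ss; rewrite Ex_ip_ymat2//.
by have := Qf_le Ss; have := ip_G2 S; lra.
Qed.

Lemma Ex_ip_ymat4_le S : S^T = S ->
  Ex N (fun x => ip S (ymat x) ^+ 4) <= kappa ^+ 4 * nsq S ^+ 2.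
Proof.
move=> Ss; apply: (le_trans (Ex_ip_ymat4_qform L Ss)).
have h1 : Qf L S ^+ 2 <= (4 * kappa * nsq S) ^+ 2.
  by apply: ler_sq; [exact: Qf_ge0|exact: Qf_le].
have h2 : (ip S G ^+ 2) ^+ 2 <= (kappa * nsq S) ^+ 2.
  by apply: ler_sq; [exact: sqr_ge0|exact: ip_G2].
rewrite -exprM in h2.
rewrite (_ : (4 * _ * _) ^+ 2 = 16 * (kappa * nsq S) ^+ 2) in h1; last by ring.
rewrite (_ : kappa ^+ 4 * _ = kappa * (kappa * (kappa * nsq S) ^+ 2)); last by ring.
have x0 : 0 <= (kappa * nsq S) ^+ 2 by exact: sqr_ge0.
move: x0 h1 h2; set x := (kappa * nsq S) ^+ 2 => x0 h1 h2.
have h3 : 1000 * x <= kappa * x by rewrite ler_wpM2r.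
have h4 : 1000 * (kappa * x) <= kappa * (kappa * x) by rewrite ler_wpM2r//; lra.
lra.
Qed.

Lemma Ex_tr_ymat2_le : Ex N (fun x => ip 1%:M (ymat x) ^+ 2) <= 9 * kappa * p%:R.
Proof. by have := Ex_ip_ymat2_le (trmx1 R p); rewrite nsq1. Qed.

Lemma Ex_tr_ymat4_le : Ex N (fun x => ip 1%:M (ymat x) ^+ 4) <= kappa ^+ 4 * p%:R ^+ 2.
Proof. by have := Ex_ip_ymat4_le (trmx1 R p); rewrite nsq1. Qed.

Lemma Ex_tr_ymat_le : `|Ex N (fun x => ip 1%:M (ymat x))| <= kappa * p%:R.
Proof.
have P1 := p1; have K1 := k1; have kp : 1 <= kappa * p%:R by nra.
rewrite -ler_sqr ?nnegrE//; last lra.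
rewrite real_normK ?num_real// Ex_ip_ymat ?trmx1//.
by have := ip_G2 1%:M; rewrite nsq1 => /le_trans; apply; nra.
Qed.

Lemma Ex_nsq_ymat_le : Ex N (fun x => nsq (ymat x)) <= 12 * kappa * p%:R ^+ 2.
Proof.
have P1 := p1; have K1 := k1; have K := k1000; have wm := mom_ip_ymat L 1%:M.
under eq_fun do rewrite nsq_ymat -addrA.
rewrite ExD; [|by apply: momD; [exact: momX|exact: momZ]|exact: mom_cst].
rewrite ExD; [|exact: momX|exact: momZ].
rewrite ExZ// Ex_cst.
have h2 := Ex_tr_ymat2_le; have := Ex_tr_ymat_le; rewrite ler_norml => /andP[_ h1].
have h3 : (2 * p%:R - 2) * Ex N (fun x => ip 1%:M (ymat x)) <=
   (2 * p%:R - 2) * (kappa * p%:R) by rewrite ler_wpM2l//; lra.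
have h4 : kappa * p%:R <= kappa * p%:R ^+ 2 by rewrite ler_wpM2l ?expr2 ?ler_peMl//; lra.
have h5 : p%:R ^+ 2 <= kappa * p%:R ^+ 2 by rewrite ler_peMl// sqr_ge0.
by nra.
Qed.

(** Given S, a further observation adds 2 <G, S> + E |Y|^2 to the mean of |S|^2.
    Here <G, S> has mean m |G|^2, and E |Y|^2 is of order p^2. *)
Lemma Ex_nsq_ysum_lin m : (m <= n)%N ->
  Ex (iid_law N m) (fun t => nsq (ysum t)) <=
  m%:R * (2 * n%:R * kappa + 12 * kappa * p%:R ^+ 2).
Proof.
elim: m => [|m IH] mn.
  rewrite mul0r -[leRHS](Ex_cst (iid_law N 0) 0) le_eqVlt; apply/orP; left.
  by apply/eqP; apply: Ex_eq => t; rewrite tuple0 /ysum big_nil /nsq ip0l.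
have Ym t : mom N (fun x => 2 * ip t (ymat x)) by apply: momZ; exact: mom_ip_ymat.
have E t : Ex N (fun x => nsq (ysum (x :: tval t))) =
    nsq (ysum t) + 2 * ip G (ysum t) + Ex N (fun x => nsq (ymat x)) :> R.
  transitivity (Ex N (fun x => nsq (ysum t) + 2 * ip (ysum t) (ymat x) + nsq (ymat x))).
    by apply: Ex_eq => x; rewrite ysum_cons addrC nsqD.
  rewrite ExD; [|apply: momD => //; exact: mom_cst|exact: mom_nsq_ymat].
  rewrite ExD; [|exact: mom_cst|exact: Ym].
  rewrite ExZ; last exact: mom_ip_ymat.
  by rewrite Ex_cst Ex_ip_ymat ?trmx_ysum// (ipC G).
rewrite Ex_iidS; [|exact: mom_nsq_ysum|move=> t]; last first.
  under eq_fun do rewrite /= ysum_cons addrC nsqD.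
  by apply: momD; [apply: momD => //; exact: mom_cst|exact: mom_nsq_ymat].
under eq_fun do rewrite E.
rewrite ExD; [|apply: momD; [exact: mom_nsq_ysum|apply: momZ; exact: mom_ip_ysum]|exact: mom_cst].
rewrite ExD; [|exact: mom_nsq_ysum|apply: momZ; exact: mom_ip_ysum].
rewrite ExZ; last exact: mom_ip_ysum.
have D : Ex (iid_law N m) (fun t => ip G (ysum t)) = m%:R * nsq G.
  have := Ex_drift L m; rewrite /drift.
  under eq_fun do rewrite size_tuple.
  rewrite ExB; [|exact: mom_ip_ysum|exact: mom_cst].
  by rewrite Ex_cst => /eqP; rewrite subr_eq0 => /eqP.
rewrite D Ex_cst.
have {}IH := IH (ltnW mn); have EY := Ex_nsq_ymat_le.
have mn' : m%:R <= n%:R :> R by rewrite ler_nat ltnW.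
have h : m%:R * nsq G <= n%:R * kappa by rewrite ler_pM// nsq_ge0.
by rewrite -natr1; nra.
Qed.

Lemma Ex_nsq_ysum_le m : (m <= n)%N ->
  Ex (iid_law N m) (fun t => nsq (ysum t)) <= 14 * kappa ^+ 4 * n%:R ^+ 3.
Proof.
move=> mn; apply: (le_trans (Ex_nsq_ysum_lin mn)).
have P1 := p1; have N1 := n1; have K1 := k1; have K := k1000.
have mn' : m%:R <= n%:R :> R by rewrite ler_nat.
have h1 : p%:R ^+ 2 <= (kappa * n%:R) ^+ 2 by apply: ler_sq.
have k3 : 1 <= kappa ^+ 3 by rewrite exprn_ege1.
have h2 : n%:R * kappa <= kappa ^+ 4 * n%:R ^+ 2.
  rewrite (_ : _ * _ = kappa * n%:R); last by ring.
  by rewrite exprS expr2 -mulrA ler_wpM2l; [nra|lra|nra].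
have h3 : kappa * p%:R ^+ 2 <= kappa ^+ 4 * n%:R ^+ 2.
  apply: (@le_trans _ _ (kappa * (kappa * n%:R) ^+ 2)); first by rewrite ler_wpM2l//; lra.
  rewrite exprMn mulrA -exprS ler_wpM2r ?sqr_ge0// ler_weXn2l//.
have : 0 <= 2 * n%:R * kappa + 12 * kappa * p%:R ^+ 2 by nra.
move=> c0; apply: (@le_trans _ _ (n%:R * (14 * (kappa ^+ 4 * n%:R ^+ 2)))).
  by rewrite ler_pM//; nra.
by rewrite (_ : 14 * _ * _ = n%:R * (14 * (kappa ^+ 4 * n%:R ^+ 2)))//; ring.
Qed.

(** The deviation of |S|^2 from its leading term m p^2. *)
Definition dev (s : seq V) : R := nsq (ysum s) - (size s)%:R * p%:R ^+ 2.

Definition dev_incr (s : seq V) (x : V) : R :=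
  2 * ip (ysum s) (ymat x) + nsq (ymat x) - p%:R ^+ 2.

Lemma dev_cons x s : dev (x :: s) = dev s + dev_incr s x.
Proof. by rewrite /dev /dev_incr ysum_cons [ymat x + _]addrC nsqD /= -natr1; ring. Qed.

Lemma mom_dev m : mom (iid_law N m) (fun t => dev t).
Proof.
rewrite /dev; under eq_fun do rewrite size_tuple.
by apply: momB; [exact: mom_nsq_ysum|exact: mom_cst].
Qed.

Lemma mom_dev_incr s : mom N (dev_incr s).
Proof.
apply: momB; last exact: mom_cst.
by apply: momD; [apply: momZ; exact: mom_ip_ymat|exact: mom_nsq_ymat].
Qed.

(** In |Y|^2 - p^2 the leading terms cancel: by [nsq_ymat] what remains is
    w^2 + (2 p - 2) w - p with w = <1, Y> of order sqrt p.  Its second moment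
    is of order p^3 instead of p^4, and this makes |S|^2 concentrate. *)
Lemma Ex_dev_incr2_le s : Ex N (fun x => dev_incr s x ^+ 2) <=
  144 * kappa * nsq (ysum s) + 5 * kappa ^+ 4 * p%:R ^+ 3.
Proof.
have P1 := p1; have K1 := k1; have K := k1000.
have qm := mom_ip_ymat L (ysum s); have wm := mom_ip_ymat L 1%:M.
pose F x := 16 * ip (ysum s) (ymat x) ^+ 2 + 4 * ip 1%:M (ymat x) ^+ 4 +
  16 * p%:R ^+ 2 * ip 1%:M (ymat x) ^+ 2 + 4 * p%:R ^+ 2.
have m1 := momX 2 qm; have m2 := momX 4 wm; have m3 := momX 2 wm.
have Fm : mom N F by do ! [apply: momD|exact: mom_cst|exact: momZ|].
apply: (@le_trans _ _ (Ex N F)).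
  apply: le_Ex => //; first exact/momX/mom_dev_incr.
  move=> x; rewrite /dev_incr nsq_ymat /F.
  set q := ip (ysum s) _; set w := ip _ _; set P := p%:R.
  rewrite (_ : 2 * q + _ - _ = 2 * q + w ^+ 2 + (2 * P - 2) * w - P); last by ring.
  have h4 a b c d : (a + b + c - d) ^+ 2 <= 4 * (a ^+ 2 + b ^+ 2 + c ^+ 2 + d ^+ 2) :> R.
    have := sqr_ge0 (a - b); have := sqr_ge0 (a - c); have := sqr_ge0 (a + d).
    have := sqr_ge0 (b - c); have := sqr_ge0 (b + d); have := sqr_ge0 (c + d).
    by nra.
  apply: (le_trans (h4 _ _ _ _)).
  rewrite -(exprM w 2 2) !exprMn.
  have : (2 * P - 2) ^+ 2 * w ^+ 2 <= 4 * P ^+ 2 * w ^+ 2.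
    rewrite ler_wpM2r ?sqr_ge0//; rewrite -/P in P1; nra.
  by nra.
have -> : Ex N F = 16 * Ex N (fun x => ip (ysum s) (ymat x) ^+ 2)
    + 4 * Ex N (fun x => ip 1%:M (ymat x) ^+ 4)
    + 16 * p%:R ^+ 2 * Ex N (fun x => ip 1%:M (ymat x) ^+ 2) + 4 * p%:R ^+ 2.
  rewrite /F !ExD ?ExZ ?Ex_cst//; do ! [apply: momD|exact: mom_cst|exact: momZ|] => //.
have e1 := Ex_ip_ymat2_le (trmx_ysum s); have e2 := Ex_tr_ymat4_le; have e3 := Ex_tr_ymat2_le.
have e4 : 16 * p%:R ^+ 2 * Ex N (fun x => ip 1%:M (ymat x) ^+ 2) <=
    144 * (kappa * p%:R ^+ 3).
  rewrite [leRHS](_ : _ = 16 * p%:R ^+ 2 * (9 * kappa * p%:R)); last by ring.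
  by rewrite ler_wpM2l// mulr_ge0// sqr_ge0.
have p2 : 0 <= p%:R ^+ 2 :> R by rewrite sqr_ge0.
have p3 : p%:R ^+ 2 <= p%:R ^+ 3 :> R by rewrite exprS ler_peMl.
have p4 : kappa ^+ 4 * p%:R ^+ 2 <= kappa ^+ 4 * p%:R ^+ 3.
  by rewrite ler_wpM2l// exprn_ge0//; lra.
have k4 : 1000 * kappa <= kappa ^+ 4.
  rewrite exprS mulrC ler_wpM2l//; first lra.
  by rewrite (le_trans K)// exprS ler_peMr ?exprn_ege1//; lra.
have p5 : 1000 * (kappa * p%:R ^+ 3) <= kappa ^+ 4 * p%:R ^+ 3.
  by rewrite mulrA ler_wpM2r// exprn_ge0.
have p6 : p%:R ^+ 3 <= kappa * p%:R ^+ 3 by rewrite ler_peMl// exprn_ge0.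
lra.
Qed.

(** The increments of [dev] are small but not centred, so their sizes simply add
    in L^2, which gives the factor m^2.  The inequality
    (a + b)^2 <= (1 + 1/m) a^2 + (1 + m) b^2 is the triangle inequality of L^2
    in a form that can be integrated step by step: it turns m^2 into
    (m + 1)^2. *)
Lemma Ex_dev2_le m : (m <= n)%N ->
  Ex (iid_law N m) (fun t => dev t ^+ 2) <=
  m%:R ^+ 2 * (6 * kappa ^+ 7 * n%:R ^+ 3).
Proof.
have P1 := p1; have N1 := n1; have K1 := k1; have K := k1000.
set B := 6 * _ * _.
elim: m => [|m IH] mn.
  rewrite expr0n mul0r -[leRHS](Ex_cst (iid_law N 0) 0) le_eqVlt; apply/orP; left.
  by apply/eqP; apply: Ex_eq => t;
    rewrite tuple0 /dev /ysum big_nil /nsq ip0l mul0r subrr expr0n.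
have sq_incr (t : m.-tuple V) x : (dev t + dev_incr t x) ^+ 2 <=
    (1 + m%:R^-1) * dev t ^+ 2 + (1 + m%:R) * dev_incr t x ^+ 2.
  (* For m = 0 the inverse of m is 0, and the inequality holds as dev t = 0. *)
  have [m0|m_gt0] := posnP m.
    have -> : dev t = 0.
      have : size (tval t) = 0%N by rewrite size_tuple.
      case: (tval t) => // _.
      by rewrite /dev /ysum big_nil /nsq ip0l mul0r subrr.
    by move: (dev_incr t x) => b; rewrite m0 add0r expr0n mulr0 add0r addr0 mul1r.
  have M0 : 0 < m%:R :> R by rewrite ltr0n.
  rewrite -subr_ge0.
  set a := dev t; set b := dev_incr t x.
  have -> : (1 + m%:R^-1) * a ^+ 2 + (1 + m%:R) * b ^+ 2 - (a + b) ^+ 2 =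
    m%:R^-1 * (a - m%:R * b) ^+ 2 by field; rewrite gt_eqF.
  by rewrite mulr_ge0 ?sqr_ge0// invr_ge0 ltW.
have devm t : mom N (fun x => dev (x :: t)).
  under eq_fun do rewrite dev_cons.
  by apply: momD; [exact: mom_cst|exact: mom_dev_incr].
have dm := momX 2 (mom_dev m).
pose g (t : m.-tuple V) := (1 + m%:R^-1) * dev t ^+ 2 +
  (1 + m%:R) * (144 * kappa * nsq (ysum t) + 5 * kappa ^+ 4 * p%:R ^+ 3).
have gm : mom (iid_law N m) g.
  apply: momD; first exact: momZ.
  apply: momZ; apply: momD; last exact: mom_cst.
  by apply: momZ; exact: mom_nsq_ysum.
apply: (@le_trans _ _ (Ex (iid_law N m) g)).
  apply: le_Ex_iidS => //; first exact/momX/mom_dev.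
    by move=> t; exact/momX/devm.
  move=> t /=.
  apply: (@le_trans _ _ (Ex N (fun x => (1 + m%:R^-1) * dev t ^+ 2 +
      (1 + m%:R) * dev_incr t x ^+ 2))).
    apply: le_Ex; first exact/momX/devm.
      apply: momD; first exact: mom_cst.
      by apply: momZ; exact/momX/mom_dev_incr.
    by move=> x; rewrite dev_cons; exact: sq_incr.
  have im : mom N (fun x => dev_incr t x ^+ 2) by exact/momX/mom_dev_incr.
  rewrite ExD; [|exact: mom_cst|exact: momZ].
  by rewrite Ex_cst ExZ// lerD2l ler_wpM2l// Ex_dev_incr2_le.
have nm := momZ (144 * kappa) (mom_nsq_ysum L m).
have hm := momD nm (mom_cst (iid_law N m) (5 * kappa ^+ 4 * p%:R ^+ 3)).
rewrite /g (ExD (momZ (1 + m%:R^-1) dm) (momZ (1 + m%:R) hm)) (ExZ _ dm) (ExZ _ hm).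
rewrite (ExD nm (mom_cst _ _)) (ExZ _ (mom_nsq_ysum L m)).
rewrite Ex_cst.
have hS := Ex_nsq_ysum_le (ltnW mn); have {}IH := IH (ltnW mn).
have hB : 144 * kappa * Ex (iid_law N m) (fun t => nsq (ysum t)) +
    5 * kappa ^+ 4 * p%:R ^+ 3 <= B.
  have h1 : 144 * kappa * Ex (iid_law N m) (fun t => nsq (ysum t)) <=
      144 * kappa * (14 * kappa ^+ 4 * n%:R ^+ 3).
    by rewrite ler_wpM2l// mulr_ge0//; lra.
  have h2 : p%:R ^+ 3 <= (kappa * n%:R) ^+ 3.
    by rewrite lerXn2r ?nnegrE// mulr_ge0//; lra.
  have h3 : kappa ^+ 4 * p%:R ^+ 3 <= kappa ^+ 7 * n%:R ^+ 3.
    rewrite (_ : kappa ^+ 7 * _ = kappa ^+ 4 * (kappa * n%:R) ^+ 3); last by ring.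
    by rewrite ler_wpM2l// exprn_ge0//; lra.
  have n3 : 0 <= kappa ^+ 5 * n%:R ^+ 3.
    by rewrite mulr_ge0// exprn_ge0//; lra.
  have h4 : 1000 * (kappa ^+ 5 * n%:R ^+ 3) <= kappa * (kappa ^+ 5 * n%:R ^+ 3).
    by rewrite ler_wpM2r.
  have h5 : 1000 * (kappa * (kappa ^+ 5 * n%:R ^+ 3)) <= kappa * (kappa * (kappa ^+ 5 * n%:R ^+ 3)).
    by rewrite ler_wpM2r// mulr_ge0//; lra.
  rewrite (_ : kappa * (kappa * _) = kappa ^+ 7 * n%:R ^+ 3) in h5; last by ring.
  rewrite (_ : 144 * kappa * (14 * _ * _) = 2016 * (kappa ^+ 5 * n%:R ^+ 3)) in h1; last by ring.
  rewrite /B; lra.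
have m0 : 0 <= 1 + m%:R^-1 :> R by rewrite addr_ge0// invr_ge0.
apply: (@le_trans _ _ ((1 + m%:R^-1) * (m%:R ^+ 2 * B) + (1 + m%:R) * B)).
  by rewrite lerD// ler_wpM2l.
rewrite mulrA -mulrDl le_eqVlt; apply/orP; left; apply/eqP; congr (_ * _).
rewrite -natr1; have [->|m_gt0] := posnP m.
  by rewrite invr0; ring.
by field; rewrite pnatr_eq0 -lt0n.
Qed.

Lemma Ex_nsq_ysum2_le m : (m <= n)%N ->
  Ex (iid_law N m) (fun t => nsq (ysum t) ^+ 2) <= kappa ^+ 8 * n%:R ^+ 6.
Proof.
move=> mn; have P1 := p1; have N1 := n1; have K1 := k1; have K := k1000.
have dm := momX 2 (mom_dev m).
have mn' : m%:R <= n%:R :> R by rewrite ler_nat.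
apply: (@le_trans _ _ (Ex (iid_law N m)
    (fun t => 2 * dev t ^+ 2 + 2 * (m%:R * p%:R ^+ 2) ^+ 2))).
  apply: le_Ex; first exact/momX/mom_nsq_ysum.
    by apply: momD; [exact: momZ|exact: mom_cst].
  move=> t; rewrite /dev size_tuple.
  have h (a b : R) : a ^+ 2 <= 2 * (a - b) ^+ 2 + 2 * b ^+ 2.
    by have := sqr_ge0 (a - 2 * b); nra.
  exact: h.
rewrite ExD; [|exact: momZ|exact: mom_cst].
rewrite ExZ// Ex_cst.
have h1 : m%:R ^+ 2 * (6 * kappa ^+ 7 * n%:R ^+ 3) <= n%:R ^+ 2 * (6 * kappa ^+ 7 * n%:R ^+ 3).
  apply: ler_wpM2r; last exact: ler_sq.
  by apply: mulr_ge0; [apply: mulr_ge0 => //; rewrite exprn_ge0//; lra|rewrite exprn_ge0].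
have h2 := le_trans (Ex_dev2_le mn) h1.
have h3 : (m%:R * p%:R ^+ 2) ^+ 2 <= (n%:R * (kappa * n%:R) ^+ 2) ^+ 2.
  apply: ler_sq; first by rewrite mulr_ge0// sqr_ge0.
  by rewrite ler_pM ?sqr_ge0//; exact: ler_sq.
rewrite (_ : (n%:R * (kappa * n%:R) ^+ 2) ^+ 2 = kappa ^+ 4 * n%:R ^+ 6) in h3; last by ring.
rewrite (_ : _ ^+ 2 * (6 * _ * _) = 6 * (kappa ^+ 7 * n%:R ^+ 5)) in h2; last by ring.
have h4 : kappa ^+ 7 * n%:R ^+ 5 <= kappa ^+ 7 * n%:R ^+ 6.
  by apply: ler_wpM2l; [rewrite exprn_ge0//; lra|rewrite ler_weXn2l].
have h5 : kappa ^+ 4 * n%:R ^+ 6 <= kappa ^+ 7 * n%:R ^+ 6.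
  by apply: ler_wpM2r; [rewrite exprn_ge0|rewrite ler_weXn2l].
have h6 : 1000 * (kappa ^+ 7 * n%:R ^+ 6) <= kappa * (kappa ^+ 7 * n%:R ^+ 6).
  by rewrite ler_wpM2r// mulr_ge0// exprn_ge0//; lra.
rewrite (_ : kappa * (_ * _) = kappa ^+ 8 * n%:R ^+ 6) in h6; last by ring.
have h7 : 0 <= kappa ^+ 7 * n%:R ^+ 6 by rewrite mulr_ge0// exprn_ge0//; lra.
lra.
Qed.

Lemma Ex_drift2_le m : (m <= n)%N ->
  Ex (iid_law N m) (fun t => drift L t ^+ 2) <= 8 * kappa ^+ 2 * n%:R.
Proof.
move=> mn; rewrite Ex_drift2.
have K1 := k1; have GK := Gk; have G0 := nsq_ge0 G.
have h1 := Qf_le (trmx_G L); have h0 := Qf_ge0 G.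
have mn' : m%:R <= n%:R :> R by rewrite ler_nat.
have h2 : Qf L G <= 4 * kappa * kappa by nra.
apply: (@le_trans _ _ (n%:R * (2 * (4 * kappa * kappa)))).
  by rewrite ler_pM//; lra.
rewrite le_eqVlt; apply/orP; left; apply/eqP; ring.
Qed.

End Quantitative.

(** * The normal distribution function *)

Section NormalCdf.
Context (R : realType).
Notation mu := (@lebesgue_measure R).
Implicit Types (x y u w : R).

Lemma is_derive_Phi x : is_derive x 1 (@Phi R) (phi x).
Proof.
have fi : mu.-integrable [set` `]-oo, (x + 1)%R]] (EFin \o @phi R).
  by apply: integrableS (integrable_phi R).
have xx1 : x < x + 1 by rewrite ltrDl.
have [|d dE] := continuous_FTC1 xx1 fi _ (@continuous_phi R x); first by rewrite ltNyr.
apply: DeriveDef; first exact: d.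
by rewrite -derive1E dE.
Qed.

Lemma measurable_Phi : measurable_fun setT (@Phi R).
Proof.
apply: continuous_measurable_fun => x; apply/differentiable_continuous/derivable1_diffP.
by case: (is_derive_Phi x).
Qed.

Lemma Phi_ge0 x : 0 <= Phi x.
Proof. by rewrite fine_ge0. Qed.

Lemma Phi_cdf x : (Phi x)%:E = @gauss R `]-oo, x]%classic.
Proof. by rewrite /Phi fineK// fin_num_measure. Qed.

Lemma Phi_le1 x : Phi x <= 1.
Proof. by rewrite -lee_fin Phi_cdf probability_le1. Qed.

Lemma Phi_nd x y : x <= y -> Phi x <= Phi y.
Proof.
move=> xy; rewrite -lee_fin !Phi_cdf le_measure ?inE//.
by apply: subset_itvl; rewrite bnd_simp.
Qed.

(** By the mean value theorem; iterating it replaces Taylor's formula. *)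
Lemma bound_antiderivative (F f : R -> R) k C :
  (forall x, is_derive x 1 F (f x)) -> F 0 = 0 ->
  (forall x, `|f x| <= C * `|x| ^+ k) -> forall x, `|F x| <= C * `|x| ^+ k.+1.
Proof.
move=> dF F0 fC x.
have cF : continuous F.
  by move=> z; apply/differentiable_continuous/derivable1_diffP; case: (dF z).
have C0 : 0 <= C.
  by have := le_trans (normr_ge0 _) (fC 1); rewrite normr1 expr1n mulr1.
have H c : `|c| <= `|x| -> `|f c| * `|x| <= C * `|x| ^+ k.+1.
  move=> cx; rewrite exprSr mulrA ler_wpM2r// (le_trans (fC c))// ler_wpM2l//.
  by rewrite lerXn2r ?nnegrE.
have [x0|x0] := leP 0 x.
  have [c] := MVT_segment x0 (fun z _ => dF z) (continuous_subspaceT cF).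
  rewrite in_itv/= F0 !subr0 => /andP[c0 cx] ->.
  by rewrite normrM; apply: H; rewrite !ger0_norm.
have [c] := MVT_segment (ltW x0) (fun z _ => dF z) (continuous_subspaceT cF).
rewrite in_itv/= F0 !sub0r => /andP[c0 cx] E.
rewrite -normrN E normrM normrN; apply: H.
by rewrite !ler0_norm ?lerN2// ltW.
Qed.

(** The normal density is bounded by 1. *)
Lemma Phi_lip x y : `|Phi x - Phi y| <= `|x - y|.
Proof.
have d (t : R) : is_derive t 1 (fun t : R => Phi (y + t) - Phi y) (phi (y + t)).
  have h : is_derive (y + t) 1 (@Phi R) (phi (y + t)) by exact: is_derive_Phi.
  have h1 : is_derive t (1:R) (fun t : R => y + t) (1:R) by apply: is_derive_eq; rewrite mulr1 add0r.
  have := is_derive1_comp h h1; rewrite mulr1 => h2.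
  by apply: is_derive_eq; rewrite subr0.
have := bound_antiderivative (k := 0) (C := 1) d _ _ (x - y).
rewrite addr0 subrr expr1 mul1r (_ : y + (x - y) = x); last by ring.
apply => // t.
by rewrite expr0 mulr1 ger0_norm ?phi_ge0// phi_le1.
Qed.

(** The limits of Phi are those of the distribution function of the identity,
    seen as a random variable under the normal law. *)
Let idR : measurableTypeR R -> R := idfun.
#[local] HB.instance Definition _ :=
  @isMeasurableFun.Build _ _ _ _ idR (@measurable_id _ _ setT).

Lemma Phi_lim1 (e : R) : 0 < e -> exists2 x, 0 < x & 1 - e <= Phi x.
Proof.
move=> e0; pose X := (idR : {RV (@gauss R) >-> R}).
have cE x : cdf X x = (Phi x)%:E by rewrite Phi_cdf.
have h : (fun x => (Phi x)%:E) @ +oo%R --> 1%E.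
  have := cvg_cdfy1 X; apply: cvg_trans; apply: near_eq_cvg.
  by near=> x; rewrite cE.
have h2 : (Phi x : R) @[x --> +oo%R] --> (1 : R) by exact: (fine_cvg h).
have /cvgrPdist_le /(_ _ e0) [A [_ hA]] := h2.
exists (Num.max 1 (A + 1)); first by rewrite lt_max ltr01.
have := hA (Num.max 1 (A + 1)); rewrite lt_max ltrDl ltr01 orbT => /(_ isT) /=.
by rewrite ler_norml => /andP[_]; lra.
Unshelve. all: by end_near. Qed.

Lemma Phi_lim0 (e : R) : 0 < e -> exists2 x, 0 < x & Phi (- x) <= e.
Proof.
move=> e0; pose X := (idR : {RV (@gauss R) >-> R}).
have cE x : cdf X x = (Phi x)%:E by rewrite Phi_cdf.
have h : (fun x => (Phi x)%:E) @ -oo%R --> 0%E.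
  have := cvg_cdfNy0 X; apply: cvg_trans; apply: near_eq_cvg.
  by near=> x; rewrite cE.
have h2 : (Phi x : R) @[x --> -oo%R] --> (0 : R) by exact: (fine_cvg h).
have /cvgrPdist_le /(_ _ e0) [A [_ hA]] := h2.
exists (Num.max 1 (- A + 1)); first by rewrite lt_max ltr01.
have := hA (- Num.max 1 (- A + 1)).
rewrite ltrNl lt_max ltrDl ltr01 orbT => /(_ isT) /=.
by rewrite sub0r normrN ger0_norm// Phi_ge0.
Unshelve. all: by end_near. Qed.

End NormalCdf.

(** * A random increment as a step of the heat flow *)

Section HeatKernel.
Context (R : realType).
Implicit Types (y u w e tau v d : R).

(** Uniform bounds for the first three derivatives of phi, up to constants. *)
Lemma phi_derivs_bound : exists2 C : R, 0 <= C &
  forall u, [/\ `|u| * phi u <= C, `|u ^+ 2 - 1| * phi u <= C &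
    `|u| * (u ^+ 2 + 1) * phi u <= C].
Proof.
have [C1 C10 h1] := @exprn_phi_le R 1; have [C2 C20 h2] := @exprn_phi_le R 2.
have [C3 C30 h3] := @exprn_phi_le R 3; have [C0 C00 h0] := @exprn_phi_le R 0.
exists (C0 + C1 + C2 + C3); first by rewrite !addr_ge0.
move=> u; have := h0 u; have := h1 u; have := h2 u; have := h3 u.
rewrite expr0 mul1r expr1 -[u ^+ 2]real_normK ?num_real//.
set a := `|u|; set f := phi u => H3 H2 H1 H0.
have f0 : 0 <= f by exact: phi_ge0.
have a0 : 0 <= a by exact: normr_ge0.
split; first by lra.
- apply: (@le_trans _ _ ((a ^+ 2 + 1) * f)); last by rewrite mulrDl mul1r; lra.
  rewrite ler_wpM2r// (le_trans (ler_normB _ _))// normr1 ger0_norm ?sqr_ge0//.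
- by rewrite (_ : a * (a ^+ 2 + 1) * f = a ^+ 3 * f + a * f); [lra|ring].
Qed.

Lemma is_derive_shift (F : R -> R) u w f :
  is_derive (u + w) 1 F f -> is_derive w 1 (fun t => F (u + t)) f.
Proof.
move=> h.
have h1 : is_derive w (1:R) (fun t : R => u + t) (1:R).
  by apply: is_derive_eq; rewrite mulr1 add0r.
by have := is_derive1_comp h h1; rewrite mulr1.
Qed.

(** Taylor's formula of order 3, obtained by integrating the bound on the third
    derivative of Phi three times. *)
Lemma Phi_taylor3 : exists2 C : R, 0 <= C & forall u w,
  `|Phi (u + w) - Phi u - phi u * w + u * phi u * w ^+ 2 / 2| <= C * `|w| ^+ 3.
Proof.
have [C C0 hC] := phi_derivs_bound.
exists C => // u.
have d0 (t : R) : is_derive t 1 (fun t : R => - (u + t) * phi (u + t))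
    (((u + t) ^+ 2 - 1) * phi (u + t)).
  apply: (is_derive_shift (F := fun s => - s * phi s)).
  set s := u + t; have dphi := is_derive_phi s.
  have := is_deriveM (is_deriveN (is_derive_id s (1:R))) dphi.
  rewrite /GRing.scale /=.
  rewrite (_ : - s * (- s * phi s) + phi s * -1 = (s ^+ 2 - 1) * phi s); last by ring.
  done.
have b2 t : `|- (u + t) * phi (u + t) + u * phi u| <= C * `|t| ^+ 1.
  apply: (@bound_antiderivative _ (fun t => - (u + t) * phi (u + t) + u * phi u)
    (fun t => ((u + t) ^+ 2 - 1) * phi (u + t)) 0 C).
  - by move=> s; apply: is_derive_eq; rewrite addr0.
  - by rewrite addr0; ring.
  - move=> s; rewrite expr0 mulr1 normrM [`|phi _|]ger0_norm ?phi_ge0//.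
    by have [_ ] := hC (u + s).
have b1 t : `|phi (u + t) - phi u + u * phi u * t| <= C * `|t| ^+ 2.
  apply: (@bound_antiderivative _ (fun t => phi (u + t) - phi u + u * phi u * t)
    (fun t => - (u + t) * phi (u + t) + u * phi u) 1 C) => //.
  - move=> s; have dphi := is_derive_shift (is_derive_phi (u + s)).
    by apply: is_derive_eq; rewrite /GRing.scale /=; ring.
  - by rewrite addr0; ring.
move=> w.
apply: (@bound_antiderivative _
  (fun t => Phi (u + t) - Phi u - phi u * t + u * phi u * t ^+ 2 / 2)
  (fun t => phi (u + t) - phi u + u * phi u * t) 2 C) => //.
- move=> s; have dPhi := is_derive_shift (is_derive_Phi (u + s)).
  by apply: is_derive_eq; rewrite /GRing.scale /=; field.
- by rewrite addr0 expr0n /= !mulr0 mul0r subrr subr0 addr0.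
Qed.

(** The second derivative of Phi (y / sqrt tau) in y.  It is also twice the
    derivative in tau: this is the heat equation. *)
Definition ker2 y tau := - (y / Num.sqrt tau * phi (y / Num.sqrt tau)) / tau.

Lemma is_derive_divsqrt y tau : 0 < tau ->
  is_derive tau 1 (fun t => y / Num.sqrt t) (- (y / Num.sqrt tau) / (2 * tau)).
Proof.
move=> t0; have ds := is_derive1_sqrt t0.
have s0 : Num.sqrt tau != 0 by rewrite gt_eqF// sqrtr_gt0.
have := is_deriveM (is_derive_cst y tau 1) (is_deriveV s0 ds).
rewrite /GRing.scale /=.
set D := _ + _; rewrite (_ : D = - (y / Num.sqrt tau) / (2 * tau)) //.
rewrite /D; have E : tau = Num.sqrt tau ^+ 2 by rewrite sqr_sqrtr ?ltW.
move: s0 E; move: (Num.sqrt tau) => s s0 ->.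
by field.
Qed.

Lemma is_derive_Phi_heat y tau : 0 < tau ->
  is_derive tau 1 (fun t => Phi (y / Num.sqrt t)) (ker2 y tau / 2).
Proof.
move=> t0; have d1 := is_derive_divsqrt y t0.
have := is_derive1_comp (g := fun t : R => y / Num.sqrt t) (is_derive_Phi (y / Num.sqrt tau)) d1.
rewrite (_ : phi _ * _ = ker2 y tau / 2) //.
by rewrite /ker2; field; rewrite !gt_eqF// sqrtr_gt0.
Qed.

Lemma is_derive_ker2 y tau (u := y / Num.sqrt tau) : 0 < tau ->
  is_derive tau 1 (ker2 y) ((3 - u ^+ 2) * u * phi u / (2 * tau ^+ 2)).
Proof.
move=> t0; have d1 := is_derive_divsqrt y t0.
have d2 := is_derive1_comp (g := fun t : R => y / Num.sqrt t) (is_derive_phi (y / Num.sqrt tau)) d1.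
have tn0 : tau != 0 by rewrite gt_eqF.
have := is_deriveM (is_deriveN (is_deriveM d1 d2)) (is_deriveV tn0 (is_derive_id tau (1:R))).
rewrite /GRing.scale /= -/u.
set D := _ + _; rewrite (_ : D = (3 - u ^+ 2) * u * phi u / (2 * tau ^+ 2)) //.
rewrite /D [X in X * _ + _](_ : _ = - (u * phi u)) //.
by clear D; move: u => v; field.
Qed.

(** Taylor's formula of order 2 in the time variable; the second time derivative
    is bounded as long as tau stays away from 0. *)
Lemma Phi_heat_step e : 0 < e -> exists2 C : R, 0 <= C & forall y tau v,
  e <= tau -> 0 <= v ->
  `|Phi (y / Num.sqrt (tau + v)) - Phi (y / Num.sqrt tau) - ker2 y tau / 2 * v|
    <= C * v ^+ 2.
Proof.
move=> e0; have [C C0 hC] := phi_derivs_bound.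
pose K := 2 * C / e ^+ 2.
have K0 : 0 <= K by rewrite divr_ge0 ?sqr_ge0// mulr_ge0.
exists K => // y tau v et v0.
have t0 : 0 < tau by lra.
have tv : tau <= tau + v by rewrite lerDl.
have pos (c : R) : tau <= c -> 0 < c by lra.
have cont (F f : R -> R) : (forall c : R, 0 < c -> is_derive c 1 F (f c)) ->
    forall a b, 0 < a -> {within `[a, b], continuous F}.
  move=> dF a b a0; apply: derivable_within_continuous => c.
  rewrite in_itv/= => /andP[ac _]; by case: (dF c (lt_le_trans a0 ac)).
have mvt (F f : R -> R) b : (forall c : R, 0 < c -> is_derive c 1 F (f c)) -> tau <= b ->
    exists2 c, tau <= c <= b & F b - F tau = f c * (b - tau).
  move=> dF tb.
  have dF' c : c \in `]tau, b[ -> is_derive c 1 F (f c).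
    by rewrite in_itv/= => /andP[tc _]; apply: dF; exact: lt_trans t0 tc.
  have [c cI cE] := MVT_segment tb dF' (cont F f dF tau b t0).
  by exists c => //; move: cI; rewrite in_itv.
have kerlip c : tau <= c -> `|ker2 y c - ker2 y tau| <= K * (c - tau).
  move=> tc; have [c' /andP[tc' _] ->] := mvt _ _ _ (@is_derive_ker2 y) tc.
  rewrite normrM [`|c - tau|]ger0_norm ?subr_ge0// ler_wpM2r ?subr_ge0//.
  have c'0 := pos _ tc'.
  set u := y / Num.sqrt c'; have [_ _ h] := hC u.
  have cc : 0 < 2 * c' ^+ 2 by rewrite mulr_gt0 ?exprn_gt0.
  rewrite normrM normfV [X in _ / X]gtr0_norm//.
  rewrite 2!normrM [`|phi u|]ger0_norm ?phi_ge0//.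
  have h1 : `|3 - u ^+ 2| * `|u| * phi u <= 3 * C.
    apply: (@le_trans _ _ (3 * (`|u| * (u ^+ 2 + 1) * phi u))); last by rewrite ler_wpM2l.
    rewrite (_ : 3 * _ = 3 * (u ^+ 2 + 1) * (`|u| * phi u)); last by ring.
    rewrite -mulrA ler_wpM2r ?mulr_ge0 ?phi_ge0//.
    by rewrite (le_trans (ler_normB _ _))// !ger0_norm ?sqr_ge0//; have := sqr_ge0 u; lra.
  rewrite ler_pdivrMr//.
  have ec : e ^+ 2 <= c' ^+ 2 by nra.
  apply: (le_trans h1).
  have ce : C <= C / e ^+ 2 * c' ^+ 2.
    by rewrite mulrAC ler_pdivlMr ?exprn_gt0// ler_wpM2l.
  rewrite (_ : K * _ = 4 * (C / e ^+ 2 * c' ^+ 2)); first lra.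
  by rewrite /K; field; rewrite gt_eqF.
have [c /andP[tc ctv] cE] := mvt _ _ _ (@is_derive_Phi_heat y) tv.
rewrite cE [tau + v - tau]addrAC subrr add0r -mulrBl -mulrBl normrM [`|v|]ger0_norm//.
rewrite expr2 mulrA ler_wpM2r// normrM [`|2^-1|]ger0_norm//.
have := kerlip c tc; have : K * (c - tau) <= K * v by rewrite ler_wpM2l// lerBlDl.
have := normr_ge0 (ker2 y c - ker2 y tau); lra.
Qed.

(** [Phi_taylor3] in the variable y, for increments divided by sqrt tau. *)
Lemma Phi_space_step e : 0 < e -> exists2 C : R, 0 <= C & forall y tau d,
  e <= tau ->
  [/\ `|phi (y / Num.sqrt tau) / Num.sqrt tau| <= C, `|ker2 y tau / 2| <= C &
  `|Phi ((y - d) / Num.sqrt tau) - Phi (y / Num.sqrt tau) +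
    phi (y / Num.sqrt tau) / Num.sqrt tau * d - ker2 y tau / 2 * d ^+ 2|
    <= C * `|d| ^+ 3].
Proof.
move=> e0; have [C C0 hC] := phi_derivs_bound; have [C' C'0 hC'] := Phi_taylor3.
pose i := (Num.sqrt e)^-1.
have s0 : 0 < Num.sqrt e by rewrite sqrtr_gt0.
have i0 : 0 < i by rewrite invr_gt0.
have i0' := ltW i0.
have A0 : 0 <= C / e by rewrite divr_ge0// ltW.
have B0 : 0 <= C' * i ^+ 3 by rewrite mulr_ge0// exprn_ge0.
exists (i + C / e + C' * i ^+ 3); first by rewrite !addr_ge0.
move=> y tau d et; have t0 : 0 < tau by lra.
set s := Num.sqrt tau; have st0 : 0 < s by rewrite sqrtr_gt0.
have es : Num.sqrt e <= s by rewrite ler_wsqrtr.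
have si : s^-1 <= i by rewrite lef_pV2 ?posrE.
have s2 : s ^+ 2 = tau by rewrite sqr_sqrtr ?ltW.
set u := y / s.
split.
- rewrite normrM ger0_norm ?phi_ge0// ger0_norm ?invr_ge0 ?(ltW st0)//.
  have : phi u * s^-1 <= 1 * i by rewrite ler_pM ?phi_ge0 ?phi_le1// invr_ge0 ltW.
  lra.
- rewrite /ker2 -/s -/u 2!normrM normrN normrM [`|phi u|]ger0_norm ?phi_ge0//.
  rewrite [`|2^-1|]ger0_norm// [`|tau^-1|]ger0_norm ?invr_ge0 ?(ltW t0)//.
  have [h _ _] := hC u.
  have : `|u| * phi u * tau^-1 <= C * e^-1.
    by rewrite ler_pM ?mulr_ge0 ?phi_ge0// ?invr_ge0 ?(ltW t0)// lef_pV2 ?posrE.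
  have : 0 <= `|u| * phi u * tau^-1.
    by rewrite !mulr_ge0 ?phi_ge0// invr_ge0 ltW.
  lra.
have := hC' u (- d / s).
have -> : u + - d / s = (y - d) / s by rewrite /u; field; rewrite gt_eqF.
have -> : Phi ((y - d) / s) - Phi u - phi u * (- d / s) +
    u * phi u * (- d / s) ^+ 2 / 2 =
  Phi ((y - d) / s) - Phi u + phi u / s * d - ker2 y tau / 2 * d ^+ 2.
  by rewrite /ker2 -/s -/u -s2; field; rewrite gt_eqF.
move=> /le_trans; apply.
rewrite normrM normrN exprMn mulrCA mulrC ler_wpM2r ?exprn_ge0//.
have : `|s^-1| ^+ 3 <= i ^+ 3.
  by rewrite lerXn2r ?nnegrE// ger0_norm// invr_ge0 ltW.
by move=> /(ler_wpM2l C'0); lra.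
Qed.

(** Lindeberg replacement without a Gaussian partner: the second-order term of
    the space expansion is [ker2] / 2 times E D^2, that of the time expansion is
    [ker2] / 2 times v, and they cancel up to E D^2 - v. *)
Lemma Phi_step e : 0 < e -> exists2 C : R, 0 <= C &
  forall (disp : measure_display) (T : measurableType disp) (P : probability T R)
    (D : T -> R) y tau v,
  e <= tau -> 0 <= v -> mom P D ->
  `|Ex P (fun x => Phi ((y - D x) / Num.sqrt tau)) - Phi (y / Num.sqrt (tau + v))|
  <= C * (`|Ex P D| + `|Ex P (fun x => D x ^+ 2) - v| +
          Ex P (fun x => `|D x| ^+ 3) + v ^+ 2).
Proof.
move=> e0; have [C1 C10 h1] := Phi_heat_step e0.
have [C2 C20 h2] := Phi_space_step e0.
exists (C1 + C2); first by rewrite addr_ge0.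
move=> disp T P D y tau v et v0 Dm.
have {}h1 := h1 y tau v et v0.
pose A := phi (y / Num.sqrt tau) / Num.sqrt tau; pose B := ker2 y tau / 2.
have [hA hB _] := h2 y tau 0 et.
have fm : mom P (fun x => Phi ((y - D x) / Num.sqrt tau)).
  apply: (@mom_bnd _ _ _ _ _ 1).
    apply: measurableT_comp; first exact: measurable_Phi.
    apply: measurable_funM => //; apply: measurable_funB => //; exact: mom_meas Dm.
  by move=> x; rewrite ger0_norm ?Phi_ge0// Phi_le1.
pose rem x := Phi ((y - D x) / Num.sqrt tau) - Phi (y / Num.sqrt tau) + A * D x - B * D x ^+ 2.
have m1 := momZ A Dm; have D2 := momX 2 Dm; have m2 := momZ B D2.
have m0 := mom_cst P (Phi (y / Num.sqrt tau)).
have rm : mom P rem by apply: momB => //; apply: momD => //; exact: momB.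
have E : Ex P (fun x => Phi ((y - D x) / Num.sqrt tau)) = Ex P rem +
    Phi (y / Num.sqrt tau) - A * Ex P D + B * Ex P (fun x => D x ^+ 2).
  rewrite /rem ExB//; last by apply: momD => //; exact: momB.
  rewrite ExD//; last exact: momB.
  by rewrite ExB// !ExZ// Ex_cst; ring.
have nm : mom P (fun x => C2 * `|D x| ^+ 3) by apply/momZ/momX/mom_norm.
have hR : `|Ex P rem| <= C2 * Ex P (fun x => `|D x| ^+ 3).
  rewrite -ExZ; last exact/momX/mom_norm.
  apply: (le_trans (Ex_norm rm)); apply: le_Ex => //; first exact: mom_norm.
  by move=> x; have [_ _] := h2 y tau (D x) et.
rewrite E; move: h1 hA hB hR; rewrite -/A -/B.
set r := Ex P rem; set F1 := Phi _; set F0 := Phi _.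
set M1 := Ex P D; set M3 := Ex P _; set M2 := Ex P _ => h1 hA hB hR.
have -> : r + F0 - A * M1 + B * M2 - F1 =
  r - A * M1 + B * (M2 - v) - (F1 - F0 - B * v) by ring.
have M30 : 0 <= M3 by apply: Ex_ge0 => x; rewrite exprn_ge0.
have t1 : `|A * M1| <= C2 * `|M1| by rewrite normrM ler_wpM2r.
have t2 : `|B * (M2 - v)| <= C2 * `|M2 - v| by rewrite normrM ler_wpM2r.
apply: (@le_trans _ _ (`|r| + `|A * M1| + `|B * (M2 - v)| + `|F1 - F0 - B * v|)).
  rewrite (le_trans (ler_normB _ _))// lerD2r (le_trans (ler_normD _ _))// lerD2r.
  exact: ler_normB.
have := mulr_ge0 C10 (normr_ge0 M1); have := mulr_ge0 C10 (normr_ge0 (M2 - v)).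
have := mulr_ge0 C10 M30; have := mulr_ge0 C20 (sqr_ge0 v).
lra.
Qed.

End HeatKernel.

(** * The centred statistic as a sum of increments *)

Ltac nonneg := do ! first [done | exact: sqr_ge0 | exact: normr_ge0
  | apply: mulr_ge0 | apply: exprn_ge0 | apply: addr_ge0 | apply: divr_ge0
  | by apply: ltW].

(** Counting powers of r = n^(-1/2): the scaling sc is of order r^4, the bounds
    on D1, D2, S1, S2 and V1 are of order r^-1, r^-2, r^-6, r^-12 and r^-5, and
    each product of the sum is of order r^3 or smaller.  D1 and D2 stand for the
    first two absolute moments of the drift, S1 and S2 for those of |S|^2, and
    V1 for the first absolute moment of the deviation of |S|^2. *)
Lemma step_budget (R : realType) (kappa rho sc v D1 D2 S1 S2 V1 : R)
    (r := rho^-1) :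
  1000 <= kappa -> 1 <= rho -> 0 <= sc -> sc <= kappa * r ^+ 4 ->
  0 <= v -> v <= 2 * r ^+ 2 ->
  0 <= D1 -> D1 <= 5 * kappa * rho ->
  0 <= D2 -> D2 <= 8 * kappa ^+ 2 * rho ^+ 2 ->
  0 <= S1 -> S1 <= 14 * kappa ^+ 4 * rho ^+ 6 ->
  0 <= S2 -> S2 <= kappa ^+ 8 * rho ^+ 12 ->
  0 <= V1 -> V1 <= kappa ^+ 4 * rho ^+ 5 ->
  sc * D1 + sc ^+ 2 * (10 * kappa * r) * S1 + sc ^+ 2 * 2 * V1 +
  sc ^+ 2 * (1 + r) * D2 + sc ^+ 4 * (4 * rho * kappa ^+ 4) * S2 +
  (sc ^+ 4 * (4 * rho * (rho ^+ 2 * kappa) ^+ 4) + v ^+ 2) <=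
  10 * kappa ^+ 16 * r ^+ 3.
Proof.
move=> K rho_ge1 s0 sl v0 vl D10 D1l D20 D2l S10 S1l S20 S2l V10 V1l.
have k0 : 0 < kappa by lra.
have rho0 : 0 < rho by lra.
have rn0 : rho != 0 by rewrite gt_eqF.
have r0 : 0 < r by rewrite invr_gt0.
have r1 : r <= 1 by rewrite invf_le1.
have r30 : 0 <= r ^+ 3 by rewrite exprn_ge0// ltW.
have sj j : sc ^+ j <= (kappa * r ^+ 4) ^+ j.
  by rewrite lerXn2r ?nnegrE; nonneg.
have s2 := sj 2%N; have s4 := sj 4%N.
have s20 : 0 <= sc ^+ 2 by exact: sqr_ge0.
have s40 : 0 <= sc ^+ 4 by rewrite exprn_ge0.
have key (a b x y c : R) : 0 <= a -> 0 <= x -> 0 <= y -> a <= b -> x <= c ->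
    a * y * x <= b * y * c.
  by move=> a0 x0 y0 ab xc; rewrite ler_pM ?mulr_ge0// ler_wpM2r.
have hk (t : R) j : 0 <= t -> t <= 1000 -> (j <= 15)%N ->
    t * kappa ^+ j * r ^+ 3 <= kappa ^+ 16 * r ^+ 3.
  move=> t0 t1 j15; apply: ler_wpM2r => //.
  apply: (@le_trans _ _ (kappa * kappa ^+ j)).
    by apply: ler_wpM2r; [nonneg|exact: le_trans K].
  by rewrite -exprS ler_weXn2l// (le_trans _ K)// ler1n.
have T1 : sc * D1 <= kappa ^+ 16 * r ^+ 3.
  apply: le_trans (hk 5 2%N _ _ _) => //; last by rewrite ler_nat.
  apply: (@le_trans _ _ ((kappa * r ^+ 4) * (5 * kappa * rho))); first exact: ler_pM.
  by rewrite le_eqVlt; apply/orP; left; apply/eqP; rewrite /r; field.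
have T2 : sc ^+ 2 * (10 * kappa * r) * S1 <= kappa ^+ 16 * r ^+ 3.
  apply: le_trans (hk 140 7%N _ _ _) => //; last by rewrite ler_nat.
  apply: (le_trans (key _ _ _ _ _ s20 S10 _ s2 S1l)); first by nonneg.
  by rewrite le_eqVlt; apply/orP; left; apply/eqP; rewrite /r; field.
have T3 : sc ^+ 2 * 2 * V1 <= kappa ^+ 16 * r ^+ 3.
  apply: le_trans (hk 2 6%N _ _ _) => //; last by rewrite ler_nat.
  apply: (le_trans (key _ _ _ _ _ s20 V10 _ s2 V1l)) => //.
  by rewrite le_eqVlt; apply/orP; left; apply/eqP; rewrite /r; field.
have T4 : sc ^+ 2 * (1 + r) * D2 <= kappa ^+ 16 * r ^+ 3.
  apply: le_trans (hk 16 4%N _ _ _) => //; last by rewrite ler_nat.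
  apply: (le_trans (key _ _ _ _ _ s20 D20 _ s2 D2l)); first by nonneg.
  have -> : (kappa * r ^+ 4) ^+ 2 * (1 + r) * (8 * kappa ^+ 2 * rho ^+ 2) =
    8 * kappa ^+ 4 * r ^+ 3 * (r ^+ 3 * (1 + r)) by rewrite /r; field.
  have -> : 16 * kappa ^+ 4 * r ^+ 3 = 8 * kappa ^+ 4 * r ^+ 3 * (1 * (1 + 1)) by ring.
  apply: ler_wpM2l; first by nonneg.
  by apply: ler_pM; [nonneg|nonneg|rewrite exprn_ile1// ltW|rewrite lerD2l].
have T5 : sc ^+ 4 * (4 * rho * kappa ^+ 4) * S2 <= 4 * (kappa ^+ 16 * r ^+ 3).
  apply: (le_trans (key _ _ _ _ _ s40 S20 _ s4 S2l)); first by nonneg.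
  by rewrite le_eqVlt; apply/orP; left; apply/eqP; rewrite /r; field.
have T6 : sc ^+ 4 * (4 * rho * (rho ^+ 2 * kappa) ^+ 4) <= kappa ^+ 16 * r ^+ 3.
  apply: le_trans (hk 4 8%N _ _ _) => //; last by rewrite ler_nat.
  apply: (@le_trans _ _ ((kappa * r ^+ 4) ^+ 4 * (4 * rho * (rho ^+ 2 * kappa) ^+ 4))).
    by apply: ler_wpM2r => //; nonneg.
  have -> : (kappa * r ^+ 4) ^+ 4 * (4 * rho * (rho ^+ 2 * kappa) ^+ 4) =
    4 * kappa ^+ 8 * r ^+ 3 * r ^+ 4 by rewrite /r; field.
  by apply: ler_piMr; [nonneg|rewrite exprn_ile1// ltW].
have T7 : v ^+ 2 <= kappa ^+ 16 * r ^+ 3.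
  apply: le_trans (hk 4 0%N _ _ _) => //; last by rewrite ler_nat.
  apply: (le_trans (ler_sq v0 vl)).
  rewrite (_ : (2 * r ^+ 2) ^+ 2 = 4 * kappa ^+ 0 * r ^+ 3 * r); last by ring.
  by apply: ler_piMr => //; nonneg.
rewrite -[leRHS]mulrA; move: T1 T2 T3 T4 T5 T6 T7.
move: (kappa ^+ 16 * r ^+ 3) => B.
move: (sc * D1) (sc ^+ 2 * (10 * kappa * r) * S1) (sc ^+ 2 * 2 * V1).
move: (sc ^+ 2 * (1 + r) * D2) (sc ^+ 4 * (4 * rho * kappa ^+ 4) * S2).
move: (sc ^+ 4 * (4 * rho * (rho ^+ 2 * kappa) ^+ 4)) (v ^+ 2) => a b c d f g h.
lra.
Qed.

Section Martingale.
Context (R : realType) (n p : nat) (kappa : R) (L : 'M[R]_p).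
Notation V := (p.-tuple R).
Notation N := (distribution (iid_law (gauss R) p) (lin_map L)).
Notation G := (L *m L^T - 1%:M).
Notation rho := (rho R n).
Notation r := rho^-1.
Hypotheses (n_gt0 : (0 < n)%N) (p_gt0 : (0 < p)%N) (k1000 : 1000 <= kappa).
Hypotheses (pn : p%:R <= kappa * n%:R) (np : n%:R <= kappa * p%:R).
Hypotheses (Gk : nsq G <= kappa).
Hypotheses (Gop : forall B, n%:R * nsq (G *m B) <= kappa * nsq B).

Definition stat_scale : R := (n%:R * p%:R)^-1.

(** The increment brought by the observation x after those in s, centred by its
    overall mean rather than by its conditional mean; the difference is the
    drift. *)
Definition incr (s : seq V) (x : V) : R :=
  stat_scale * (ip (ysum s) (ymat x) - (size s)%:R * nsq G).

Fixpoint mart (s : seq V) : R :=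
  if s is x :: s' then mart s' + incr s' x else 0.

Lemma mom_incr_cons s : mom N (incr s).
Proof.
by apply: momZ; apply: momB; [exact: mom_ip_ymat|exact: mom_cst].
Qed.

Lemma mom_mart m : mom (iid_law N m) (fun t => mart t).
Proof.
elim: m => [|m IH].
  rewrite (_ : (fun t => _) = fun=> 0); first exact: mom_cst.
  by apply/funext => t; rewrite tuple0.
rewrite (_ : (fun t => _) = fun t : m.+1.-tuple V => mart (behead t) +
  stat_scale * (ip (ysum (behead t)) (ymat (thead t)) - m%:R * nsq G)); last first.
  apply/funext => t; rewrite {1}(tuple_eta t) /= /incr /=.
  by rewrite size_behead size_tuple.
apply: momD; first exact: (mom_behead IH).
apply: momZ; apply: momB; last exact: mom_cst.
under eq_fun do rewrite ipE.
apply: mom_sum => i; apply: mom_sum => j; apply: momM.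
  exact: (mom_behead (mom_ysum L m i j)).
exact: (mom_head m (mom_ymat L i j)).
Qed.

Lemma scale_gt0 : 0 < stat_scale.
Proof. by rewrite invr_gt0 mulr_gt0// ltr0n. Qed.

Let r_gt0 : 0 < r.
Proof. by rewrite invr_gt0 sqrtr_gt0 ltr0n. Qed.

Let r_le1 : r <= 1.
Proof. by rewrite invf_le1 ?rho_ge1// -invr_gt0 r_gt0. Qed.

Lemma natr_rho : n%:R = rho ^+ 2.
Proof. by rewrite sqr_rho. Qed.

Lemma scale_le : stat_scale <= kappa * r ^+ 4.
Proof.
have h : 0 < p%:R :> R by rewrite ltr0n.
have h' : 0 < n%:R :> R by rewrite ltr0n.
rewrite (_ : r ^+ 4 = n%:R ^- 2); last first.
  by rewrite natr_rho; field; rewrite gt_eqF// -invr_gt0 r_gt0.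
rewrite /stat_scale invfM expr2 invfM mulrCA ler_wpM2l ?invr_ge0 ?(ltW h')//.
by rewrite ler_pdivlMr// mulrC ler_pdivrMr// mulrC.
Qed.

(** The leading part of the conditional variance of the increment that follows m
    observations. *)
Definition vstep (m : nat) : R := 2 * m%:R / n%:R ^+ 2.

Lemma vstepE m : vstep m = stat_scale ^+ 2 * (2 * m%:R * p%:R ^+ 2).
Proof.
by rewrite /vstep /stat_scale; field; rewrite !pnatr_eq0 -!lt0n n_gt0 p_gt0.
Qed.

Lemma Ex_incr (s : seq V) : Ex N (incr s) = stat_scale * drift L s.
Proof.
have qm := mom_ip_ymat L (ysum s).
rewrite /incr ExZ; last by apply: momB => //; exact: mom_cst.
rewrite ExB//; last exact: mom_cst.
by rewrite Ex_cst Ex_ip_ymat ?trmx_ysum// /drift (ipC G).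
Qed.

Lemma Ex_incr2 (s : seq V) : Ex N (fun x => incr s x ^+ 2) =
  stat_scale ^+ 2 * (2 * Qf L (ysum s) + drift L s ^+ 2).
Proof.
have qm := mom_ip_ymat L (ysum s).
have Ss := trmx_ysum s.
pose u x := ip (ysum s) (ymat x) - ip (ysum s) G.
have um : mom N u by apply: momB => //; exact: mom_cst.
have Eu : Ex N u = 0.
  by rewrite ExB//; [rewrite Ex_cst Ex_ip_ymat// subrr|exact: mom_cst].
transitivity (Ex N (fun x => stat_scale ^+ 2 *
    (u x ^+ 2 + 2 * drift L s * u x + drift L s ^+ 2))).
  by apply: Ex_eq => x; rewrite /incr /u /drift (ipC G); ring.
have m1 := momX 2 um; have m2 := momZ (2 * drift L s) um.
rewrite ExZ; last by apply: momD; [exact: momD|exact: mom_cst].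
rewrite ExD; [|exact: momD|exact: mom_cst].
by rewrite ExD// ExZ// Eu Ex_cst mulr0 addr0 Ex_ip_ymat_var.
Qed.

Lemma Ex_incr4_le (s : seq V) : (size s <= n)%N -> Ex N (fun x => incr s x ^+ 4) <=
  stat_scale ^+ 4 * (8 * (kappa ^+ 4 * nsq (ysum s) ^+ 2 + (n%:R * kappa) ^+ 4)).
Proof.
move=> sn; have qm := mom_ip_ymat L (ysum s).
have Ss := trmx_ysum s; have q4 := momX 4 qm.
pose b := (size s)%:R * nsq G.
have b0 : 0 <= b by rewrite mulr_ge0 ?nsq_ge0.
have bn : b <= n%:R * kappa by rewrite ler_pM ?nsq_ge0// ler_nat.
apply: (@le_trans _ _ (Ex N (fun x => stat_scale ^+ 4 * (8 * (ip (ysum s) (ymat x) ^+ 4 + b ^+ 4))))).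
  apply: le_Ex; first exact/momX/mom_incr_cons.
    by do 2 apply: momZ; apply: momD => //; exact: mom_cst.
  move=> x; rewrite /incr -/b exprMn ler_wpM2l ?exprn_ge0 ?(ltW scale_gt0)//.
  set a := ip _ _.
  have h1 : (a - b) ^+ 2 <= 2 * (a ^+ 2 + b ^+ 2) by have := sqr_ge0 (a + b); nra.
  have h2 := ler_sq (sqr_ge0 _) h1.
  rewrite -exprM in h2; apply: (le_trans h2).
  have := sqr_ge0 (a ^+ 2 - b ^+ 2).
  by rewrite (exprM a 2 2) (exprM b 2 2); nra.
rewrite ExZ; last by apply: momZ; apply: momD => //; exact: mom_cst.
rewrite ExZ; last by apply: momD => //; exact: mom_cst.
rewrite ExD//; last exact: mom_cst.
rewrite Ex_cst ler_wpM2l ?exprn_ge0 ?(ltW scale_gt0)// ler_wpM2l// lerD//.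
  exact: (Ex_ip_ymat4_le n_gt0 k1000 Gk Gop Ss).
by rewrite lerXn2r ?nnegrE// (le_trans b0).
Qed.

(** The right-hand side of [Phi_step] for one increment, bounded in terms of the
    statistics of the past whose moments are controlled: the drift, |S|^2 and
    its deviation. *)
Definition step_err (m : nat) (s : seq V) : R :=
  stat_scale * `|drift L s| +
  stat_scale ^+ 2 * (6 * kappa * r * nsq (ysum s) + 2 * `|dev s| + drift L s ^+ 2) +
  (r * stat_scale ^+ 2 * (4 * kappa * nsq (ysum s) + drift L s ^+ 2) +
   rho * stat_scale ^+ 4 * (4 * (kappa ^+ 4 * nsq (ysum s) ^+ 2 + (n%:R * kappa) ^+ 4))) +
  vstep m ^+ 2.

Lemma step_errP m (s : seq V) : size s = m -> (m <= n)%N ->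
  `|Ex N (incr s)| + `|Ex N (fun x => incr s x ^+ 2) - vstep m| +
   Ex N (fun x => `|incr s x| ^+ 3) + vstep m ^+ 2 <= step_err m s.
Proof.
move=> sm mn; have s0 := scale_gt0; have r0 := r_gt0.
have K : 1 <= kappa by have := k1000; lra.
have rho0 : 0 < rho by rewrite -invr_gt0.
have Ss := trmx_ysum s.
have s20 : 0 <= stat_scale ^+ 2 by exact: sqr_ge0.
have Qd : `|Qf L (ysum s) - nsq (ysum s)| <= 3 * kappa * r * nsq (ysum s).
  rewrite (_ : 3 * kappa * r * _ = r * (3 * kappa * nsq (ysum s))); last by ring.
  by rewrite ler_pdivlMl//; exact: Qf_dev.
have Ql : Qf L (ysum s) <= 4 * kappa * nsq (ysum s).
  exact: (Qf_le n_gt0 k1000 Gop Ss).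
rewrite /step_err lerD2r lerD//; first rewrite lerD//.
- by rewrite Ex_incr normrM gtr0_norm.
- rewrite Ex_incr2 vstepE -mulrBr normrM ger0_norm// ler_wpM2l//.
  have -> : 2 * Qf L (ysum s) + drift L s ^+ 2 - 2 * m%:R * p%:R ^+ 2 =
     2 * (Qf L (ysum s) - nsq (ysum s)) + 2 * dev s + drift L s ^+ 2.
    by rewrite /dev sm; ring.
  rewrite (le_trans (ler_normD _ _))// [`|_ ^+ 2|]ger0_norm ?sqr_ge0// lerD2r.
  rewrite (le_trans (ler_normD _ _))// !normrM ger0_norm//.
  lra.
have im := mom_incr_cons s; have i2 := momX 2 im; have i4 := momX 4 im.
(* The third absolute moment is reduced to even ones by
   d^3 <= (r d^2 + d^4 / r) / 2, balanced for d of order r. *)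
apply: (@le_trans _ _ (Ex N (fun x => (r / 2) * incr s x ^+ 2 + (rho / 2) * incr s x ^+ 4))).
  apply: le_Ex; first exact/momX/mom_norm.
    by apply: momD; exact: momZ.
  move=> x; rewrite -[incr s x ^+ 2]real_normK ?num_real//.
  have -> : incr s x ^+ 4 = `|incr s x| ^+ 4.
    by rewrite -normrX ger0_norm// (exprM _ 2 2) sqr_ge0.
  set d := `|_|; have d0 : 0 <= d by exact: normr_ge0.
  rewrite -subr_ge0.
  have -> : r / 2 * d ^+ 2 + rho / 2 * d ^+ 4 - d ^+ 3 =
    r / 2 * d ^+ 2 * (rho * d - 1) ^+ 2 by field; rewrite gt_eqF.
  by rewrite mulr_ge0 ?sqr_ge0// mulr_ge0 ?sqr_ge0// divr_ge0// ltW.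
rewrite ExD; [|exact: momZ|exact: momZ].
rewrite !ExZ// Ex_incr2; apply: lerD.
  rewrite (_ : r / 2 * _ = r * stat_scale ^+ 2 * (Qf L (ysum s) + drift L s ^+ 2 / 2)); last by field; rewrite gt_eqF.
  rewrite ler_wpM2l//; first by rewrite mulr_ge0// ltW.
  by have := sqr_ge0 (drift L s); lra.
have h4 := Ex_incr4_le (eq_ind_r (fun k => (k <= n)%N) mn sm).
apply: (@le_trans _ _ (rho / 2 * (stat_scale ^+ 4 * (8 * (kappa ^+ 4 * nsq (ysum s) ^+ 2 + (n%:R * kappa) ^+ 4))))).
  by rewrite ler_wpM2l// mulr_ge0// ltW.
by rewrite le_eqVlt; apply/orP; left; apply/eqP; field.
Qed.

Lemma mom_step_err m : mom (iid_law N m) (fun t => step_err m t).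
Proof.
have dm := mom_drift L m; have nm := mom_nsq_ysum L m; have vm := mom_dev L m.
have adm := mom_norm dm; have d2m := momX 2 dm; have n2m := momX 2 nm.
have avm := mom_norm vm.
rewrite /step_err.
by do ! [apply: momD|exact: momZ|apply: momZ|exact: mom_cst|].
Qed.

(** First moments from second ones; c is the expected order of magnitude of f. *)
Lemma Ex_abs_le (disp : measure_display) (T : measurableType disp)
    (P : probability T R) (f : T -> R) (c : R) : mom P f -> 0 < c ->
  Ex P (fun t => `|f t|) <= (c + Ex P (fun t => f t ^+ 2) / c) / 2.
Proof.
move=> fm c0; have f2 := momX 2 fm.
apply: (@le_trans _ _ (Ex P (fun t => c / 2 + (2 * c)^-1 * f t ^+ 2))).
  apply: le_Ex; [exact: mom_norm|by apply: momD; [exact: mom_cst|exact: momZ]|].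
  move=> t; rewrite -[f t ^+ 2]real_normK ?num_real//.
  set d := `|_|; rewrite -subr_ge0.
  have -> : c / 2 + (2 * c)^-1 * d ^+ 2 - d = (2 * c)^-1 * (d - c) ^+ 2.
    by field; rewrite gt_eqF.
  by rewrite mulr_ge0 ?sqr_ge0// invr_ge0 mulr_ge0// ltW.
rewrite ExD; [|exact: mom_cst|exact: momZ].
rewrite Ex_cst ExZ// le_eqVlt; apply/orP; left; apply/eqP; field.
by rewrite gt_eqF.
Qed.

Lemma Ex_step_err_le m : (m <= n)%N ->
  Ex (iid_law N m) (fun t => step_err m t) <= 10 * kappa ^+ 16 * r ^+ 3.
Proof.
move=> mn.
have dm := mom_drift L m; have nm := mom_nsq_ysum L m; have vm := mom_dev L m.
have adm := mom_norm dm; have d2m := momX 2 dm; have n2m := momX 2 nm.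
have avm := mom_norm vm.
have s0 := scale_gt0; have r0 := r_gt0; have r1 := r_le1; have sl := scale_le.
have K := k1000; have rho0 : 0 < rho by rewrite -invr_gt0.
have rn0 : rho != 0 by rewrite gt_eqF.
have k0 : 0 < kappa by lra.
have kn0 : kappa != 0 by rewrite gt_eqF.
pose A1 := stat_scale ^+ 2 * (10 * kappa * r); pose A2 := stat_scale ^+ 2 * 2.
pose A3 := stat_scale ^+ 2 * (1 + r); pose A4 := stat_scale ^+ 4 * (4 * rho * kappa ^+ 4).
pose A5 := stat_scale ^+ 4 * (4 * rho * (n%:R * kappa) ^+ 4); pose A6 := vstep m ^+ 2.
pose F (t : m.-tuple V) := stat_scale * `|drift L t| + A1 * nsq (ysum t) +
  A2 * `|dev t| + A3 * drift L t ^+ 2 + A4 * nsq (ysum t) ^+ 2 + (A5 + A6).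
have -> : Ex (iid_law N m) (fun t => step_err m t) = Ex (iid_law N m) F.
  by apply: Ex_eq => t; rewrite /F /step_err /A1 /A2 /A3 /A4 /A5 /A6; ring.
have -> : Ex (iid_law N m) F =
  stat_scale * Ex (iid_law N m) (fun t => `|drift L t|) +
  A1 * Ex (iid_law N m) (fun t => nsq (ysum t)) +
  A2 * Ex (iid_law N m) (fun t => `|dev t|) +
  A3 * Ex (iid_law N m) (fun t => drift L t ^+ 2) +
  A4 * Ex (iid_law N m) (fun t => nsq (ysum t) ^+ 2) + (A5 + A6).
  rewrite !ExD ?ExZ ?Ex_cst//; do ! [apply: momD|exact: mom_cst|exact: momZ|] => //.
have d2 := Ex_drift2_le n_gt0 k1000 Gk Gop mn; rewrite [in leRHS]natr_rho in d2.
have e2 := Ex_nsq_ysum_le n_gt0 p_gt0 k1000 pn Gk Gop mn; rewrite [in leRHS]natr_rho in e2.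
have e5 := Ex_nsq_ysum2_le n_gt0 p_gt0 k1000 pn Gk Gop mn; rewrite [in leRHS]natr_rho in e5.
have v2 := Ex_dev2_le n_gt0 p_gt0 k1000 pn Gk Gop mn.
have mn' : m%:R <= rho ^+ 2 :> R by rewrite -natr_rho ler_nat.
have m0 : 0 <= m%:R :> R by [].
have d1 : Ex (iid_law N m) (fun t => `|drift L t|) <= 5 * kappa * rho.
  have c0 : 0 < kappa * rho by rewrite mulr_gt0.
  apply: (le_trans (Ex_abs_le dm c0)).
  have h : Ex (iid_law N m) (fun t => drift L t ^+ 2) / (kappa * rho) <= 8 * (kappa * rho).
    by rewrite ler_pdivrMr// (le_trans d2)// le_eqVlt; apply/orP; left; apply/eqP; ring.
  lra.
have {}v2 : Ex (iid_law N m) (fun t => dev t ^+ 2) <= 6 * kappa ^+ 7 * rho ^+ 10.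
  apply: (le_trans v2); rewrite [leRHS](_ : _ = (rho ^+ 2) ^+ 2 * (6 * kappa ^+ 7 * n%:R ^+ 3)).
    rewrite ler_wpM2r//; last exact: ler_sq.
    by nonneg.
  by rewrite natr_rho; ring.
have v1 : Ex (iid_law N m) (fun t => `|dev t|) <= kappa ^+ 4 * rho ^+ 5.
  have c0 : 0 < kappa ^+ 4 * rho ^+ 5 by rewrite mulr_gt0 ?exprn_gt0.
  apply: (le_trans (Ex_abs_le vm c0)).
  have h : Ex (iid_law N m) (fun t => dev t ^+ 2) / (kappa ^+ 4 * rho ^+ 5) <= kappa ^+ 4 * rho ^+ 5.
    rewrite ler_pdivrMr// (le_trans v2)//.
    have : 0 <= kappa ^+ 7 * rho ^+ 10 by nonneg.
    move=> /(ler_wpM2r); move=> /(_ _ _ K).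
    rewrite (_ : kappa * (_ * _) = kappa ^+ 4 * rho ^+ 5 * (kappa ^+ 4 * rho ^+ 5)); last by ring.
    have : 0 <= kappa ^+ 7 * rho ^+ 10 by nonneg.
    lra.
  lra.
have nn (f : m.-tuple V -> R) : (forall t, 0 <= f t) -> 0 <= Ex (iid_law N m) f by exact: Ex_ge0.
have vl : vstep m <= 2 * r ^+ 2.
  rewrite /vstep natr_rho ler_pdivrMr ?exprn_gt0//.
  rewrite (_ : 2 * r ^+ 2 * _ = 2 * rho ^+ 2); last by field.
  by rewrite ler_wpM2l.
have v0 : 0 <= vstep m by rewrite /vstep divr_ge0 ?sqr_ge0// mulr_ge0.
rewrite -!exprM in d2 e2 e5.
rewrite /A1 /A2 /A3 /A4 /A5 /A6 [in (n%:R * kappa)]natr_rho.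
apply: step_budget => //; try by apply: nn => t; nonneg.
- exact: rho_ge1.
- exact: ltW.
- by apply: nn => t; exact: nsq_ge0.
Qed.

End Martingale.

(** * Normal approximation by telescoping *)

Section NormalApproximation.
Context (R : realType) (n p : nat) (kappa : R) (L : 'M[R]_p).
Notation V := (p.-tuple R).
Notation N := (distribution (iid_law (gauss R) p) (lin_map L)).
Notation G := (L *m L^T - 1%:M).
Notation rho := (rho R n).
Notation r := rho^-1.
Hypotheses (n_gt0 : (0 < n)%N) (p_gt0 : (0 < p)%N) (k1000 : 1000 <= kappa).
Hypotheses (pn : p%:R <= kappa * n%:R) (np : n%:R <= kappa * p%:R).
Hypotheses (Gk : nsq G <= kappa).
Hypotheses (Gop : forall B, n%:R * nsq (G *m B) <= kappa * nsq B).
Notation mart := (mart n L).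

Lemma mom_Phi_mart m (z s : R) :
  mom (iid_law N m) (fun t => Phi ((z - mart t) / s)).
Proof.
apply: (@mom_bnd _ _ _ _ _ 1).
  apply: measurableT_comp; first exact: measurable_Phi.
  apply: measurable_funM => //; apply: measurable_funB => //.
  exact: mom_meas (mom_mart n L m).
by move=> x; rewrite ger0_norm ?Phi_ge0// Phi_le1.
Qed.

(** Integrating out the newest observation: it is replaced by an increase of the
    smoothing parameter tau by [vstep].  The constant C is the one of
    [Phi_step]. *)
Lemma mart_step (e C : R) :
  (forall (disp : measure_display) (T : measurableType disp) (P : probability T R)
    (D : T -> R) (y tau v : R),
    e <= tau -> 0 <= v -> mom P D ->
    `|Ex P (fun x => Phi ((y - D x) / Num.sqrt tau)) - Phi (y / Num.sqrt (tau + v))|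
    <= C * (`|Ex P D| + `|Ex P (fun x => D x ^+ 2) - v| +
            Ex P (fun x => `|D x| ^+ 3) + v ^+ 2)) -> 0 <= C ->
  forall m (z tau : R), (m < n)%N -> e <= tau ->
  `|Ex (iid_law N m.+1) (fun t => Phi ((z - mart t) / Num.sqrt tau)) -
    Ex (iid_law N m) (fun t => Phi ((z - mart t) / Num.sqrt (tau + vstep R n m)))|
  <= C * (10 * kappa ^+ 16 * r ^+ 3).
Proof.
move=> hC C0 m z tau mn et.
have v0 : 0 <= vstep R n m by rewrite /vstep divr_ge0 ?mulr_ge0 ?sqr_ge0.
set s1 := Num.sqrt tau; set s2 := Num.sqrt _.
have m1 := mom_Phi_mart m.+1 z s1; have m2 := mom_Phi_mart m z s2.
have em := momZ C (mom_step_err n kappa L m).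
have sec t : mom N (fun x => Phi ((z - mart (x :: tval t)) / s1)) :> Prop.
  apply: (@mom_bnd _ _ _ _ _ 1).
    apply: measurableT_comp; first exact: measurable_Phi.
    apply: measurable_funM => //; apply: measurable_funB => //=.
    apply: measurable_funD => //; exact: mom_meas (mom_incr_cons n L t).
  by move=> x; rewrite ger0_norm ?Phi_ge0// Phi_le1.
have key (t : m.-tuple V) : `|Ex N (fun x => Phi ((z - mart (x :: tval t)) / s1)) -
    Phi ((z - mart t) / s2)| <= C * step_err n kappa L m t.
  have h := hC _ _ N (incr n L t) (z - mart t) tau _ et v0 (mom_incr_cons n L t).
  have E x : z - mart (x :: tval t) = z - mart t - incr n L t x by rewrite /=; ring.
  under eq_fun do rewrite E.
  apply: (le_trans h); rewrite ler_wpM2l//.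
  by apply: (step_errP n_gt0 p_gt0 k1000 Gk Gop); rewrite ?size_tuple// ltnW.
have eE : Ex (iid_law N m) (fun t => C * step_err n kappa L m t) <= C * (10 * kappa ^+ 16 * r ^+ 3).
  rewrite ExZ ?ler_wpM2l//; last exact: mom_step_err.
  exact: (Ex_step_err_le n_gt0 p_gt0 k1000 pn np Gk Gop (ltnW mn)).
have lower : Ex (iid_law N m.+1) (fun t => - Phi ((z - mart t) / s1)) <=
    Ex (iid_law N m) (fun t => C * step_err n kappa L m t - Phi ((z - mart t) / s2)).
  apply: le_Ex_iidS; [exact: momN|exact: momB|by move=> t; exact/momN/sec|].
  move=> t; rewrite ExN; last exact: sec.
  have := key t; set A := Ex N _ => kt; change (- A <= C * step_err n kappa L m t - Phi ((z - mart t) / s2)).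
  by move: kt; rewrite ler_norml => /andP[+ _]; move: A => A; lra.
have upper : Ex (iid_law N m.+1) (fun t => Phi ((z - mart t) / s1)) <=
    Ex (iid_law N m) (fun t => C * step_err n kappa L m t + Phi ((z - mart t) / s2)).
  apply: le_Ex_iidS; [by []|exact: momD|exact: sec|].
  move=> t; have := key t; set A := Ex N _ => kt.
  change (A <= C * step_err n kappa L m t + Phi ((z - mart t) / s2)).
  by move: kt; rewrite ler_norml => /andP[_]; move: A => A; lra.
rewrite ExN// ExB// in lower; rewrite ExD// in upper.
move: lower upper eE; rewrite ler_norml.
move: (Ex _ _) (Ex _ _) (Ex _ _) (C * _) => a b c K.
by lra.
Qed.

End NormalApproximation.

(** The smoothing parameter collects the variances 2 m / n^2 of all the
    increments, from e up to e + n (n - 1) / n^2. *)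
Lemma mart_clt (R : realType) (kappa e : R) : 1000 <= kappa -> 0 < e ->
  exists2 C : R, 0 <= C & forall (n p : nat) (L : 'M[R]_p) (G := L *m L^T - 1%:M),
  (0 < n)%N -> (0 < p)%N -> p%:R <= kappa * n%:R -> n%:R <= kappa * p%:R ->
  nsq G <= kappa -> (forall B, n%:R * nsq (G *m B) <= kappa * nsq B) ->
  forall z : R,
  `|Ex (iid_law (distribution (iid_law (gauss R) p) (lin_map L)) n)
      (fun t => Phi ((z - mart n L t) / Num.sqrt e)) -
    Phi (z / Num.sqrt (e + (1 - n%:R^-1)))| <= C / Num.sqrt n%:R.
Proof.
move=> k1000 e0; have [C C0 hC] := Phi_step e0.
pose K := C * (10 * kappa ^+ 16).
have K0 : 0 <= K by rewrite mulr_ge0// mulr_ge0// exprn_ge0//; lra.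
exists K => // n p L G n0 p0 pn np Gk Gop z.
set N := distribution _ _; set r := (Num.sqrt n%:R)^-1.
have N0 : 0 < n%:R :> R by rewrite ltr0n.
have key m tau : (m <= n)%N -> e <= tau ->
    `|Ex (iid_law N m) (fun t => Phi ((z - mart n L t) / Num.sqrt tau)) -
      Phi (z / Num.sqrt (tau + m%:R * (m%:R - 1) / n%:R ^+ 2))| <= m%:R * (K * r ^+ 3).
  elim: m tau => [|m IH] tau mn et.
    rewrite !mul0r addr0 (_ : Ex _ _ = Phi (z / Num.sqrt tau)) ?subrr ?normr0//.
    rewrite -[RHS](Ex_cst (iid_law N 0)); apply: Ex_eq => t.
    by rewrite tuple0 /= subr0.
  have st := mart_step n0 p0 k1000 pn np Gk Gop hC C0 z mn et.
  have v0 : 0 <= vstep R n m by rewrite /vstep divr_ge0 ?mulr_ge0 ?sqr_ge0.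
  have et' : e <= tau + vstep R n m by rewrite (le_trans et)// lerDl.
  have := IH _ (ltnW mn) et'.
  rewrite (_ : tau + vstep R n m + _ = tau + m.+1%:R * (m.+1%:R - 1) / n%:R ^+ 2); last first.
    by rewrite /vstep -natr1; field; rewrite gt_eqF.
  rewrite (_ : m.+1%:R * (K * r ^+ 3) = m%:R * (K * r ^+ 3) + K * r ^+ 3); last first.
    by rewrite -natr1; ring.
  move=> ih.
  apply: (le_trans (ler_distD (Ex (iid_law N m) (fun t =>
     Phi ((z - mart n L t) / Num.sqrt (tau + vstep R n m)))) _ _)).
  by rewrite [leRHS]addrC lerD// /K -mulrA.
have := key n e (leqnn n) (lexx e).
have -> : n%:R * (n%:R - 1) / n%:R ^+ 2 = 1 - n%:R^-1 :> R by field; rewrite gt_eqF.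
move=> /le_trans; apply.
have rr : r ^+ 2 = n%:R^-1 by rewrite /r exprVn sqr_sqrtr.
rewrite (_ : n%:R * (K * r ^+ 3) = K * r * (n%:R * r ^+ 2)); last by ring.
by rewrite rr mulfV ?gt_eqF// mulr1.
Qed.

(** * The covariance of a perturbed identity precision *)

Section Cholesky.
Context (R : realType).

Definition posdef p (S : 'M[R]_p) :=
  S^T = S /\ forall v : 'rV[R]_p, v != 0 -> 0 < (v *m S *m v^T) ord0 ord0.

(** Induction on the size, by completing the square in the first variable: the
    Schur complement of a positive definite matrix is positive definite. *)
Lemma cholesky p (S : 'M[R]_p) : posdef S -> exists L : 'M[R]_p, L *m L^T = S.
Proof.
elim: p S => [|p IH] S [Ss Sp].
  by exists 0; rewrite [LHS]flatmx0 [RHS]flatmx0.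
move: S Ss Sp; rewrite -[p.+1]/(1 + p)%N => S Ss Sp.
pose a := ulsubmx S ord0 ord0.
have aE : ulsubmx S = a%:M.
  by apply/matrixP => i j; rewrite !ord1 [RHS]mxE eqxx mulr1n.
pose b := dlsubmx S; pose C := drsubmx S.
have SE : S = block_mx a%:M b^T b C.
  rewrite -[LHS]submxK aE -/b -/C; congr block_mx.
  by rewrite /b trmx_dlsub Ss.
have Cs : C^T = C by rewrite /C trmx_drsub Ss.
have a0 : 0 < a.
  have := Sp (row_mx 1%:M 0); rewrite SE mul_row_block tr_row_mx mul_row_col.
  rewrite trmx1 trmx0 !mul1mx !mul0mx !mulmx0 mulmx1 !addr0 mxE eqxx mulr1n; apply.
  apply/eqP => /matrixP/(_ ord0 (lshift p ord0)).
  by rewrite row_mxEl !mxE eqxx => /eqP; rewrite oner_eq0.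
have an0 : a != 0 by rewrite gt_eqF.
have [|L' L'E] := IH (C - a^-1 *: (b *m b^T)).
  split; first by rewrite linearB linearZ /= trmx_mul trmxK Cs.
  move=> v v0; have := Sp (row_mx (- (a^-1 *: (v *m b))) v).
  have -> : row_mx (- (a^-1 *: (v *m b))) v *m S *m
      (row_mx (- (a^-1 *: (v *m b))) v)^T = v *m (C - a^-1 *: (b *m b^T)) *m v^T.
    rewrite SE mul_row_block tr_row_mx mul_row_col mul_mx_scalar.
    rewrite scalerN scalerA mulfV// scale1r addNr mul0mx add0r.
    by rewrite mulNmx -scalemxAl mulmxBr -scalemxAr mulmxA addrC.
  apply; apply: contra v0 => /eqP; rewrite -[0 in RHS]row_mx0 => /eq_row_mx[_ ->].
  by rewrite eqxx.
pose s := Num.sqrt a.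
have s2 : s * s = a by rewrite -expr2 sqr_sqrtr ?ltW.
have sn0 : s != 0 by rewrite gt_eqF// sqrtr_gt0.
exists (block_mx s%:M 0 (s^-1 *: b) L').
rewrite tr_block_mx mulmx_block SE trmx0 !mul0mx !mulmx0 !addr0 tr_scalar_mx.
rewrite L'E !mul_scalar_mx !mul_mx_scalar linearZ /= !scalerA mulfV// !scale1r.
rewrite scale_scalar_mx s2 -scalemxAl -scalemxAr scalerA.
congr block_mx.
have -> : s^-1 * s^-1 = a^-1 by rewrite -s2 invfM.
by rewrite addrC subrK.
Qed.

End Cholesky.

Section OperatorNorm.
Context (R : realType) (p : nat).
Implicit Types (x : 'cV[R]_p) (H B : 'M[R]_p).

Definition sq2 x : R := \sum_(i < p) x i 0 ^+ 2.

Lemma sq2_ge0 x : 0 <= sq2 x.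
Proof. by apply: sumr_ge0 => i _; exact: sqr_ge0. Qed.

Lemma l2norm_sq x : l2norm x ^+ 2 = sq2 x.
Proof. by rewrite sqr_sqrtr// sq2_ge0. Qed.

(** The operator norm is a supremum of reals, so the set has to be bounded; the
    row sums of absolute values provide a bound. *)
Lemma opnorm_le H x : l2norm (H *m x) <= opnorm H * l2norm x.
Proof.
have ub : has_ubound [set l2norm (H *m x) | x in [set x : 'cV[R]_p | l2norm x <= 1]].
  exists (Num.sqrt (\sum_(i < p) (\sum_(j < p) `|H i j|) ^+ 2)) => _ [y /= y1 <-].
  rewrite ler_wsqrtr//; apply: ler_sum => i _; rewrite -[leLHS]real_normK ?num_real//.
  rewrite lerXn2r ?nnegrE//; first exact: sumr_ge0.
  rewrite mxE (le_trans (ler_norm_sum _ _ _))//; apply: ler_sum => j _.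
  rewrite normrM ler_piMr//.
  have h : sq2 y <= 1 by rewrite -l2norm_sq exprn_ile1// sqrtr_ge0.
  rewrite -(@ler_pXn2r _ 2) ?nnegrE// expr1n real_normK ?num_real//.
  apply: le_trans h; rewrite /sq2 (bigD1 j)//= lerDl.
  by apply: sumr_ge0 => k _; exact: sqr_ge0.
have l2Z (t : R) (y : 'cV[R]_p) : 0 <= t -> l2norm (t *: y) = t * l2norm y.
  move=> t0; rewrite /l2norm -[t in RHS]ger0_norm// -sqrtr_sqr -sqrtrM ?sqr_ge0//.
  by congr Num.sqrt; rewrite mulr_sumr; apply: eq_bigr => i _; rewrite mxE exprMn.
have n0 y : 0 <= l2norm y by exact: sqrtr_ge0.
have [x0|x0] := eqVneq (l2norm x) 0.
  have xz : x = 0.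
    apply/matrixP => i j; rewrite ord1 mxE; apply/eqP; rewrite -sqrf_eq0.
    have : sq2 x = 0 by rewrite -l2norm_sq x0 expr0n.
    by move/eqP; rewrite psumr_eq0 => [/allP/(_ i)|k _]; rewrite ?sqr_ge0// mem_index_enum => /(_ isT).
  rewrite xz mulmx0 /l2norm big1 ?sqrtr0 ?mulr0// => i _.
  by rewrite mxE expr0n.
have xp : 0 < l2norm x by rewrite lt_neqAle eq_sym x0 n0.
rewrite -ler_pdivrMr// (_ : _ / _ = l2norm (H *m ((l2norm x)^-1 *: x))); last first.
  by rewrite -scalemxAr l2Z ?invr_ge0 ?n0// mulrC.
apply: sup_upper_bound => //; last first.
  exists ((l2norm x)^-1 *: x) => //=; rewrite l2Z ?invr_ge0 ?n0//.
  by rewrite mulVf.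
split => //; exists (l2norm (H *m 0)), 0 => //=.
by rewrite /l2norm big1 ?sqrtr0// => i _; rewrite mxE expr0n.
Qed.

Lemma nsq_col B : nsq B = \sum_(j < p) sq2 (col j B).
Proof.
rewrite /nsq ipE exchange_big; apply: eq_bigr => j _; apply: eq_bigr => i _.
by rewrite mxE expr2.
Qed.

(** The square of the Frobenius norm adds up over the columns, and each column is
    multiplied by H. *)
Lemma nsq_opnorm H B (c : R) : opnorm H <= c -> nsq (H *m B) <= c ^+ 2 * nsq B.
Proof.
move=> Hc; rewrite !nsq_col mulr_sumr; apply: ler_sum => j _.
rewrite (_ : col j (H *m B) = H *m col j B); last by rewrite !colE mulmxA.
rewrite -!l2norm_sq -exprMn.
have n0 (y : 'cV[R]_p) : 0 <= l2norm y by exact: sqrtr_ge0.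
rewrite lerXn2r ?nnegrE//.
  by rewrite (le_trans (n0 (H *m col j B)))// (le_trans (opnorm_le _ _))// ler_wpM2r.
by rewrite (le_trans (opnorm_le _ _))// ler_wpM2r.
Qed.

End OperatorNorm.

(** Here A stands for omega H / n and a bounds the square of its operator norm. *)
Section PrecisionMatrix.
Context (R : realType) (p : nat) (A : 'M[R]_p) (a : R).
Hypotheses (As : A^T = A) (a_gt0 : 0 < a) (a_le : a <= 1 / 12).
Hypothesis Aop : forall B : 'M[R]_p, nsq (A *m B) <= a * nsq B.
Let M := 1%:M + A + A *m A.
Let S := invmx M.
Let G := S - 1%:M.

Let Ms : M^T = M.
Proof. by rewrite /M !linearD /= trmx1 trmx_mul As. Qed.

Lemma row_sq_ge0 (v : 'rV[R]_p) : 0 <= (v *m v^T) ord0 ord0.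
Proof. by rewrite mxE; apply: sumr_ge0 => i _; rewrite mxE -expr2 sqr_ge0. Qed.

Lemma row_sq_gt0 (v : 'rV[R]_p) : v != 0 -> 0 < (v *m v^T) ord0 ord0.
Proof.
move=> v0; rewrite lt_neqAle row_sq_ge0 andbT eq_sym; apply: contra v0.
rewrite mxE psumr_eq0 => [/allP h|i _]; last by rewrite mxE -expr2 sqr_ge0.
apply/eqP/matrixP => i j; rewrite ord1 [RHS]mxE.
by have := h j; rewrite mem_index_enum mxE -expr2 sqrf_eq0 => /(_ isT)/eqP.
Qed.

(** 1 + A + A^2 = ((1 + A)^2 + 1 + A^2) / 2. *)
Lemma quad_precision (v : 'rV[R]_p) :
  (v *m v^T) ord0 ord0 / 2 <= (v *m M *m v^T) ord0 ord0.
Proof.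
have h := row_sq_ge0 (v + v *m A); have h2 := row_sq_ge0 (v *m A).
have E1 : v *m M *m v^T = v *m v^T + v *m A *m v^T + (v *m A) *m (v *m A)^T.
  by rewrite /M !mulmxDr !mulmxDl mulmx1 trmx_mul As !mulmxA.
have E2 : (v + v *m A) *m (v + v *m A)^T =
    v *m v^T + v *m A *m v^T + v *m A *m v^T + (v *m A) *m (v *m A)^T.
  rewrite [(_ + _)^T]linearD /= mulmxDr !mulmxDl [(v *m A)^T in X in _ + X]trmx_mul As.
  by rewrite !mulmxA trmx_mul As !mulmxA !addrA.
have h1 := row_sq_ge0 v.
move: h h1 h2; rewrite E1 E2 !mxE.
by lra.
Qed.

Lemma precision_unit : M \in unitmx.
Proof.
rewrite -row_free_unit; apply/inj_row_free => v vM.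
apply/eqP; apply: contraT => /row_sq_gt0 v0.
by have := quad_precision v; rewrite vM mul0mx [X in _ <= X]mxE; lra.
Qed.

Lemma posdef_cov : posdef S.
Proof.
have Ss : S^T = S by rewrite /S trmx_inv Ms.
split => // v v0; pose w := v *m S.
have vE : v = w *m M by rewrite /w -mulmxA mulVmx ?precision_unit// mulmx1.
have -> : v *m S *m v^T = w *m M *m w^T.
  by rewrite -/w [in LHS]vE trmx_mul Ms mulmxA.
apply: lt_le_trans (quad_precision w); rewrite divr_gt0// row_sq_gt0//.
by apply: contra v0 => /eqP w0; rewrite vE w0 mul0mx.
Qed.

Lemma nsqD_le (X Y : 'M[R]_p) : nsq (X + Y) <= 2 * (nsq X + nsq Y).
Proof. by have := nsq_ge0 (X - Y); rewrite nsqB nsqD; lra. Qed.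

(** With C = S B, the equation B = C + A C + A^2 C bounds C in terms of B, as A is
    small. *)
Lemma nsq_cov_mul (B : 'M[R]_p) : nsq (S *m B) <= 5 * nsq B.
Proof.
set C := S *m B.
have BE : B = C + (A *m C + A *m (A *m C)).
  have -> : C + (A *m C + A *m (A *m C)) = M *m C.
    by rewrite /M !mulmxDl mul1mx addrA mulmxA.
  by rewrite /C mulmxA mulmxV ?precision_unit// mul1mx.
have h1 : nsq C <= 2 * (nsq B + nsq (A *m C + A *m (A *m C))).
  rewrite -[X in nsq X <= _](addrK (A *m C + A *m (A *m C))) -BE.
  by rewrite -[X in 2 * (_ + X)]nsqN nsqD_le.
have h2 := nsqD_le (A *m C) (A *m (A *m C)).
have h3 := Aop C; have h4 := Aop (A *m C).
have c0 := nsq_ge0 C; have b0 := nsq_ge0 B.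
have al := a_le; have a0 := a_gt0.
have h5 : a * nsq C <= 1 / 12 * nsq C by rewrite ler_wpM2r.
have h6 : a * nsq (A *m C) <= 1 / 12 * nsq (A *m C) by rewrite ler_wpM2r ?nsq_ge0.
lra.
Qed.

Let E := S *m (A *m (A *m A)).

(** From (1 + A + A^2)(1 - A) = 1 - A^3: the covariance has no term of order 2
    in A. *)
Lemma covB1_expand : G = E - A.
Proof.
have h : M *m (1%:M - A) = 1%:M - A *m (A *m A).
  rewrite /M mulmxBr mulmx1 !mulmxDl mul1mx -mulmxA.
  move: (A *m A) (A *m (A *m A)) => X Y.
  by rewrite -[1%:M + A + X]addrA opprD [LHS]addrA addrK.
have : 1%:M - A = S *m (1%:M - A *m (A *m A)).
  by rewrite -h mulmxA mulVmx ?precision_unit// mul1mx.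
rewrite mulmxBr mulmx1 -/E /G => h'.
have -> : S = 1%:M - A + E by rewrite h' subrK.
by rewrite -[_ + E]addrA [1%:M + _]addrC addrK addrC.
Qed.

Lemma nsq_remainder_mul (B : 'M[R]_p) : nsq (E *m B) <= 5 * a ^+ 2 * nsq (A *m B).
Proof.
have a0 := ltW a_gt0.
rewrite /E -!mulmxA (le_trans (nsq_cov_mul _))// -mulrA ler_wpM2l//.
by rewrite expr2 -mulrA (le_trans (Aop _))// ler_wpM2l// Aop.
Qed.

Lemma nsq_covB1_mul (B : 'M[R]_p) : nsq (G *m B) <= 3 * nsq (A *m B).
Proof.
rewrite covB1_expand mulmxBl (le_trans (nsqD_le _ _))// nsqN.
have h := nsq_remainder_mul B; have n0 := nsq_ge0 (A *m B).
have h2 : 5 * a ^+ 2 * nsq (A *m B) <= 1 / 2 * nsq (A *m B).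
  have al := a_le; have a0 := a_gt0; rewrite ler_wpM2r//; nra.
lra.
Qed.

Lemma nsq_covB1_dev : `|nsq G - nsq A| <= 7 * a * nsq A.
Proof.
have h := nsq_remainder_mul 1%:M; rewrite !mulmx1 in h.
have h2 := ip_amgm A E a_gt0; have n0 := nsq_ge0 A; have e0 := nsq_ge0 E.
have al := a_le; have a0 := a_gt0.
have h3 : a^-1 * nsq E <= 5 * a * nsq A.
  by rewrite ler_pdivrMl// (le_trans h)// le_eqVlt; apply/orP; left; apply/eqP; ring.
have h4 : nsq E <= a * nsq A.
  apply: (le_trans h); rewrite ler_wpM2r//; nra.
rewrite covB1_expand [E - A]addrC nsqD nsqN ipNl.
have : `|nsq A + 2 * - ip A E + nsq E - nsq A| <= 2 * `|ip A E| + nsq E.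
  rewrite (_ : _ - nsq A = nsq E - 2 * ip A E); last by ring.
  by rewrite (le_trans (ler_normB _ _))// normrM (ger0_norm e0) [`|2|]ger0_norm// addrC.
by lra.
Qed.

End PrecisionMatrix.

(** * The test statistic as a sum over pairs *)

Section UStatistic.
Context (R : realType) (p : nat).
Notation V := (p.-tuple R).

(** The sum over pairs, built by adding one element at the head.  The pairs are
    unordered, so it is immaterial that the head of a tuple, which has index 0,
    is treated as the newest observation. *)
Fixpoint pairsum (s : seq V) : R :=
  if s is x :: s' then pairsum s' + ip (ysum s') (ymat x) else 0.

Lemma ip_suml (I : Type) (rs : seq I) (F : I -> 'M[R]_p) (B : 'M[R]_p) :
  ip (\sum_(i <- rs) F i) B = \sum_(i <- rs) ip (F i) B.
Proof.
elim: rs => [|i rs IH]; first by rewrite !big_nil ip0l.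
by rewrite !big_cons ipDl IH.
Qed.

Lemma pairsum_tuple n (x : n.-tuple V) :
  \sum_(t < n) \sum_(s < n | (s < t)%N) ip (ymat (tnth x t)) (ymat (tnth x s)) =
  pairsum x.
Proof.
elim: n x => [|n IH] x; first by rewrite big_ord0 tuple0.
case/tupleP: x => x0 x /=.
rewrite big_ord_recl big_pred0 ?add0r; last by move=> s; rewrite ltn0.
rewrite -IH /ysum big_tuple ip_suml -big_split /=.
apply: eq_bigr => t _.
rewrite big_mkcond big_ord_recl /= tnth0 tnthS addrC; congr (_ + _).
rewrite [RHS]big_mkcond; apply: eq_bigr => s _.
by rewrite tnthS.
Qed.

(** The strict lower triangle is the mirror image of the upper one, hence the
    factor 2 that the statistic compensates by halving its diagonal part. *)
Lemma ip_ymat_split (x y : V) : ip (ymat x) (ymat y) =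
  2 * (\sum_(i < p) \sum_(j < p | (i < j)%N)
    (tnth x i * tnth x j) * (tnth y i * tnth y j)) +
  \sum_(i < p) (tnth x i ^+ 2 - 1) * (tnth y i ^+ 2 - 1).
Proof.
pose F (i j : 'I_p) := ymat x i j * ymat y i j.
have Fs i j : F i j = F j i by rewrite /F -{1}trmx_ymat -{1}[ymat y]trmx_ymat !mxE.
have -> : ip (ymat x) (ymat y) = \sum_i \sum_j F i j by rewrite ipE.
have -> : \sum_i \sum_j F i j = \sum_(i < p) (\sum_(j < p | (i < j)%N) F i j
    + \sum_(j < p | (j < i)%N) F i j + F i i).
  apply: eq_bigr => i _.
  rewrite (bigID (fun j : 'I_p => (i < j)%N)) /= -addrA; congr (_ + _).
  rewrite (bigD1 i) ?ltnn//= addrC; congr (_ + _).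
  by apply: eq_bigl => j; rewrite -leqNgt [RHS]ltn_neqAle andbC.
rewrite 2!big_split /=.
have -> : \sum_(i < p) \sum_(j < p | (j < i)%N) F i j =
    \sum_(i < p) \sum_(j < p | (i < j)%N) F i j.
  rewrite (exchange_big_dep predT)//=; apply: eq_bigr => i _.
  by apply: eq_bigr => j _.
rewrite mulr_natl mulr2n; congr (_ + _ + _).
- apply: eq_bigr => i _; apply: eq_bigr => j ij.
  by rewrite /F !mxE -val_eqE (ltn_eqF ij) !subr0.
- apply: eq_bigr => i _; apply: eq_bigr => j ij.
  by rewrite /F !mxE -val_eqE (ltn_eqF ij) !subr0.
- by apply: eq_bigr => i _; rewrite /F !mxE eqxx !expr2.
Qed.

Lemma U_statE n (x : n.-tuple V) : U_stat x = (2 * n%:R ^+ 2)^-1 * pairsum x.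
Proof.
rewrite -pairsum_tuple.
under eq_bigr do under eq_bigr do rewrite ip_ymat_split.
have drop0 (F : 'I_n -> R) (c : 'I_n -> R) :
    \sum_(t < n | (0 < t)%N) c t * \sum_(s < n | (s < t)%N) F s =
    \sum_(t < n) \sum_(s < n | (s < t)%N) c t * F s.
  rewrite big_mkcond; apply: eq_bigr => t _; rewrite mulr_sumr.
  case: ifPn => //; rewrite -eqn0Ngt => /eqP t0.
  by rewrite big_pred0// => s; rewrite t0 ltn0.
rewrite /U_stat /=.
under eq_bigr do under eq_bigr do rewrite drop0.
under [X in _ + _ * X]eq_bigr do rewrite drop0.
have -> : \sum_(t < n) \sum_(s < n | (s < t)%N)
   (2 * (\sum_(i < p) \sum_(j < p | (i < j)%N)
      (tnth (tnth x t) i * tnth (tnth x t) j) * (tnth (tnth x s) i * tnth (tnth x s) j)) +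
    \sum_(i < p) (tnth (tnth x t) i ^+ 2 - 1) * (tnth (tnth x s) i ^+ 2 - 1)) =
  2 * (\sum_(i < p) \sum_(j < p | (i < j)%N) \sum_(t < n) \sum_(s < n | (s < t)%N)
      (tnth (tnth x t) i * tnth (tnth x t) j) * (tnth (tnth x s) i * tnth (tnth x s) j)) +
  \sum_(i < p) \sum_(t < n) \sum_(s < n | (s < t)%N)
      (tnth (tnth x t) i ^+ 2 - 1) * (tnth (tnth x s) i ^+ 2 - 1).
  under eq_bigr do rewrite big_split /= -mulr_sumr.
  rewrite big_split /= -mulr_sumr; congr (2 * _ + _).
    transitivity (\sum_(t < n) \sum_(i < p) \sum_(j < p | (i < j)%N) \sum_(s < n | (s < t)%N)
      (tnth (tnth x t) i * tnth (tnth x t) j) * (tnth (tnth x s) i * tnth (tnth x s) j)).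
      by apply: eq_bigr => t _; rewrite exchange_big; apply: eq_bigr => i _; rewrite exchange_big.
    by rewrite exchange_big; apply: eq_bigr => i _; rewrite exchange_big.
  transitivity (\sum_(t < n) \sum_(i < p) \sum_(s < n | (s < t)%N)
    (tnth (tnth x t) i ^+ 2 - 1) * (tnth (tnth x s) i ^+ 2 - 1)).
    by apply: eq_bigr => t _; rewrite exchange_big.
  by rewrite exchange_big.
rewrite mulrDr [_^-1 * (2 * _)]mulrA; congr (_ * _ + _).
by rewrite [in RHS]invfM mulrAC mulVf ?mul1r// pnatr_eq0.
Qed.

(** Centring the increments by m |G|^2 for m < n subtracts
    n (n - 1) / 2 |G|^2 in total. *)
Lemma mart_pairsum n (L : 'M[R]_p) (G := L *m L^T - 1%:M) (s : seq V) : mart n L s =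
  stat_scale R n p * (pairsum s - (size s)%:R * ((size s)%:R - 1) / 2 * nsq G).
Proof.
elim: s => [|x s IH]; first by rewrite /= !mul0r subrr mulr0.
by rewrite /= IH /incr -/G -natr1; field; rewrite /stat_scale.
Qed.

Lemma test_statE n (x : n.-tuple V) (L : 'M[R]_p) (G := L *m L^T - 1%:M) :
  (0 < n)%N -> (0 < p)%N ->
  2 * U_stat x / (p%:R / n%:R) = mart n L x + (n%:R - 1) / (2 * p%:R) * nsq G.
Proof.
move=> n0 p0; rewrite U_statE mart_pairsum -/G size_tuple /stat_scale.
by field; rewrite !pnatr_eq0 -!lt0n n0 p0.
Qed.

End UStatistic.

(** * Estimates on the bulk *)

Section Bulk.
Context (R : realType).

Lemma cov_rootP p (S : 'M[R]_p) : posdef S -> cov_root S *m (cov_root S)^T = S.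
Proof.
move=> /cholesky exL; rewrite /cov_root.
exact: (@xgetPex _ 0 [set L : 'M[R]_p | L *m L^T = S] exL).
Qed.

(** The operator norm condition on H makes a = 9 omega^2 (p/n) / n a bound for the
    square of the operator norm of A = omega H / n; the trace condition says
    that |A|^2 is omega^2 (p/n)^2 up to the relative error d. *)
Lemma K_rig_bounds n p (omega : R) (H : 'M[R]_p) (c := p%:R / n%:R)
    (a := 9 * omega ^+ 2 * c / n%:R) (d := n%:R `^ (- 4^-1))
    (L := cov_root (Sigma n omega H)) (G := L *m L^T - 1%:M) :
  (0 < n)%N -> (0 < p)%N -> 0 < omega -> K_rig n H -> a <= 1 / 12 -> d <= 1 ->
  [/\ forall B, n%:R * nsq (G *m B) <= 27 * omega ^+ 2 * c * nsq B,
      nsq G <= 6 * omega ^+ 2 * c ^+ 2 &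
      `|nsq G - omega ^+ 2 * c ^+ 2| <= omega ^+ 2 * c ^+ 2 * (d + 14 * a)].
Proof.
move=> n0 p0 w0 [Hs Hop Htr] a12 d1.
have N0 : 0 < n%:R :> R by rewrite ltr0n.
have P0 : 0 < p%:R :> R by rewrite ltr0n.
have Nn0 : n%:R != 0 :> R by rewrite gt_eqF.
have Pn0 : p%:R != 0 :> R by rewrite gt_eqF.
have c0 : 0 < c by rewrite divr_gt0.
have a0 : 0 < a by rewrite divr_gt0// mulr_gt0// mulr_gt0// exprn_gt0.
pose A := (omega / n%:R) *: H.
have As : A^T = A by rewrite linearZ /= Hs.
have Aop B : nsq (A *m B) <= a * nsq B.
  rewrite /A -scalemxAl nsqZ.
  have h := nsq_opnorm B Hop; rewrite exprMn sqr_sqrtr// in h.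
  have := ler_wpM2l (sqr_ge0 (omega / n%:R)) h => /le_trans; apply.
  by rewrite le_eqVlt; apply/orP; left; apply/eqP; rewrite /a /c; field.
have LE : L *m L^T = invmx (1%:M + A + A *m A).
  by apply: cov_rootP; exact: (posdef_cov As).
have GE : G = invmx (1%:M + A + A *m A) - 1%:M by rewrite /G LE.
have gB B := nsq_covB1_mul As a0 a12 Aop B; have gA := nsq_covB1_dev As a0 a12 Aop.
rewrite -GE in gA; have {}gB B : nsq (G *m B) <= 3 * nsq (A *m B) by rewrite GE.
have w2 : 0 <= omega ^+ 2 * c ^+ 2 by rewrite mulr_ge0 ?sqr_ge0.
have nA : `|nsq A - omega ^+ 2 * c ^+ 2| <= omega ^+ 2 * c ^+ 2 * d.
  rewrite (_ : nsq A - _ = omega ^+ 2 * c ^+ 2 * (p%:R ^- 2 * \tr (H *m H) - 1)).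
    by rewrite normrM ger0_norm// ler_wpM2l.
  by rewrite /A nsqZ /nsq /ip Hs /c; field; rewrite Nn0 Pn0.
have A2 : nsq A <= 2 * (omega ^+ 2 * c ^+ 2).
  have h := ler_wpM2l w2 d1; have := ler_norm (nsq A - omega ^+ 2 * c ^+ 2).
  by move: nA h; lra.
split.
- move=> B; have h := ler_wpM2l (ltW N0) (gB B); apply: (le_trans h).
  have h2 := ler_wpM2l (ltW N0) (ler_wpM2l (ler0n R 3) (Aop B)).
  apply: (le_trans h2); rewrite le_eqVlt; apply/orP; left; apply/eqP.
  by rewrite /a; field.
- by have := gB 1%:M; rewrite !mulmx1; lra.
- have h := ler_wpM2l (ltW a0) A2.
  apply: (le_trans (ler_distD (nsq A) _ _)).
  by move: nA gA h; lra.
Qed.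

End Bulk.

(** * From smoothed to exact rejection probabilities *)

Section Sandwich.
Context (R : realType).

(** A smoothed step shifted by d lies above the indicator, except for the normal
    tail beyond d / sqrt e. *)
Lemma smooth_step_gt (e d z t : R) : 0 < e -> 0 < d ->
  (t <= z)%R%:R <= Phi ((z + d - t) / Num.sqrt e) + (1 - Phi (d / Num.sqrt e)).
Proof.
move=> e0 d0; have s0 : 0 < Num.sqrt e by rewrite sqrtr_gt0.
case: (leP t z) => [tz|_] /=; last first.
  by rewrite addr_ge0 ?Phi_ge0// subr_ge0 Phi_le1.
have : Phi (d / Num.sqrt e) <= Phi ((z + d - t) / Num.sqrt e).
  by apply: Phi_nd; rewrite ler_pM2r ?invr_gt0//; lra.
by lra.
Qed.

Lemma smooth_step_lt (e d z t : R) : 0 < e -> 0 < d ->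
  Phi ((z - d - t) / Num.sqrt e) - Phi (- d / Num.sqrt e) <= (t <= z)%R%:R.
Proof.
move=> e0 d0; have s0 : 0 < Num.sqrt e by rewrite sqrtr_gt0.
case: (leP t z) => tz /=.
  by have := Phi_le1 ((z - d - t) / Num.sqrt e); have := Phi_ge0 (- d / Num.sqrt e); lra.
rewrite subr_le0; apply: Phi_nd; rewrite ler_pM2r ?invr_gt0//; lra.
Qed.

Lemma inv_sqrt_near1 (t : R) : 1 / 2 <= t -> `|(Num.sqrt t)^-1 - 1| <= `|t - 1|.
Proof.
move=> t12; have t0 : 0 < t by lra.
set s := Num.sqrt t; have s0 : 0 < s by rewrite sqrtr_gt0.
have tE : t = s ^+ 2 by rewrite sqr_sqrtr// ltW.
have -> : s^-1 - 1 = (1 - s) / s by field; rewrite gt_eqF.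
have -> : t - 1 = (s - 1) * (s + 1) by rewrite tE; ring.
rewrite !normrM normfV -[`|1 - s|]normrN opprB ler_wpM2l//.
rewrite (gtr0_norm s0) gtr0_norm; last by lra.
rewrite invf_ple ?posrE//; last by lra.
rewrite -(ler_pM2r (_ : 0 < s + 1)); last by lra.
rewrite mulVf; last by rewrite gt_eqF//; lra.
by move: t12; rewrite tE; nra.
Qed.

Lemma Phi_scaled (z w t : R) : 1 / 2 <= t ->
  `|Phi (w / Num.sqrt t) - Phi z| <= `|w| * `|t - 1| + `|w - z|.
Proof.
move=> t12; apply: (le_trans (Phi_lip _ _)).
have -> : w / Num.sqrt t - z = w * ((Num.sqrt t)^-1 - 1) + (w - z) by ring.
rewrite (le_trans (ler_normD _ _))// lerD2r normrM ler_wpM2l//.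
exact: inv_sqrt_near1.
Qed.

End Sandwich.

(** * Uniform limit of the power *)

Section Power.
Context (R : realType).

Lemma mom_indic_le (disp : measure_display) (T : measurableType disp)
    (P : probability T R) (f : T -> R) (z : R) :
  mom P f -> mom P (fun t => (f t <= z)%R%:R).
Proof.
move=> fm; apply: (@mom_bnd _ _ _ _ _ 1); last by move=> x; rewrite normr_nat lern1 leq_b1.
rewrite (_ : (fun t => _) = fun t => if (f t <= z)%R then 1 else 0); last first.
  by apply/funext => t; case: (_ <= _).
apply: measurable_fun_ifT => //.
by apply: measurable_fun_ler => //; exact: mom_meas fm.
Qed.

(** The indicator lies between two smoothed steps, shifted by d in either
    direction.  A bound on the smoothed distribution function at all points thus
    gives the exact one at z, at the price of the normal tails beyond
    d / sqrt e and of the modulus of continuity of Phi. *)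
Lemma indicator_approx (disp : measure_display) (T : measurableType disp)
    (P : probability T R) (f : T -> R) (z w mu e d tau eps1 : R) :
  mom P f -> 0 < e -> 0 < d -> 1 / 2 <= tau ->
  (forall z, `|Ex P (fun t => Phi ((z - f t) / Num.sqrt e)) -
     Phi (z / Num.sqrt tau)| <= eps1) ->
  `|Ex P (fun t => (f t + mu <= z)%R%:R) - Phi w| <=
  eps1 + (1 - Phi (d / Num.sqrt e)) + Phi (- d / Num.sqrt e) +
    (`|z| + d + `|mu|) * `|tau - 1| + d + `|z - mu - w|.
Proof.
move=> fm e0 d0 t12 hP.
pose Z := z - mu.
have -> : Ex P (fun t => (f t + mu <= z)%R%:R) = Ex P (fun t => (f t <= Z)%R%:R).
  by apply: Ex_eq => t; rewrite lerBrDr.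
have im := mom_indic_le Z fm.
have sm y : mom P (fun t => Phi ((y - f t) / Num.sqrt e)).
  apply: (@mom_bnd _ _ _ _ _ 1); last by move=> x; rewrite ger0_norm ?Phi_ge0// Phi_le1.
  apply: measurableT_comp; first exact: measurable_Phi.
  apply: measurable_funM => //; apply: measurable_funB => //; exact: mom_meas fm.
set t1 := Phi (d / _); set t2 := Phi (- d / _).
have t1b : t1 <= 1 by exact: Phi_le1.
have t2b : 0 <= t2 by exact: Phi_ge0.
have Zle : `|Z| <= `|z| + `|mu| by exact: ler_normB.
have tn0 : 0 <= `|tau - 1| by [].
have h s : `|s| <= d -> `|Phi ((Z + s) / Num.sqrt tau) - Phi w| <=
    (`|z| + d + `|mu|) * `|tau - 1| + d + `|Z - w|.
  move=> sd; apply: (le_trans (Phi_scaled w (Z + s) t12)).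
  rewrite -[leRHS]addrA; apply: lerD.
    apply: ler_wpM2r => //; apply: le_trans (ler_normD _ _) _.
    by move: Zle sd; lra.
  by rewrite (_ : Z + s - w = s + (Z - w)) ?(le_trans (ler_normD _ _)) ?lerD2r//; ring.
have up : Ex P (fun t => (f t <= Z)%R%:R) <=
    Ex P (fun t => Phi ((Z + d - f t) / Num.sqrt e)) + (1 - t1).
  rewrite -[1 - t1](Ex_cst P) -ExD//; last exact: mom_cst.
  apply: le_Ex => //; first by apply: momD => //; exact: mom_cst.
  by move=> t; exact: smooth_step_gt.
have lo : Ex P (fun t => Phi ((Z - d - f t) / Num.sqrt e)) - t2 <=
    Ex P (fun t => (f t <= Z)%R%:R).
  rewrite -[t2](Ex_cst P) -ExB//; last exact: mom_cst.
  apply: le_Ex => //; first by apply: momB => //; exact: mom_cst.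
  by move=> t; exact: smooth_step_lt.
have h1 := h d; have h2 := h (- d); rewrite normrN in h2.
have dd : `|d| <= d by rewrite ger0_norm// ltW.
have {}h1 := h1 dd; have {}h2 := h2 dd.
have g1 := hP (Z + d); have g2 := hP (Z - d).
move: up lo h1 h2 g1 g2; rewrite -/Z !ler_norml.
set A := Ex P _; set B := Ex P _; set D := Ex P _.
set F1 := Phi ((Z + d) / _); set F2 := Phi ((Z - d) / _); set W := Phi w.
set X := (_ + _ + _) * _.
move=> up lo /andP[_ h1] /andP[h2 _] /andP[_ g1] /andP[g2 _].
by apply/andP; split; lra.
Qed.

Lemma powR_quarter_le (n : nat) (e : R) : 0 < e -> e ^- 4 <= n%:R ->
  n%:R `^ (- 4^-1) <= e.
Proof.
move=> e0 en; have N0 : 0 < n%:R :> R by apply: lt_le_trans en; rewrite invr_gt0 exprn_gt0.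
rewrite -(@ler_pXn2r _ 4) ?nnegrE ?powR_ge0 ?(ltW e0)//.
rewrite -powR_mulrn ?powR_ge0// -powRrM mulNr mulVf// powR_inv1 ?(ltW N0)//.
by rewrite invf_ple ?posrE// exprn_gt0.
Qed.

(** The bulk contains sqrt p times the identity.  In particular the supremum over
    it is not that of the empty set, which would be -oo. *)
Lemma scalar_in_K_rig n p : (0 < p)%N -> @K_rig R n p ((Num.sqrt p%:R)%:M).
Proof.
move=> p0; have P0 : 0 < p%:R :> R by rewrite ltr0n.
set s := Num.sqrt p%:R; have s0 : 0 <= s by exact: sqrtr_ge0.
split.
- by rewrite tr_scalar_mx.
- apply: (@le_trans _ _ s); last by rewrite -/s; lra.
  apply: ge_sup.
    exists (l2norm (s%:M *m (0 : 'cV[R]_p))), 0 => //=.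
    by rewrite /l2norm big1 ?sqrtr0// => i _; rewrite mxE expr0n.
  move=> _ [x /= x1 <-]; rewrite mul_scalar_mx.
  rewrite /l2norm (eq_bigr (fun i => s ^+ 2 * x i 0 ^+ 2)); last first.
    by move=> i _; rewrite mxE exprMn.
  rewrite -mulr_sumr sqrtrM ?sqr_ge0// sqrtr_sqr ger0_norm// -[leRHS]mulr1.
  by rewrite ler_wpM2l.
- rewrite mul_scalar_mx scale_scalar_mx mxtrace_scalar -expr2 sqr_sqrtr ?(ltW P0)//.
  rewrite -[p%:R *+ p]mulr_natr -expr2 mulVf ?expf_neq0 ?gt_eqF//.
  by rewrite subrr normr0 powR_ge0.
Qed.

Lemma phi_U_mart (alpha : R) n p (L : 'M[R]_p) (x : n.-tuple (p.-tuple R)) :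
  (0 < n)%N -> (0 < p)%N ->
  phi_U alpha x = 1 - (mart n L x +
    (n%:R - 1) / (2 * p%:R) * nsq (L *m L^T - 1%:M) <= Phi_inv (1 - alpha))%R%:R.
Proof.
move=> n0 p0; rewrite /phi_U (test_statE _ L n0 p0).
by case: leP => _ /=; rewrite ?subrr ?subr0.
Qed.

Lemma mom_phi_U (alpha : R) n p (L : 'M[R]_p) : (0 < n)%N -> (0 < p)%N ->
  mom (iid_law (distribution (iid_law (gauss R) p) (lin_map L)) n) (@phi_U R alpha n p).
Proof.
move=> n0 p0; rewrite (_ : @phi_U R alpha n p = fun x => 1 - (mart n L x +
    (n%:R - 1) / (2 * p%:R) * nsq (L *m L^T - 1%:M) <= Phi_inv (1 - alpha))%R%:R); last first.
  by apply/funext => x; rewrite (phi_U_mart _ L).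
apply: momB; first exact: mom_cst.
apply: mom_indic_le; apply: momD; [exact: mom_mart|exact: mom_cst].
Qed.

(** The kappa of the moment bounds.  The summands bound p / n and n / p when
    p / n is within a factor 2 of gamma, and the operator and Frobenius norms
    of G through [K_rig_bounds]. *)
Definition bulk_const (gamma omega : R) : R :=
  1000 + 2 * gamma + 2 / gamma + 54 * omega ^+ 2 * gamma
   + 24 * omega ^+ 2 * gamma ^+ 2.

Lemma bulk_const_ge (gamma omega : R) : 0 < gamma -> 0 < omega ->
  [/\ 1000 <= bulk_const gamma omega, 2 * gamma <= bulk_const gamma omega,
      2 / gamma <= bulk_const gamma omega,
      54 * omega ^+ 2 * gamma <= bulk_const gamma omega &
      24 * omega ^+ 2 * gamma ^+ 2 <= bulk_const gamma omega].
Proof.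
move=> g0 w0; have w2 : 0 < omega ^+ 2 by rewrite exprn_gt0.
have t1 : 0 < 2 * gamma by rewrite mulr_gt0.
have t2 : 0 < 2 / gamma by rewrite divr_gt0.
have t3 : 0 < 54 * omega ^+ 2 * gamma by rewrite mulr_gt0// mulr_gt0.
have t4 : 0 < 24 * omega ^+ 2 * gamma ^+ 2.
  by rewrite mulr_gt0 ?exprn_gt0// mulr_gt0.
by rewrite /bulk_const; split; lra.
Qed.

(** For large n every matrix of the bulk satisfies the hypotheses of the normal
    approximation, with a constant that does not depend on the matrix, and the
    mean of the statistic is close to omega^2 gamma / 2. *)
Lemma bulk_regime n p (gamma omega b : R) (H : 'M[R]_p) (c := p%:R / n%:R)
    (wg := omega ^+ 2 * gamma) (kappa := bulk_const gamma omega)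
    (L := cov_root (Sigma n omega H)) (G := L *m L^T - 1%:M) :
  (0 < n)%N -> (0 < p)%N -> 0 < gamma -> 0 < omega -> 0 < b -> K_rig n H ->
  `|gamma - c| <= gamma / 2 -> `|gamma - c| <= b / omega ^+ 2 ->
  216 * wg <= n%:R -> (252 * wg + 6) * wg / (b / 2) <= n%:R ->
  n%:R `^ (- 4^-1) <= (1 : R) -> wg * n%:R `^ (- 4^-1) <= b ->
  [/\ p%:R <= kappa * n%:R, n%:R <= kappa * p%:R, nsq G <= kappa,
      forall B, n%:R * nsq (G *m B) <= kappa * nsq B &
      `|(n%:R - 1) / (2 * p%:R) * nsq G - omega ^+ 2 * gamma / 2| <= 3 * b].
Proof.
move=> n0 p0 g0 w0 b0 HK cg1 cg2 nK1 nK3; set dn := _ `^ _ => dn1 dnb.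
have N0 : 0 < n%:R :> R by rewrite ltr0n.
have P0 : 0 < p%:R :> R by rewrite ltr0n.
have w2 : 0 < omega ^+ 2 by rewrite exprn_gt0.
have wg0 : 0 < wg by rewrite mulr_gt0.
have [_ k1 k2 k3 k4] := bulk_const_ge g0 w0; rewrite -/kappa in k1 k2 k3 k4.
have [cl cu] : gamma / 2 <= c /\ c <= 2 * gamma.
  by move: cg1; rewrite ler_norml => /andP[]; lra.
have c0 : 0 < c by rewrite divr_gt0.
pose a := 9 * omega ^+ 2 * c / n%:R.
have cuw := ler_wpM2l (ltW w2) cu.
have a_le : a * n%:R <= 18 * wg.
  by rewrite /a divfK ?gt_eqF// /wg; lra.
have a12 : a <= 1 / 12 by rewrite -(ler_pM2r N0); lra.
have [Gop Gk Gdev] := K_rig_bounds n0 p0 w0 HK a12 dn1.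
rewrite -/c -/a -/dn -/L -/G in Gop Gk Gdev.
have G0 := nsq_ge0 G.
have a0 : 0 <= a by rewrite divr_ge0// mulr_ge0 ?(ltW c0)// mulr_ge0// ltW.
have dn0 : 0 <= dn by exact: powR_ge0.
split.
- by rewrite -ler_pdivrMr// -/c (le_trans cu).
- rewrite -ler_pdivrMr// (@le_trans _ _ (2 / gamma))//.
  rewrite (_ : n%:R / p%:R = c^-1); last by rewrite /c invf_div.
  by rewrite -[2 / gamma]invf_div lef_pV2 ?posrE// divr_gt0.
- apply: (le_trans Gk); apply: le_trans k4.
  have : c ^+ 2 <= (2 * gamma) ^+ 2 by apply: ler_sq => //; exact: ltW.
  by move=> /(ler_wpM2l (ltW w2)); rewrite exprMn; lra.
- move=> B; apply: (le_trans (Gop B)); rewrite ler_wpM2r ?nsq_ge0//.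
  by apply: le_trans k3; lra.
have c2 : 0 < 2 * c by rewrite mulr_gt0.
(* The three errors: |G|^2 against omega^2 c^2, n - 1 against n, and c against
   gamma. *)
have E : (n%:R - 1) / (2 * p%:R) * nsq G - omega ^+ 2 * gamma / 2 =
   (nsq G - omega ^+ 2 * c ^+ 2) / (2 * c)
   - nsq G / (2 * c * n%:R) + omega ^+ 2 / 2 * (c - gamma).
  rewrite (_ : p%:R = c * n%:R); last by rewrite /c divfK// gt_eqF.
  by field; rewrite !gt_eqF.
have e1 : `|(nsq G - omega ^+ 2 * c ^+ 2) / (2 * c)| <= wg * (dn + 14 * a).
  rewrite normrM normfV (gtr0_norm c2) ler_pdivrMr// (le_trans Gdev)//.
  rewrite (_ : omega ^+ 2 * c ^+ 2 * _ = (omega ^+ 2 * c * (dn + 14 * a)) * c); last by ring.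
  rewrite (_ : wg * _ * _ = (omega ^+ 2 * (2 * gamma) * (dn + 14 * a)) * c); last by rewrite /wg; ring.
  apply: ler_wpM2r; first exact: ltW.
  by apply: ler_wpM2r => //; rewrite addr_ge0// mulr_ge0.
have e2 : `|nsq G / (2 * c * n%:R)| <= 6 * wg / n%:R.
  rewrite ger0_norm; last by rewrite divr_ge0// mulr_ge0// ltW.
  rewrite invfM mulrA ler_wpM2r ?invr_ge0// ler_pdivrMr// (le_trans Gk)//.
  by have := ler_wpM2l (ltW (mulr_gt0 w2 c0)) cu; rewrite /wg; lra.
have e3 : `|omega ^+ 2 / 2 * (c - gamma)| <= b / 2.
  rewrite normrM ger0_norm; last by rewrite divr_ge0// ltW.
  rewrite distrC.
  by have := ler_wpM2l (ltW w2) cg2; rewrite [_ * (b / _)]mulrCA mulfV ?gt_eqF//; lra.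
have e4 : wg * (14 * a) + 6 * wg / n%:R <= b / 2.
  rewrite -(ler_pM2r N0) mulrDl -[_ / n%:R * _]mulrA mulVf ?gt_eqF// mulr1.
  have := ler_wpM2l (ltW wg0) a_le.
  by move: nK3; rewrite ler_pdivrMr ?divr_gt0//; lra.
rewrite E (le_trans (ler_normD _ _))// (le_trans (lerD (ler_normB _ _) e3))//.
lra.
Qed.

Lemma power_bound n p (gamma omega alpha e d eps1 : R) (H : 'M[R]_p)
    (L := cov_root (Sigma n omega H))
    (mu := (n%:R - 1) / (2 * p%:R) * nsq (L *m L^T - 1%:M)) :
  (1 < n)%N -> (0 < p)%N -> 0 < e -> 0 < d ->
  (forall y, `|Ex (iid_law (distribution (iid_law (gauss R) p) (lin_map L)) n)
      (fun t => Phi ((y - mart n L t) / Num.sqrt e)) -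
    Phi (y / Num.sqrt (e + (1 - n%:R^-1)))| <= eps1) ->
  `|Ex (nu n omega H) (@phi_U R alpha n p) - beta_star gamma alpha omega| <=
  eps1 + (1 - Phi (d / Num.sqrt e)) + Phi (- d / Num.sqrt e) +
  (`|Phi_inv (1 - alpha)| + d + `|mu|) * (e + n%:R^-1) + d +
  `|mu - omega ^+ 2 * gamma / 2|.
Proof.
move=> n1 p0 e0 d0 clt; set z := Phi_inv (1 - alpha) : R.
set mu0 := omega ^+ 2 * gamma / 2.
have n0 : (0 < n)%N by exact: ltnW.
have mm := mom_mart n L n.
set P := iid_law _ _ in clt.
have -> : Ex (nu n omega H) (@phi_U R alpha n p) =
   1 - Ex P (fun t => (mart n L t + mu <= z)%R%:R).
  have im : mom P (fun t => (mart n L t + mu <= z)%R%:R).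
    by apply: mom_indic_le; apply: momD; [exact: mm|exact: mom_cst].
  transitivity (Ex P (fun t => 1 - (mart n L t + mu <= z)%R%:R)).
    by apply: Ex_eq => t; exact: (phi_U_mart alpha L t n0 p0).
  by rewrite ExB ?Ex_cst//; exact: mom_cst.
have ni0 : 0 < n%:R^-1 :> R by rewrite invr_gt0 ltr0n.
have ni : n%:R^-1 <= 2^-1 :> R by rewrite lef_pV2 ?posrE ?ltr0n// ler_nat.
have t12 : 1 / 2 <= e + (1 - n%:R^-1) by move: e0 ni; clear; lra.
have tau1 : `|e + (1 - n%:R^-1) - 1| <= e + n%:R^-1.
  by move: e0 ni0; clear; rewrite ler_norml => *; apply/andP; split; lra.
have IA := @indicator_approx _ _ P _ z (z - mu0) mu e d _ _ mm e0 d0 t12 clt.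
have flip (a b : R) : `|1 - a - (1 - b)| = `|a - b|.
  by rewrite distrC; congr (`|_|); ring.
rewrite /beta_star -/z -/mu0 flip.
apply: (le_trans IA); rewrite (_ : z - mu - (z - mu0) = - (mu - mu0)); last by ring.
by rewrite normrN !lerD2r lerD2l ler_wpM2l// !addr_ge0// ltW.
Qed.

Lemma error_budget (eta A t1 t2 z mu e r dmu eps d : R) : d = eta / 8 -> 0 <= d ->
  eps <= d -> 1 - t1 <= d -> t2 <= d -> 0 <= e -> 0 <= r -> z + d + mu <= A ->
  A * e <= d -> A * r <= d -> dmu <= d ->
  eps + (1 - t1) + t2 + (z + d + mu) * (e + r) + d + dmu <= eta.
Proof.
move=> dE d0 h1 h2 h3 e0 r0 hA he hr hm.
have : (z + d + mu) * (e + r) <= A * (e + r) by rewrite ler_wpM2r// addr_ge0.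
by lra.
Qed.

(** The shift d is a fraction of eta; e is chosen so small that the normal tails
    beyond d / sqrt e and the added variance are below d; only then is n taken
    large, depending on the constant of [mart_clt] for this e. *)
Lemma power_uniform (p : nat -> nat) (gamma omega alpha : R) :
  0 < gamma -> (p n)%:R / n%:R @[n --> \oo] --> gamma -> 0 < omega ->
  forall eta : R, 0 < eta -> \forall n \near \oo,
  [/\ (0 < n)%N, (0 < p n)%N & forall H : 'M[R]_(p n), K_rig n H ->
  `|Ex (nu n omega H) (@phi_U R alpha n (p n)) - beta_star gamma alpha omega| <= eta].
Proof.
move=> g0 cvp w0 eta eta0.
set z := Phi_inv (1 - alpha) : R.
pose mu0 := omega ^+ 2 * gamma / 2.
have w2 : 0 < omega ^+ 2 by rewrite exprn_gt0.
have mu00 : 0 < mu0 by rewrite divr_gt0// mulr_gt0.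
pose M := mu0 + 1; pose d := eta / 8.
have d0 : 0 < d by rewrite divr_gt0.
have [x1 x10 hx1] := @Phi_lim0 R d d0; have [x2 x20 hx2] := @Phi_lim1 R d d0.
pose x := x1 + x2; have x0 : 0 < x by rewrite addr_gt0.
pose A := `|z| + d + M.
have A0 : 0 < A by have := normr_ge0 z; rewrite /A /M; lra.
pose e := Num.min ((d / x) ^+ 2) (d / A).
have e0 : 0 < e by rewrite lt_min exprn_gt0 ?divr_gt0.
have s0 : 0 < Num.sqrt e by rewrite sqrtr_gt0.
have xe : x <= d / Num.sqrt e.
  rewrite ler_pdivlMr// mulrC -ler_pdivlMr//.
  have dx0 : 0 <= d / x by rewrite divr_ge0 ?(ltW d0) ?(ltW x0).
  rewrite -(ger0_norm dx0) -sqrtr_sqr ler_wsqrtr//.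
  by rewrite /e ge_min lexx.
have Ae : A * e <= d.
  by rewrite mulrC -ler_pdivlMr// /e ge_min lexx orbT.
have [k1000 _ _ _ _] := bulk_const_ge g0 w0.
have [C C0 hC] := mart_clt k1000 e0.
pose b := Num.min d 1 / 3.
have b0 : 0 < b by rewrite divr_gt0// lt_min d0 ltr01.
have bd : 3 * b <= d by rewrite /b mulrC divfK// ge_min lexx.
have b1 : 3 * b <= 1 by rewrite /b mulrC divfK// ge_min lexx orbT.
pose wg := omega ^+ 2 * gamma; have wg0 : 0 < wg by rewrite mulr_gt0.
pose q := Num.min 1 (b / wg); have q0 : 0 < q by rewrite lt_min ltr01 divr_gt0.
pose g' := Num.min (gamma / 2) (b / omega ^+ 2).
have g'0 : 0 < g' by rewrite lt_min; apply/andP; split; exact: divr_gt0.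
have /cvgrPdist_le /(_ _ g'0) cvg' := cvp.
near=> n.
have n2 : (1 < n)%N by near: n; exact: nbhs_infty_gt.
have n0 : (0 < n)%N by exact: ltnW.
have N0 : 0 < n%:R :> R by rewrite ltr0n.
have cg : `|gamma - (p n)%:R / n%:R| <= g' by near: n; exact: cvg'.
set c := (p n)%:R / n%:R : R in cg.
have cg1 : `|gamma - c| <= gamma / 2 by rewrite (le_trans cg)// ge_min lexx.
have cg2 : `|gamma - c| <= b / omega ^+ 2 by rewrite (le_trans cg)// ge_min lexx orbT.
have c0 : 0 < c by move: cg1; rewrite ler_norml => /andP[]; lra.
have P0 : 0 < (p n)%:R :> R by move: c0; rewrite /c pmulr_lgt0// invr_gt0.
have p0 : (0 < p n)%N by rewrite -(ltr0n R).
split => // H HK.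
have nK1 : 216 * wg <= n%:R by near: n; exact: nbhs_infty_ger.
have nK2 : q ^- 4 <= n%:R by near: n; exact: nbhs_infty_ger.
have nK3 : (252 * wg + 6) * wg / (b / 2) <= n%:R by near: n; exact: nbhs_infty_ger.
have dq := powR_quarter_le q0 nK2.
have dn1 : n%:R `^ (- 4^-1) <= 1 :> R by rewrite (le_trans dq)// ge_min lexx.
have dnb : wg * n%:R `^ (- 4^-1) <= b.
  by rewrite mulrC -ler_pdivlMr// (le_trans dq)// ge_min lexx orbT.
have [pn np Gk Gop mu_dev] := bulk_regime n0 p0 g0 w0 b0 HK cg1 cg2 nK1 nK3 dn1 dnb.
set L := cov_root (Sigma n omega H) in Gk Gop mu_dev.
have clt := hC n (p n) L n0 p0 pn np Gk Gop.
set mu := (n%:R - 1) / _ * _ in mu_dev; rewrite -/mu0 in mu_dev.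
have mu_le : `|mu| <= M.
  rewrite -[mu](subrK mu0) (le_trans (ler_normD _ _))// (gtr0_norm mu00) /M addrC.
  by rewrite lerD2l (le_trans mu_dev).
have nK4 : A / d <= n%:R by near: n; exact: nbhs_infty_ger.
have An : A * n%:R^-1 <= d by rewrite ler_pdivrMr// mulrC -ler_pdivrMr.
have nK5 : (C / d) ^+ 2 <= n%:R by near: n; exact: nbhs_infty_ger.
have Cn : C / Num.sqrt n%:R <= d.
  have sn0 : 0 < Num.sqrt n%:R :> R by rewrite sqrtr_gt0.
  rewrite ler_pdivrMr// mulrC -ler_pdivrMr//.
  have Cd0 : 0 <= C / d by rewrite divr_ge0// ltW.
  rewrite -(ger0_norm Cd0) -sqrtr_sqr.
  by rewrite ler_wsqrtr.
have tl1 : 1 - Phi (d / Num.sqrt e) <= d.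
  have h : Phi x2 <= Phi (d / Num.sqrt e) by apply: Phi_nd; rewrite (le_trans _ xe)// lerDr ltW.
  by rewrite lerBlDr -lerBlDl (le_trans hx2).
have tl2 : Phi (- d / Num.sqrt e) <= d.
  apply: le_trans hx1; apply: Phi_nd.
  by rewrite mulNr lerN2 (le_trans _ xe)// lerDl ltW.
have := power_bound gamma alpha n2 p0 e0 d0 clt; rewrite -/z -/L -/mu -/mu0.
move=> /le_trans; apply; apply: (@error_budget _ A) => //.
- exact: ltW.
- exact: ltW.
- by rewrite lerD2l.
- exact: le_trans mu_dev bd.
Unshelve. all: by end_near. Qed.

End Power.

Theorem lemma3 (R : realType) (p : nat -> nat) (gamma omega alpha : R)
  (p_infty : p n @[n --> \oo] --> \oo)
  (gamma_gt0 : 0 < gamma)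
  (p_ratio : (p n)%:R / n%:R @[n --> \oo] --> gamma)
  (omega_gt0 : 0 < omega)
  (alpha_gt0 : 0 < alpha) (alpha_lt1 : alpha < 1) :
  ereal_sup [set `| 'E_(nu n omega H)[@phi_U R alpha n (p n)]
                    - (beta_star gamma alpha omega)%:E |%E
            | H in @K_rig R n (p n)] @[n --> \oo] --> 0%E.
Proof.
pose S n := ereal_sup [set `| 'E_(nu n omega H)[@phi_U R alpha n (p n)]
  - (beta_star gamma alpha omega)%:E |%E | H in @K_rig R n (p n)].
(* S n >= 0 because the bulk is nonempty; with the upper bound this makes the
   supremum finite, so that convergence can be checked on real numbers. *)
have S_small eta : 0 < eta -> \forall n \near \oo, (0 <= S n <= eta%:E)%E.
  move=> eta0; have := power_uniform alpha gamma_gt0 p_ratio omega_gt0 eta0.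
  apply: filterS => n [n0 p0 hn].
  have EE H : `| 'E_(nu n omega H)[@phi_U R alpha n (p n)] - (beta_star gamma alpha omega)%:E |%E =
      (`|Ex (nu n omega H) (@phi_U R alpha n (p n)) - beta_star gamma alpha omega|)%:E.
    rewrite unlock (Ex_fin (mom_phi_U alpha (cov_root (Sigma n omega H)) n0 p0)).
    by rewrite -EFinB.
  apply/andP; split.
    have Kin := @scalar_in_K_rig R n (p n) p0.
    by apply: le_trans (abse_ge0 _) (ereal_sup_ubound _);
      exists (Num.sqrt (p n)%:R)%:M; [exact: Kin|reflexivity].
  apply: ge_ereal_sup => _ [H HK <-].
  by rewrite EE lee_fin; exact: hn.
apply/fine_cvgP; split.
  have := S_small 1 ltr01; apply: filterS => n /andP[S0 S1].
  by rewrite fin_numElt (lt_le_trans _ S0) ?ltNyr// (le_lt_trans S1) ?ltry.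
apply/cvgr0Pnorm_le => eta eta0.
have := S_small eta eta0; apply: filterS => n /andP[S0 S1] /=.
have Sf : S n \is a fin_num.
  by rewrite fin_numElt (lt_le_trans _ S0) ?ltNyr// (le_lt_trans S1) ?ltry.
by rewrite ger0_norm ?fine_ge0// -lee_fin fineK.
Qed.
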